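(* Let $n\in\mathbb N_0$, $q\in\mathbb C$ with $0<|q|<1$, and let $t,a,b,c,d\in\mathbb C\setminus\{0\}$ with $|t|<1$ and $\max(|a|,|b|,|c|,|d|)<1$, such that no denominator factor below vanishes. Put $z=e^{i\psi}$ and $x=\cos\psi$. Then the Askey--Wilson polynomials $p_n(x;a,b,c,d|q)$ satisfy $$\int_0^\pi p_n(x;a,b,c,d|q)\;{}_2\phi_1\left(az,bz;ab;q,\frac tz\right)\,{}_2\phi_1\left(\frac cz,\frac dz;cd;q,tz\right)\frac{(z^2,z^{-2};q)_\infty}{(az,az^{-1},bz,bz^{-1},cz,cz^{-1},dz,dz^{-1};q)_\infty}\,d\psi$$ $$=\frac{2\pi\,t^n\,(abcd;q)_\infty\left(\sqrt{\tfrac{abcd}q},-\sqrt{\tfrac{abcd}q},ac,ad,bc,bd;q\right)_n}{(q,ab,ac,ad,bc,bd,cd;q)_\infty\left(\tfrac{abcd}q,\sqrt{qabcd},-\sqrt{qabcd};q\right)_n}.$$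
   Context: $(a;q)_n=\prod_{j=0}^{n-1}(1-aq^j)$ for $n\in\mathbb N_0\cup\{\infty\}$, $(a_1,\dots,a_k;q)_n=\prod_i(a_i;q)_n$, and $${}_r\phi_s(a_1,\dots,a_r;b_1,\dots,b_s;q,w)=\sum_{k\ge0}\frac{(a_1,\dots,a_r;q)_k}{(q,b_1,\dots,b_s;q)_k}\left((-1)^kq^{\binom k2}\right)^{1+s-r}w^k .$$ The Askey--Wilson polynomials, for $x=\frac12(z+z^{-1})$, are $$p_n(x;a,b,c,d|q)=a^{-n}(ab,ac,ad;q)_n\;{}_4\phi_3\left(q^{-n},q^{n-1}abcd,az,az^{-1};\ ab,ac,ad;\ q,q\right).$$ *)

(* Defs.v *)
From Stdlib Require Import Reals ZArith List Lra FunctionalExtensionality.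
From Coquelicot Require Import Coquelicot.
Import ListNotations.
Local Open Scope C_scope.

Definition CpowZ (x : C) (m : Z) : C :=
  match m with
  | Z0 => 1
  | Zpos p => x ^ Pos.to_nat p
  | Zneg p => / x ^ Pos.to_nat p
  end.

(** As for [RInt], [iota] returns the unique object with the given property;
    its value is irrelevant when the sequence or series diverges. *)
Definition Clim_seq (u : nat -> C) : C :=
  iota (T := C_R_CompleteNormedModule)
    (fun l : C => filterlim u eventually (locally l)).

Definition CSeries (u : nat -> C) : C :=
  iota (T := C_R_CompleteNormedModule) (fun l : C => is_series u l).

Fixpoint qpoch (a q : C) (n : nat) : C :=
  match n with
  | O => 1
  | S m => qpoch a q m * (1 - a * q ^ m)
  end.

Definition qpoch_inf (a q : C) : C := Clim_seq (qpoch a q).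

Definition qpochs (l : list C) (q : C) (n : nat) : C :=
  fold_right (fun a r => qpoch a q n * r) (RtoC 1) l.

Definition qpochs_inf (l : list C) (q : C) : C :=
  fold_right (fun a r => qpoch_inf a q * r) (RtoC 1) l.

(** The basic hypergeometric series r-phi-s, with r and s the lengths of
    [nums] and [dens]. The exponent 1 + s - r is an integer. *)
Definition qhyper (nums dens : list C) (q w : C) : C :=
  CSeries (fun k : nat =>
    qpochs nums q k / qpochs (q :: dens) q k
    * CpowZ ((- (1)) ^ k * q ^ (k * (k - 1) / 2)%nat)
        (1 + Z.of_nat (length dens) - Z.of_nat (length nums))
    * w ^ k).

Definition askey_wilson_z (n : nat) (z a b c d q : C) : C :=
  CpowZ a (- Z.of_nat n) * qpochs [a * b; a * c; a * d] q n
  * qhyper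
      [CpowZ q (- Z.of_nat n); CpowZ q (Z.of_nat n - 1) * (a * b * c * d);
       a * z; a * / z]
      [a * b; a * c; a * d] q q.

(** The polynomial as a function of x, through x = (z + 1/z) / 2; the choice
    of z is immaterial, see [askey_wilsonE]. *)
Definition askey_wilson (n : nat) (x a b c d q : C) : C :=
  iota (T := C_R_CompleteNormedModule) (fun p : C =>
    exists z : C, z <> 0 /\ x = (z + / z) / 2 /\
                  p = askey_wilson_z n z a b c d q).

Definition expi (psi : R) : C := (cos psi, sin psi).

Lemma CSeries_ext (u v : nat -> C) :
  (forall k, u k = v k) -> CSeries u = CSeries v.
Proof.
intros E; f_equal; now apply functional_extensionality.
Qed.

Lemma askey_wilson_zV (n : nat) (z a b c d q : C) :
  z <> 0 -> askey_wilson_z n (/ z) a b c d q = askey_wilson_z n z a b c d q.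
Proof.
intros Hz.
assert (Hzz : / / z = z) by (field; repeat split; first [exact Hz | exact C1_nz]).
unfold askey_wilson_z, qhyper; rewrite Hzz.
f_equal; apply CSeries_ext; intros k.
unfold qpochs; simpl; f_equal; f_equal; unfold Cdiv; f_equal; ring.
Qed.

Lemma askey_wilsonE (n : nat) (z a b c d q : C) :
  z <> 0 ->
  askey_wilson n ((z + / z) / 2) a b c d q = askey_wilson_z n z a b c d q.
Proof.
intros Hz; unfold askey_wilson.
assert (H2 : RtoC 2 <> 0) by (intros H; apply RtoC_inj in H; lra).
apply (iota_unique (V := C_R_CompleteNormedModule)).
- intros p [y [Hy [E Hp]]].
  assert (Hf : (y - z) * (y * z - 1) = 0).
  { replace ((y - z) * (y * z - 1))
      with (2 * (y * z) * ((y + / y) / 2 - (z + / z) / 2)) by (now field).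
    rewrite E; ring. }
  assert (Hd : y = z \/ y = / z).
  { destruct (Ceq_dec (y - z) 0) as [H0 | H0].
    - left; replace y with ((y - z) + z) by ring; rewrite H0; ring.
    - right; destruct (Ceq_dec (y * z - 1) 0) as [H1 | H1].
      + replace y with ((y * z - 1 + 1) / z) by (now field).
        rewrite H1; now field.
      + now destruct (Cmult_neq_0 _ _ H0 H1). }
  destruct Hd as [-> | ->]; [exact Hp | now rewrite Hp; apply askey_wilson_zV].
- now exists z.
Qed.

(* Main.v *)
Require Import Defs.
From Stdlib Require Import Reals ZArith List Lia Lra Psatz FunctionalExtensionality.
From Coquelicot Require Import Coquelicot.
Import ListNotations.
Local Open Scope C_scope.
Set Bullet Behavior "Strict Subproofs".

(** The product of the two 2-phi-1 series is a generating function of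
    Askey-Wilson polynomials: the coefficient of t^m is
    p_m(x; c,d,a,b | q) / (q, ab, cd; q)_m ([phi21_product_coef]). This is an
    instance of Sears' transformation, and comes from applying the
    q-Saalschuetz sum [q_saalschutz] twice. The series converges uniformly on
    the unit circle ([cauchy_product]), so it may be integrated term by term,
    and the theorem says that p_n(x; a,b,c,d) is orthogonal to all the
    p_m(x; c,d,a,b) but the one with m = n.

    For the orthogonality, p_n(x; a,b,c,d) is expanded in the products
    (az, a/z; q)_k and p_m(x; c,d,a,b) in the products (cz, c/z; q)_j.
    Multiplying the weight by such products replaces a by a q^k and c by c q^j,
    so each integral is a value of the Askey-Wilson integral ([aw_moment]), and
    what remains is a double sum. The inner sum, over the index of the
    polynomial of larger degree, is again a q-Saalschuetz sum; it contains the
    factor (q^(j+1-n); q)_n, which vanishes for j < n ([aw_reduced_sum_0]).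
    When m = n a single term is left ([aw_pair_diagonal]).

    The Askey-Wilson integral ([askey_wilson_integral]) follows from a first
    order recurrence. With w the weight on the unit circle,
      (1 - abcd) w(aq,b,c,d) - (1 - ab)(1 - ac)(1 - ad) w(a,b,c,d)
        = - a (F(z) - F(z/q))
    for a function F that is analytic on the annulus 1 <= |u| <= 1/|q|
    ([aw_flux_difference]); hence F(z) and F(z/q) have the same integral over
    the circle ([contour_shift]) and the integral of the left-hand side
    vanishes. Iterating a -> aq in each of the four parameters reduces the
    integral to the one with all parameters 0 ([aw_integral_reduce]). That
    constant is read off at the parameters q, -q, s, -s with s^2 = q, where the
    weight collapses to (1 - z^2)(1 - 1/z^2) ([aw_integral_0]). *)

(** * Finite sums and the q-Saalschuetz sum *)

Fixpoint csum (f : nat -> C) (n : nat) : C :=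
  match n with O => 0 | S m => csum f m + f m end.

Lemma csum_ext (f g : nat -> C) (n : nat) :
  (forall k, (k < n)%nat -> f k = g k) -> csum f n = csum g n.
Proof.
induction n as [|n IH]; intros E; simpl; [easy|].
rewrite IH, E; auto with arith.
Qed.

Lemma csum_0 (f : nat -> C) (n : nat) :
  (forall k, (k < n)%nat -> f k = 0) -> csum f n = 0.
Proof.
induction n as [|n IH]; intros E; simpl; [easy|].
rewrite IH, E; auto with arith; ring.
Qed.

Lemma csum_last (f : nat -> C) (n : nat) :
  (forall k, (k < n)%nat -> f k = 0) -> csum f (S n) = f n.
Proof. intros H; simpl; rewrite csum_0 by auto; ring. Qed.

Lemma csum_single (f : nat -> C) (n N : nat) : (n < N)%nat ->
  (forall m, m <> n -> f m = 0) -> csum f N = f n.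
Proof.
intros HN Hf; induction N as [|N IH]; [lia|]; simpl.
destruct (Nat.eq_dec n N) as [-> | NE].
- rewrite csum_0; [ring|]; intros k Hk; apply Hf; lia.
- rewrite IH, (Hf N) by lia; ring.
Qed.

Lemma csum_plus (f g : nat -> C) (n : nat) :
  csum (fun k => f k + g k) n = csum f n + csum g n.
Proof. induction n as [|n IH]; simpl; [|rewrite IH]; ring. Qed.

Lemma csum_scal (c : C) (f : nat -> C) (n : nat) :
  csum (fun k => c * f k) n = c * csum f n.
Proof. induction n as [|n IH]; simpl; [|rewrite IH]; ring. Qed.

Lemma csum_scal_r (c : C) (f : nat -> C) (n : nat) :
  csum (fun k => f k * c) n = csum f n * c.
Proof. induction n as [|n IH]; simpl; [|rewrite IH]; ring. Qed.

Lemma csum_recl (f : nat -> C) (n : nat) :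
  csum f (S n) = f O + csum (fun k => f (S k)) n.
Proof.
induction n as [|n IH]; [simpl; ring|].
change (csum f (S (S n))) with (csum f (S n) + f (S n)).
rewrite IH; simpl; ring.
Qed.

Lemma csum_rev (f : nat -> C) (n : nat) :
  csum f (S n) = csum (fun k => f (n - k)%nat) (S n).
Proof.
revert f; induction n as [|n IH]; intros f; [reflexivity|].
rewrite (csum_recl (fun k => f (S n - k)%nat)).
change (csum f (S (S n))) with (csum f (S n) + f (S n)).
rewrite IH, Cplus_comm; f_equal.
Qed.

Lemma csum_swap (f : nat -> nat -> C) (n m : nat) :
  csum (fun i => csum (f i) m) n = csum (fun j => csum (fun i => f i j) n) m.
Proof.
induction n as [|n IH]; simpl.
- symmetry; apply csum_0; auto.
- rewrite IH, <- csum_plus; reflexivity.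
Qed.

Lemma csum_triangle (f : nat -> nat -> C) (m : nat) :
  csum (fun j => csum (f j) (S j)) m
  = csum (fun k => csum (fun i => f (k + i)%nat k) (m - k)) m.
Proof.
induction m as [|m IH]; [reflexivity|].
change (csum (fun j => csum (f j) (S j)) (S m))
  with (csum (fun j => csum (f j) (S j)) m + csum (f m) (S m)).
rewrite IH.
change (csum (fun k => csum (fun i => f (k + i)%nat k) (S m - k)) (S m))
  with (csum (fun k => csum (fun i => f (k + i)%nat k) (S m - k)) m
        + csum (fun i => f (m + i)%nat m) (S m - m)).
replace (S m - m)%nat with 1%nat by lia.
change (csum (f m) (S m)) with (csum (f m) m + f m m).
rewrite Cplus_assoc, <- csum_plus.
f_equal.
- apply csum_ext; intros k Hk.
  replace (S m - k)%nat with (S (m - k)) by lia; simpl.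
  now replace (k + (m - k))%nat with m by lia.
- simpl; rewrite Nat.add_0_r; ring.
Qed.

Lemma qpoch_S (a q : C) (n : nat) :
  qpoch a q (S n) = qpoch a q n * (1 - a * q ^ n).
Proof. reflexivity. Qed.

Lemma qpoch_add (a q : C) (n m : nat) :
  qpoch a q (n + m) = qpoch a q n * qpoch (a * q ^ n) q m.
Proof.
induction m as [|m IH]; [rewrite Nat.add_0_r; simpl; ring|].
rewrite Nat.add_succ_r, !qpoch_S, IH, Cpow_add_r; ring.
Qed.

Lemma qpoch_recl (a q : C) (n : nat) :
  qpoch a q (S n) = (1 - a) * qpoch (a * q) q n.
Proof.
change (S n) with (1 + n)%nat; rewrite qpoch_add, Cpow_1_r; simpl; ring.
Qed.

Lemma one_minus_nz (x : C) : (Cmod x < 1)%R -> 1 - x <> 0.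
Proof.
intros H E; assert (x = 1) as -> by (replace x with (1 - (1 - x)) by ring; rewrite E; ring).
rewrite Cmod_1 in H; lra.
Qed.

Lemma Cmod_pow_le1 (q : C) (n : nat) : (Cmod q < 1)%R -> (Cmod (q ^ n) <= 1)%R.
Proof.
intros H; rewrite Cmod_pow, <- (pow1 n); apply pow_incr.
split; [apply Cmod_ge_0 | lra].
Qed.

Lemma Cmod_mult_lt1 (x y : C) :
  (Cmod x < 1)%R -> (Cmod y <= 1)%R -> (Cmod (x * y) < 1)%R.
Proof.
intros Hx Hy; rewrite Cmod_mult.
assert (0 <= Cmod x)%R by apply Cmod_ge_0; assert (0 <= Cmod y)%R by apply Cmod_ge_0; nra.
Qed.

Lemma qpoch_factor_nz (a q : C) (n : nat) :
  (Cmod q < 1)%R -> (Cmod a < 1)%R -> 1 - a * q ^ n <> 0.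
Proof.
intros Hq Ha; apply one_minus_nz, Cmod_mult_lt1; auto using Cmod_pow_le1.
Qed.

Lemma qpoch_nz (a q : C) (n : nat) :
  (Cmod q < 1)%R -> (Cmod a < 1)%R -> qpoch a q n <> 0.
Proof.
intros Hq Ha; induction n as [|n IH]; [exact C1_nz|].
apply Cmult_neq_0; auto using qpoch_factor_nz.
Qed.

(** The q-Saalschuetz sum is kept in convolution form: (g)_(n-k) / (q)_(n-k)
    replaces the usual (q^-n)_k / (q^(1-n)/g)_k, so that no negative power of q
    occurs. *)
Definition saalschutz_term (x y g q : C) (n k : nat) : C :=
  qpoch x q k * qpoch y q k * g ^ k / (qpoch q q k * qpoch (x * y * g) q k)
  * (qpoch g q (n - k) / qpoch q q (n - k)).

(** Both sides of the q-Saalschuetz sum satisfy the same first order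
    recurrence in n. For the sum it is proved by creative telescoping: the k-th
    summand of the recurrence is h(k) - h(k+1) with h(0) = 0, and the right-hand
    side below is - h(K+1). *)
Lemma saalschutz_partial_sum (x y g q : C) (n K : nat) :
  (Cmod q < 1)%R -> (Cmod (x * y * g) < 1)%R -> (K <= n)%nat ->
  (1 - q * q ^ n) * (1 - x * y * g * q ^ n) * csum (saalschutz_term x y g q (S n)) (S K)
  - (1 - x * g * q ^ n) * (1 - y * g * q ^ n) * csum (saalschutz_term x y g q n) (S K)
  = - (saalschutz_term x y g q n K * (1 - x * q ^ K) * (1 - y * q ^ K) * g * q ^ (n - K)).
Proof.
intros Hq HZ; induction K as [|K IH]; intros HK.
- unfold csum, saalschutz_term; rewrite !Nat.sub_0_r, !qpoch_S; simpl.
  pose proof (qpoch_nz q q n Hq Hq); pose proof (qpoch_factor_nz q q n Hq Hq).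
  field; repeat split; auto; exact C1_nz.
- assert (HK' : (K <= n)%nat) by lia; specialize (IH HK').
  change (csum (saalschutz_term x y g q (S n)) (S (S K)))
    with (csum (saalschutz_term x y g q (S n)) (S K) + saalschutz_term x y g q (S n) (S K)).
  change (csum (saalschutz_term x y g q n) (S (S K)))
    with (csum (saalschutz_term x y g q n) (S K) + saalschutz_term x y g q n (S K)).
  match goal with |- ?A * (?S1 + ?t1) - ?B * (?S2 + ?t2) = ?r =>
    replace (A * (S1 + t1) - B * (S2 + t2))
      with ((A * S1 - B * S2) + (A * t1 - B * t2)) by ring end.
  rewrite IH; clear IH.
  destruct (Nat.le_exists_sub (S K) n HK) as [r [-> _]].
  unfold saalschutz_term.
  replace (r + S K - K)%nat with (S r) by lia.
  replace (S (r + S K) - S K)%nat with (S r) by lia.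
  replace (r + S K - S K)%nat with r by lia.
  rewrite !qpoch_S, !Cpow_add_r, !Cpow_S.
  pose proof (qpoch_nz q q r Hq Hq); pose proof (qpoch_factor_nz q q r Hq Hq).
  pose proof (qpoch_nz q q K Hq Hq); pose proof (qpoch_factor_nz q q K Hq Hq).
  pose proof (qpoch_nz _ q K Hq HZ); pose proof (qpoch_factor_nz _ q K Hq HZ).
  field; repeat split; auto; exact C1_nz.
Qed.

Lemma q_saalschutz (x y g q : C) (n : nat) :
  (Cmod q < 1)%R -> (Cmod (x * y * g) < 1)%R ->
  csum (saalschutz_term x y g q n) (S n)
  = qpoch (x * g) q n * qpoch (y * g) q n / (qpoch q q n * qpoch (x * y * g) q n).
Proof.
intros Hq HZ; induction n as [|n IH].
- unfold saalschutz_term; simpl; field; exact C1_nz.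
- pose proof (saalschutz_partial_sum x y g q n n Hq HZ (le_n n)) as E.
  rewrite IH in E.
  change (csum (saalschutz_term x y g q (S n)) (S (S n)))
    with (csum (saalschutz_term x y g q (S n)) (S n) + saalschutz_term x y g q (S n) (S n)).
  pose proof (qpoch_nz q q n Hq Hq) as Q1; pose proof (qpoch_factor_nz q q n Hq Hq) as Q2.
  pose proof (qpoch_nz _ q n Hq HZ) as Q3; pose proof (qpoch_factor_nz _ q n Hq HZ) as Q4.
  revert E; generalize (csum (saalschutz_term x y g q (S n)) (S n)); intros s E.
  assert (Es : s = ((1 - x * g * q ^ n) * (1 - y * g * q ^ n) *
    (qpoch (x * g) q n * qpoch (y * g) q n / (qpoch q q n * qpoch (x * y * g) q n))
    - saalschutz_term x y g q n n * (1 - x * q ^ n) * (1 - y * q ^ n) * g * q ^ (n - n))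
    / ((1 - q * q ^ n) * (1 - x * y * g * q ^ n))).
  { match type of E with ?A * s - ?B = ?c => 
      replace s with ((A * s - B + B) / A) by (field; auto);
      rewrite E end.
    field; auto. }
  rewrite Es; unfold saalschutz_term; rewrite !Nat.sub_diag, !qpoch_S, !Cpow_S; simpl.
  field; repeat split; auto; exact C1_nz.
Qed.

(** * The coefficients of the generating function *)

Ltac nz := repeat split; repeat apply Cmult_neq_0; auto using Cpow_nz, C1_nz.

(** (-1)^n q^(n(n-1)/2), built as a product to avoid the division by 2. *)
Fixpoint qsgn (q : C) (n : nat) : C :=
  match n with O => 1 | S m => qsgn q m * - q ^ m end.

Lemma qsgn_nz (q : C) (n : nat) : q <> 0 -> qsgn q n <> 0.
Proof.
intros Hq; induction n as [|n IH]; [exact C1_nz|].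
apply Cmult_neq_0; [exact IH|].
intros E; apply (Cpow_nz q n Hq); replace (q ^ n) with (- - q ^ n) by ring; rewrite E; ring.
Qed.

Lemma qsgn_add (q : C) (k i : nat) :
  qsgn q (k + i) = qsgn q k * qsgn q i * (q ^ k) ^ i.
Proof.
induction i as [|i IH]; [rewrite Nat.add_0_r; simpl; ring|].
rewrite Nat.add_succ_r; cbn [qsgn]; rewrite IH, Cpow_add_r, (Cpow_S (q ^ k)); ring.
Qed.

(** Reading the product backwards: 1 - x q^i = - x q^i (1 - q^-i / x). *)
Lemma qpoch_reverse (x q : C) (n : nat) :
  x <> 0 -> q <> 0 ->
  qpoch x q n = qpoch (q / (x * q ^ n)) q n * x ^ n * qsgn q n.
Proof.
intros Hx Hq; induction n as [|n IH]; [simpl; ring|].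
rewrite (qpoch_S x), (qpoch_recl (q / _)), IH, !Cpow_S; cbn [qsgn].
pose proof (Cpow_nz q n Hq).
replace (q / (x * (q * q ^ n)) * q) with (q / (x * q ^ n)) by (field; nz).
replace (1 - q / (x * (q * q ^ n))) with (1 - / (x * q ^ n)) by (field; nz).
field; nz.
Qed.

Lemma qpoch_neg_power (q : C) (m k : nat) :
  q <> 0 -> (k <= m)%nat ->
  qpoch (/ q ^ m) q k * qpoch q q (m - k) * (q ^ m) ^ k = qpoch q q m * qsgn q k.
Proof.
intros Hq; induction k as [|k IH]; intros Hk.
- rewrite Nat.sub_0_r; simpl; ring.
- assert (Hk' : (k <= m)%nat) by lia; specialize (IH Hk').
  cbn [qsgn].
  replace (qpoch q q m * (qsgn q k * - q ^ k)) with (qpoch q q m * qsgn q k * - q ^ k) by ring.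
  rewrite <- IH; clear IH.
  destruct (Nat.le_exists_sub (S k) m Hk) as [r [-> _]].
  replace (r + S k - S k)%nat with r by lia.
  replace (r + S k - k)%nat with (S r) by lia.
  rewrite !qpoch_S, (Cpow_S (q ^ (r + S k))).
  replace (q ^ (r + S k)) with (q * q ^ r * q ^ k) by (rewrite Cpow_add_r, Cpow_S; ring).
  pose proof (Cpow_nz q r Hq); pose proof (Cpow_nz q k Hq).
  field; nz.
Qed.

Definition aw_coef (n k : nat) (a b c d q : C) : C :=
  qpoch (/ q ^ n) q k * qpoch (a * b * c * d * q ^ n / q) q k * q ^ k
  / (qpoch q q k * qpoch (a * b) q k * qpoch (a * c) q k * qpoch (a * d) q k).

(** The Askey-Wilson polynomial as a function of z, with the terminating 4-phi-3
    series written as a finite sum. *)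
Definition aw_poly (n : nat) (z a b c d q : C) : C :=
  / a ^ n * (qpoch (a * b) q n * qpoch (a * c) q n * qpoch (a * d) q n)
  * csum (fun k => aw_coef n k a b c d q * (qpoch (a * z) q k * qpoch (a / z) q k)) (S n).

(** The coefficient of t^i in 2-phi-1(az, bz; ab; q, t/z). The second series of
    the generating function is the same one with c, d and 1/z for a, b and z. *)
Definition phi21_coef (a b q z : C) (i : nat) : C :=
  qpoch (a * z) q i * qpoch (b * z) q i / (qpoch q q i * qpoch (a * b) q i) * (/ z) ^ i.

(** The q-Saalschuetz sum with x = az, y = bz and g = c/z, in reversed order and
    multiplied by (abcz; q)_M / c^M. It performs the inner summation in the proof of
    Sears' transformation. *)
Lemma sears_inner (a b c q z : C) (M : nat) :
  (Cmod q < 1)%R -> z <> 0 -> c <> 0 -> (Cmod (a * b * c * z) < 1)%R ->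
  csum (fun i => qpoch (a * z) q (M - i) * qpoch (b * z) q (M - i) * (/ z) ^ (M - i)
                 / qpoch q q (M - i) * qpoch (c / z) q i / qpoch q q i
                 * qpoch (a * b * c * z * q ^ (M - i)) q i * (/ c) ^ i) (S M)
  = (/ c) ^ M * qpoch (a * c) q M * qpoch (b * c) q M / qpoch q q M.
Proof.
intros Hq Hz Hc HZ.
assert (EZ : a * z * (b * z) * (c / z) = a * b * c * z) by (field; nz).
pose proof (q_saalschutz (a * z) (b * z) (c / z) q M Hq) as SA.
rewrite EZ in SA; specialize (SA HZ); rewrite csum_rev in SA.
replace (a * z * (c / z)) with (a * c) in SA by (field; nz).
replace (b * z * (c / z)) with (b * c) in SA by (field; nz).
pose proof (qpoch_nz _ q M Hq HZ) as NZ; pose proof (qpoch_nz q q M Hq Hq) as Nq.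
transitivity ((/ c) ^ M * qpoch (a * b * c * z) q M
  * csum (fun k => saalschutz_term (a * z) (b * z) (c / z) q M (M - k)) (S M)).
- rewrite <- csum_scal; apply csum_ext; intros i Hi.
  unfold saalschutz_term; rewrite EZ.
  destruct (Nat.le_exists_sub i M ltac:(lia)) as [r [-> _]].
  replace (r + i - i)%nat with r by lia; replace (r + i - r)%nat with i by lia.
  rewrite (qpoch_add _ q r i), !Cpow_add_r.
  replace ((c / z) ^ r) with (c ^ r * (/ z) ^ r) by (unfold Cdiv; now rewrite Cpow_mult_l).
  rewrite !Cpow_inv by auto.
  pose proof (Cpow_nz c r Hc); pose proof (Cpow_nz c i Hc); pose proof (Cpow_nz z r Hz).
  pose proof (qpoch_nz q q r Hq Hq); pose proof (qpoch_nz q q i Hq Hq).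
  pose proof (qpoch_nz _ q r Hq HZ).
  field; nz.
- rewrite SA; field; nz.
Qed.

(** Bookkeeping of the powers of q when a double sum over j = k + i is reordered. *)
Lemma sears_exponents (q s ab cz : C) (k i r : nat) :
  s * q = ab * cz * q ^ (k + i + r) ->
  (ab * q ^ r) ^ (k + i) * qsgn q (k + i) * cz ^ (k + i) * (q ^ k) ^ k * (q ^ k) ^ i
  = qsgn q k * (s ^ k * q ^ k) * ((ab * cz * q ^ (k + r)) ^ i * qsgn q i).
Proof.
intros Es; rewrite <- (Cpow_mult_l s q), Es, qsgn_add, !Cpow_add_r, !Cpow_mult_l.
rewrite (eq_trans (eq_sym (Cpow_mult_r q i k)) (eq_trans (f_equal _ (Nat.mul_comm i k)) (Cpow_mult_r q k i))).
ring.
Qed.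

(** Sears' transformation in the case that identifies the generating function.
    The factors of the j-th term that carry d are expanded over k <= j by the
    q-Saalschuetz sum; after interchanging the summations, the sum over j - k
    is [sears_inner] with c q^k for c. *)
Lemma phi21_product_coef (a b c d q z : C) (m : nat) :
  (0 < Cmod q < 1)%R -> a <> 0 -> b <> 0 -> c <> 0 -> d <> 0 -> z <> 0 ->
  (Cmod (a * b) < 1)%R -> (Cmod (c * d) < 1)%R -> (Cmod (c * a) < 1)%R ->
  (Cmod (c * b) < 1)%R -> (Cmod (a * b * c * z) < 1)%R ->
  csum (fun j => phi21_coef a b q z (m - j) * phi21_coef c d q (/ z) j) (S m)
  = aw_poly m z c d a b q / (qpoch q q m * qpoch (a * b) q m * qpoch (c * d) q m).
Proof.
intros [Hq0 Hq] Ha Hb Hc Hd Hz Hab Hcd Hca Hcb HZ.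
assert (Hqn : q <> 0) by (apply Cmod_gt_0; exact Hq0).
(* With x = cz, y = Y and g = 1/s the right-hand side of the q-Saalschuetz sum
   contains (d/z)_j and (q/(ab q^m))_j, the latter being (ab q^(m-j))_j reversed. *)
set (s := a * b * (c * z) * q ^ m / q).
set (Y := c * d * a * b * q ^ m / q).
assert (Hs : s <> 0).
{ unfold s, Cdiv; repeat apply Cmult_neq_0; auto using Cpow_nz.
  intros E; apply C1_nz; rewrite <- (Cinv_r q Hqn), E; ring. }
pose proof (qpoch_nz _ q m Hq Hab) as Nab.
set (F := fun j k : nat =>
  qpoch (a * z) q (m - j) * qpoch (b * z) q (m - j) * (/ z) ^ (m - j)
  / qpoch q q (m - j) / qpoch (a * b) q m * qpoch (c / z) q j * z ^ j
  * (a * b * q ^ (m - j)) ^ j * qsgn q j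
  * saalschutz_term (c * z) Y (/ s) q j k).
transitivity (csum (fun j => csum (F j) (S j)) (S m)).
{ apply csum_ext; intros j Hj; unfold F; rewrite csum_scal, q_saalschutz; auto.
  2: { replace (c * z * Y * / s) with (c * d)
         by (unfold s, Y; field; nz); auto. }
  replace (c * z * Y * / s) with (c * d) by (unfold s, Y; field; nz).
  replace (Y * / s) with (d / z) by (unfold s, Y; field; nz).
  replace (c * z * / s) with (q / (a * b * q ^ m))
    by (unfold s, Y; field; nz).
  destruct (Nat.le_exists_sub j m ltac:(lia)) as [r [-> _]].
  replace (r + j - j)%nat with r by lia.
  assert (E : qpoch (a * b * q ^ r) q j
     = qpoch (q / (a * b * q ^ (r + j))) q j * (a * b * q ^ r) ^ j * qsgn q j).
  { rewrite (qpoch_reverse (a * b * q ^ r)) by (repeat apply Cmult_neq_0; auto using Cpow_nz).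
    now rewrite Cpow_add_r, Cmult_assoc. }
  rewrite (qpoch_add (a * b)) in Nab |- *.
  pose proof (qpoch_nz q q r Hq Hq); pose proof (qpoch_nz q q j Hq Hq).
  pose proof (qpoch_nz _ q r Hq Hab); pose proof (qpoch_nz _ q j Hq Hcd).
  assert (Nj : qpoch (a * b * q ^ r) q j <> 0) by (intros E0; apply Nab; rewrite E0; ring).
  assert (qpoch (q / (a * b * q ^ (r + j))) q j <> 0)
    by (intros E0; apply Nj; rewrite E, E0; ring).
  assert ((a * b * q ^ r) ^ j <> 0) by (apply Cpow_nz; nz).
  pose proof (qsgn_nz q j Hqn).
  transitivity (phi21_coef a b q z r * phi21_coef c d q (/ z) j * qpoch (a * b * q ^ r) q j
    / (qpoch (q / (a * b * q ^ (r + j))) q j * (a * b * q ^ r) ^ j * qsgn q j)).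
  { rewrite <- E; field; nz. }
  unfold phi21_coef.
  replace (/ / z) with z by (field; nz).
  change (c * / z) with (c / z); change (d * / z) with (d / z).
  rewrite E; field; nz. }
rewrite csum_triangle; unfold aw_poly.
match goal with |- _ = ?A * ?B / ?D => transitivity (A / D * B);
  [|unfold Cdiv; ring] end.
rewrite <- csum_scal.
apply csum_ext; intros k Hk.
replace (S m - k)%nat with (S (m - k)) by lia.
assert (Hck : (Cmod (a * b * (c * q ^ k) * z) < 1)%R).
{ replace (a * b * (c * q ^ k) * z) with (a * b * c * z * q ^ k) by ring.
  apply Cmod_mult_lt1; auto using Cmod_pow_le1. }
assert (Hcqk : c * q ^ k <> 0) by (apply Cmult_neq_0; auto using Cpow_nz).
pose proof (sears_inner a b (c * q ^ k) q z (m - k) Hq Hz Hcqk Hck) as SI.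
set (K := qpoch (c * z) q k * qpoch (c / z) q k * qpoch Y q k
  / (qpoch q q k * qpoch (c * d) q k * qpoch (a * b) q m)
  * qsgn q k * q ^ k / ((q ^ k) ^ k * c ^ k)).
transitivity (K * csum (fun i => qpoch (a * z) q (m - k - i) * qpoch (b * z) q (m - k - i)
   * (/ z) ^ (m - k - i) / qpoch q q (m - k - i) * qpoch (c * q ^ k / z) q i / qpoch q q i
   * qpoch (a * b * (c * q ^ k) * z * q ^ (m - k - i)) q i * (/ (c * q ^ k)) ^ i) (S (m - k))).
{ rewrite <- csum_scal; apply csum_ext; intros i Hi.
  unfold F, saalschutz_term.
  replace (k + i - k)%nat with i by lia.
  replace (m - (k + i))%nat with (m - k - i)%nat by lia.
  assert (Em : exists r, m = (k + i + r)%nat) by (exists (m - (k + i))%nat; lia).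
  destruct Em as [r Em].
  replace (m - k - i)%nat with r by lia.
  replace (c * z * Y * / s) with (c * d) by (unfold s, Y; field; nz).
  assert (X := sears_exponents q s (a * b) (c * z) k i r).
  rewrite <- Em in X.
  assert (Es : s * q = a * b * (c * z) * q ^ m) by (unfold s; field; nz).
  specialize (X Es).
  assert (R : qpoch (a * b * (c * z) * q ^ (k + r)) q i
    = qpoch (/ s) q i * (a * b * (c * z) * q ^ (k + r)) ^ i * qsgn q i).
  { rewrite qpoch_reverse by (repeat apply Cmult_neq_0; auto using Cpow_nz).
    do 3 f_equal. unfold s; rewrite Em.
    replace (q ^ (k + i + r)) with (q ^ (k + r) * q ^ i)
      by (rewrite <- Cpow_add_r; f_equal; lia).
    field; nz. }
  replace (a * b * (c * q ^ k) * z * q ^ r) with (a * b * (c * z) * q ^ (k + r))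
    by (rewrite Cpow_add_r; ring).
  rewrite R.
  rewrite (qpoch_add (c / z)).
  replace (c / z * q ^ k) with (c * q ^ k / z) by (field; nz).
  rewrite !Cpow_inv by auto.
  unfold K.
  rewrite (Cpow_add_r z), (Cpow_mult_l c).
  rewrite (Cpow_add_r (c * z)), !(Cpow_mult_l c z) in X.
  pose proof (Cpow_nz z k Hz); pose proof (Cpow_nz z i Hz).
  pose proof (Cpow_nz z r Hz).
  pose proof (Cpow_nz c k Hc); pose proof (Cpow_nz c i Hc).
  pose proof (Cpow_nz s k Hs); pose proof (Cpow_nz q k Hqn).
  pose proof (Cpow_nz (q ^ k) k (Cpow_nz q k Hqn)).
  pose proof (Cpow_nz (q ^ k) i (Cpow_nz q k Hqn)).
  pose proof (qpoch_nz q q r Hq Hq); pose proof (qpoch_nz q q i Hq Hq).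
  pose proof (qpoch_nz q q k Hq Hq); pose proof (qpoch_nz _ q k Hq Hcd).
  match goal with |- context [?x * (a * b * q ^ r) ^ (k + i) * qsgn q (k + i)] =>
    replace (x * (a * b * q ^ r) ^ (k + i) * qsgn q (k + i)) with 
     (x * ((a * b * q ^ r) ^ (k + i) * qsgn q (k + i))) by ring end.
  replace ((a * b * q ^ r) ^ (k + i) * qsgn q (k + i)) with
    (qsgn q k * (s ^ k * q ^ k) * ((a * b * (c * z) * q ^ (k + r)) ^ i * qsgn q i)
      / (c ^ k * z ^ k * (c ^ i * z ^ i) * (q ^ k) ^ k * (q ^ k) ^ i)).
  2: { rewrite <- X; field; nz. }
  field; nz. }
rewrite SI; unfold K, aw_coef; fold Y.
pose proof (qpoch_neg_power q m k Hqn ltac:(lia)) as NP.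
assert (Em : exists r, m = (k + r)%nat) by (exists (m - k)%nat; lia).
destruct Em as [r Em].
replace (m - k)%nat with r in * by lia.
pose proof (qpoch_nz q q m Hq Hq).
pose proof (qpoch_nz q q r Hq Hq).
pose proof (qpoch_nz q q k Hq Hq); pose proof (qpoch_nz _ q k Hq Hcd).
pose proof (qpoch_nz _ q m Hq Hcd).
pose proof (qpoch_nz _ q k Hq Hca); pose proof (qpoch_nz _ q k Hq Hcb).
pose proof (Cpow_nz q k Hqn). pose proof (Cpow_nz q r Hqn).
pose proof (Cpow_nz (q ^ k) k (Cpow_nz q k Hqn)).
pose proof (Cpow_nz (q ^ m) k (Cpow_nz q m Hqn)).
pose proof (Cpow_nz c k Hc). pose proof (Cpow_nz c r Hc).
pose proof (Cpow_nz (q ^ k) r (Cpow_nz q k Hqn)).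
pose proof (Cpow_nz (q ^ r) k (Cpow_nz q r Hqn)).
replace (qpoch (/ q ^ m) q k) with
  (qpoch q q m * qsgn q k / (qpoch q q r * (q ^ m) ^ k)) by (rewrite <- NP; field; nz).
replace ((q ^ m) ^ k) with ((q ^ k) ^ k * (q ^ k) ^ r).
2: { rewrite Em, Cpow_add_r, Cpow_mult_l; f_equal.
     now rewrite <- !Cpow_mult_r, Nat.mul_comm. }
rewrite Cpow_inv by auto.
replace (qpoch (c * a) q m) with (qpoch (c * a) q k * qpoch (a * (c * q ^ k)) q r)
  by (rewrite Em, qpoch_add; do 2 f_equal; ring).
replace (qpoch (c * b) q m) with (qpoch (c * b) q k * qpoch (b * (c * q ^ k)) q r)
  by (rewrite Em, qpoch_add; do 2 f_equal; ring).
replace (c ^ m) with (c ^ k * c ^ r) by (rewrite Em, Cpow_add_r; auto).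
rewrite (Cpow_mult_l c).
field; nz.
Qed.

(** * Uniform limits *)

Definition ulim {X : Type} (f : nat -> X -> C) (g : X -> C) : Prop :=
  forall eps : R, (0 < eps)%R ->
  exists N, forall n, (N <= n)%nat -> forall x, (Cmod (f n x - g x) < eps)%R.

Definition bounded {X : Type} (f : X -> C) : Prop :=
  exists M : R, forall x, (Cmod (f x) <= M)%R.

(** The special case of one point, so that the rules for [ulim] apply to sequences. *)
Definition clim (u : nat -> C) (l : C) : Prop :=
  ulim (fun n (_ : unit) => u n) (fun _ => l).

Lemma bounded_pos {X : Type} (f : X -> C) :
  bounded f -> exists M : R, (0 < M)%R /\ forall x, (Cmod (f x) <= M)%R.
Proof.
intros [M HM]; exists (Rmax M 1); split.
- apply Rlt_le_trans with 1%R; [lra | apply Rmax_r].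
- intros x; eapply Rle_trans; [apply HM | apply Rmax_l].
Qed.

Lemma bounded_const {X : Type} (c : C) : bounded (fun _ : X => c).
Proof. exists (Cmod c); intros; lra. Qed.

Lemma bounded_plus {X : Type} (f g : X -> C) :
  bounded f -> bounded g -> bounded (fun x => f x + g x).
Proof.
intros [M HM] [M' HM']; exists (M + M')%R; intros x.
eapply Rle_trans; [apply Cmod_triangle | now apply Rplus_le_compat].
Qed.

Lemma bounded_mult {X : Type} (f g : X -> C) :
  bounded f -> bounded g -> bounded (fun x => f x * g x).
Proof.
intros [M HM] [M' HM']; exists (M * M')%R; intros x.
rewrite Cmod_mult; apply Rmult_le_compat; auto using Cmod_ge_0.
Qed.

Lemma ulim_const {X : Type} (f : X -> C) : ulim (fun _ => f) f.
Proof.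
intros eps He; exists O; intros n _ x.
replace (f x - f x) with (RtoC 0) by ring; rewrite Cmod_0; lra.
Qed.

Lemma ulim_ext {X : Type} (f f' : nat -> X -> C) (g g' : X -> C) :
  (forall n x, f n x = f' n x) -> (forall x, g x = g' x) -> ulim f g -> ulim f' g'.
Proof.
intros E E' H eps He; destruct (H eps He) as [N HN]; exists N; intros n Hn x.
rewrite <- E, <- E'; auto.
Qed.

Lemma ulim_mult {X : Type} (f f' : nat -> X -> C) (g g' : X -> C) :
  bounded g -> bounded g' -> ulim f g -> ulim f' g' ->
  ulim (fun n x => f n x * f' n x) (fun x => g x * g' x).
Proof.
intros B B' H H' eps He.
destruct (bounded_pos _ B) as [M [M0 HM]]; destruct (bounded_pos _ B') as [M' [M0' HM']].
set (e1 := Rmin 1 (eps / (2 * (M' + 1)))); set (e2 := (eps / (2 * M))%R).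
assert (E1 : (0 < e1)%R) by (apply Rmin_pos; [lra | apply Rdiv_lt_0_compat; lra]).
assert (E2 : (0 < e2)%R) by (apply Rdiv_lt_0_compat; lra).
destruct (H e1 E1) as [N HN]; destruct (H' (Rmin 1 e2) ltac:(apply Rmin_pos; lra)) as [N' HN'].
exists (Nat.max N N'); intros n Hn x.
specialize (HN n ltac:(lia) x); specialize (HN' n ltac:(lia) x).
replace (f n x * f' n x - g x * g' x)
  with ((f n x - g x) * f' n x + g x * (f' n x - g' x)) by ring.
eapply Rle_lt_trans; [apply Cmod_triangle|].
rewrite !Cmod_mult.
assert (F' : (Cmod (f' n x) <= M' + 1)%R).
{ replace (f' n x) with ((f' n x - g' x) + g' x) by ring.
  eapply Rle_trans; [apply Cmod_triangle|].
  pose proof (Rmin_l 1 e2); specialize (HM' x); lra. }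
assert (A1 : (Cmod (f n x - g x) * Cmod (f' n x) <= eps / 2)%R).
{ apply Rle_trans with (eps / (2 * (M' + 1)) * (M' + 1))%R.
  - apply Rmult_le_compat; auto using Cmod_ge_0.
    pose proof (Rmin_r 1 (eps / (2 * (M' + 1)))); unfold e1 in HN; lra.
  - right; field; lra. }
assert (A2 : (Cmod (g x) * Cmod (f' n x - g' x) < eps / 2)%R).
{ apply Rle_lt_trans with (M * Cmod (f' n x - g' x))%R.
  - apply Rmult_le_compat_r; auto using Cmod_ge_0.
  - apply Rlt_le_trans with (M * e2)%R.
    + apply Rmult_lt_compat_l; auto; pose proof (Rmin_r 1 e2); lra.
    + right; unfold e2; field; lra. }
lra.
Qed.

Lemma ulim_plus {X : Type} (f f' : nat -> X -> C) (g g' : X -> C) :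
  ulim f g -> ulim f' g' -> ulim (fun n x => f n x + f' n x) (fun x => g x + g' x).
Proof.
intros H H' eps He.
destruct (H (eps / 2)%R ltac:(lra)) as [N HN]; destruct (H' (eps / 2)%R ltac:(lra)) as [N' HN'].
exists (Nat.max N N'); intros n Hn x.
specialize (HN n ltac:(lia) x); specialize (HN' n ltac:(lia) x).
replace (f n x + f' n x - (g x + g' x)) with ((f n x - g x) + (f' n x - g' x)) by ring.
eapply Rle_lt_trans; [apply Cmod_triangle|]; lra.
Qed.

Lemma ulim_inv {X : Type} (f : nat -> X -> C) (g : X -> C) (M : R) :
  (forall n x, f n x <> 0) -> (forall x, g x <> 0) ->
  (forall n x, (Cmod (/ f n x) <= M)%R) -> (forall x, (Cmod (/ g x) <= M)%R) ->
  ulim f g -> ulim (fun n x => / f n x) (fun x => / g x).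
Proof.
intros F G HF HG H eps He.
set (M1 := (Rmax M 1)).
assert (P : (0 < M1)%R) by (apply Rlt_le_trans with 1%R; [lra | apply Rmax_r]).
assert (Q : (M <= M1)%R) by apply Rmax_l.
destruct (H (eps / (M1 * M1))%R ltac:(apply Rdiv_lt_0_compat; [lra | nra])) as [N HN].
exists N; intros n Hn x; specialize (HN n Hn x).
replace (/ f n x - / g x) with (/ f n x * / g x * - (f n x - g x)) by (field; auto).
rewrite !Cmod_mult, Cmod_opp.
specialize (HF n x); specialize (HG x).
apply Rle_lt_trans with (M1 * M1 * Cmod (f n x - g x))%R.
- apply Rmult_le_compat_r; auto using Cmod_ge_0.
  apply Rmult_le_compat; auto using Cmod_ge_0; lra.
- apply Rlt_le_trans with (M1 * M1 * (eps / (M1 * M1)))%R.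
  + apply Rmult_lt_compat_l; [nra | auto].
  + right; field; lra.
Qed.

Lemma ulim_tail {X : Type} (f : nat -> X -> C) (g : X -> C) (K rho : R) :
  (0 <= rho < 1)%R ->
  (forall n x, (Cmod (f n x - g x) <= K * rho ^ n)%R) -> ulim f g.
Proof.
intros Hr H eps He.
set (K1 := Rmax K 1).
assert (P : (0 < K1)%R) by (apply Rlt_le_trans with 1%R; [lra | apply Rmax_r]).
assert (Q : (K <= K1)%R) by apply Rmax_l.
destruct (pow_lt_1_zero rho) with (y := (eps / K1)%R) as [N HN].
- rewrite Rabs_pos_eq; lra.
- apply Rdiv_lt_0_compat; lra.
- exists N; intros n Hn x; specialize (HN n Hn).
  assert (R0 : (0 <= rho ^ n)%R) by (apply pow_le; lra).
  rewrite Rabs_pos_eq in HN by auto.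
  eapply Rle_lt_trans; [apply H|].
  apply Rle_lt_trans with (K1 * rho ^ n)%R; [now apply Rmult_le_compat_r|].
  apply Rlt_le_trans with (K1 * (eps / K1))%R; [now apply Rmult_lt_compat_l|].
  right; field; lra.
Qed.

Lemma clim_unique (u : nat -> C) (l l' : C) : clim u l -> clim u l' -> l = l'.
Proof.
intros H H'.
destruct (Ceq_dec (l - l') 0) as [E | E].
- replace l with ((l - l') + l') by ring; rewrite E; ring.
- apply Cmod_gt_0 in E.
  destruct (H (Cmod (l - l') / 2)%R ltac:(lra)) as [N HN].
  destruct (H' (Cmod (l - l') / 2)%R ltac:(lra)) as [N' HN'].
  specialize (HN (Nat.max N N') ltac:(lia) tt); specialize (HN' (Nat.max N N') ltac:(lia) tt).
  simpl in HN, HN'.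
  assert (Cmod (l - l') < Cmod (l - l'))%R; [|lra].
  replace (l - l') with (- (u (Nat.max N N') - l) + (u (Nat.max N N') - l')) at 1 by ring.
  eapply Rle_lt_trans; [apply Cmod_triangle|].
  rewrite Cmod_opp; lra.
Qed.

Lemma clim_bound (u : nat -> C) (l c : C) (K : R) :
  clim u l -> (forall n, (Cmod (u n - c) <= K)%R) -> (Cmod (l - c) <= K)%R.
Proof.
intros H B; apply le_epsilon; intros eps He.
destruct (H eps He) as [N HN]; specialize (HN N (le_n N) tt); simpl in HN.
replace (l - c) with (- (u N - l) + (u N - c)) by ring.
eapply Rle_trans; [apply Cmod_triangle|]; rewrite Cmod_opp; specialize (B N); lra.
Qed.

Lemma clim_shift (u : nat -> C) (l : C) (k : nat) :
  clim u l -> clim (fun n => u (k + n)%nat) l.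
Proof.
intros H eps He; destruct (H eps He) as [N HN]; exists N; intros n Hn x.
apply (HN (k + n)%nat ltac:(lia) x).
Qed.

Lemma clim_mult (u v : nat -> C) (l m : C) :
  clim u l -> clim v m -> clim (fun n => u n * v n) (l * m).
Proof. apply ulim_mult; apply bounded_const. Qed.

Lemma clim_const (c : C) : clim (fun _ => c) c.
Proof. apply ulim_const. Qed.

Lemma clim_ext (u v : nat -> C) (l : C) :
  (forall n, u n = v n) -> clim u l -> clim v l.
Proof. intros E; apply ulim_ext; auto. Qed.

Lemma clim_filterlim (u : nat -> C) (l : C) :
  filterlim u eventually (locally (T := C_R_CompleteNormedModule) l) <-> clim u l.
Proof.
split.
- intros H eps He.
  assert (He' : (0 < eps / 2)%R) by lra.
  destruct (proj1 (filterlim_locally (U := C_R_CompleteNormedModule) u l) H (mkposreal _ He')) as [N HN].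
  exists N; intros n Hn _; destruct (HN n Hn) as [B1 B2].
  unfold ball in B1, B2; simpl in B1, B2.
  unfold AbsRing_ball, abs, minus, plus, opp in B1, B2; simpl in B1, B2.
  eapply Rle_lt_trans; [apply Cmod_2Rmax|].
  assert (Hm : (Rmax (Rabs (fst (u n - l)%C)) (Rabs (snd (u n - l)%C)) < eps / 2)%R).
  { apply Rmax_lub_lt; simpl; auto. }
  assert (S2 : (sqrt 2 <= 2)%R).
  { rewrite <- (sqrt_Rsqr 2) at 2 by lra; apply sqrt_le_1_alt; unfold Rsqr; lra. }
  assert (0 <= sqrt 2)%R by apply sqrt_pos.
  assert (0 <= Rmax (Rabs (fst (u n - l)%C)) (Rabs (snd (u n - l)%C)))%R
    by (eapply Rle_trans; [apply Rabs_pos | apply Rmax_l]).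
  nra.
- intros H; apply (filterlim_locally (U := C_R_CompleteNormedModule) u l); intros eps.
  destruct (H eps (cond_pos eps)) as [N HN]; exists N; intros n Hn.
  apply C_NormedModule_mixin_compat1, (HN n Hn tt).
Qed.

Lemma Clim_seq_eq (u : nat -> C) (l : C) : clim u l -> Clim_seq u = l.
Proof.
intros H; apply (iota_unique (V := C_R_CompleteNormedModule)).
- intros y Hy; apply (clim_unique u); auto; now apply clim_filterlim.
- now apply clim_filterlim.
Qed.

Lemma sum_n_csum (u : nat -> C) (n : nat) :
  sum_n (G := C_R_CompleteNormedModule) u n = csum u (S n).
Proof.
induction n as [|n IH].
- rewrite sum_O; simpl; ring.
- rewrite sum_Sn, IH; reflexivity.
Qed.

Lemma CSeries_eq (u : nat -> C) (l : C) : clim (csum u) l -> CSeries u = l.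
Proof.
assert (E : forall v l', is_series (V := C_R_CompleteNormedModule) v l' <-> clim (fun n => csum v (S n)) l').
{ intros v l'; unfold is_series; rewrite clim_filterlim; split; apply clim_ext;
    intros n; now rewrite sum_n_csum. }
intros H; apply (iota_unique (V := C_R_CompleteNormedModule)).
- intros y Hy; apply (clim_unique (fun n => csum u (S n))); [now apply E|].
  apply (clim_shift _ _ 1 H).
- apply E, (clim_shift _ _ 1 H).
Qed.

Lemma CSeries_finite (u : nat -> C) (n : nat) :
  (forall k, (n <= k)%nat -> u k = 0) -> CSeries u = csum u n.
Proof.
intros H; apply CSeries_eq; intros eps He; exists n; intros m Hm _.
replace (csum u m) with (csum u n).
{ replace (csum u n - csum u n) with (RtoC 0) by ring; rewrite Cmod_0; lra. }
destruct (Nat.le_exists_sub n m Hm) as [p [-> _]]; clear Hm.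
induction p as [|p IH]; [reflexivity|].
simpl; rewrite <- IH, H by lia; ring.
Qed.

Lemma geometric_increments (u : nat -> C) (K rho : R) (n p : nat) :
  (0 <= rho < 1)%R -> (forall n, (Cmod (u (S n) - u n) <= K * rho ^ n)%R) ->
  (Cmod (u (n + p)%nat - u n) <= K * rho ^ n * ((1 - rho ^ p) / (1 - rho)))%R.
Proof.
intros Hr H; induction p as [|p IH].
- rewrite Nat.add_0_r; replace (u n - u n) with (RtoC 0) by ring.
  rewrite Cmod_0; simpl; right; field; lra.
- rewrite Nat.add_succ_r.
  replace (u (S (n + p)) - u n) with ((u (S (n + p)) - u (n + p)%nat) + (u (n + p)%nat - u n))
    by ring.
  eapply Rle_trans; [apply Cmod_triangle|].
  eapply Rle_trans; [apply Rplus_le_compat; [apply H | apply IH]|].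
  rewrite pow_add; simpl; right; field; lra.
Qed.

(** Completeness of C with a rate: the geometric bound on the increments makes the convergence uniform in
    any parameter on which K does not depend. *)
Lemma geometric_limit (u : nat -> C) (K rho : R) :
  (0 <= rho < 1)%R -> (forall n, (Cmod (u (S n) - u n) <= K * rho ^ n)%R) ->
  exists l, clim u l /\ forall n, (Cmod (u n - l) <= K / (1 - rho) * rho ^ n)%R.
Proof.
intros Hr H.
assert (K0 : (0 <= K)%R).
{ specialize (H O); simpl in H; pose proof (Cmod_ge_0 (u 1%nat - u O)); lra. }
assert (B : forall n m, (n <= m)%nat -> (Cmod (u m - u n) <= K / (1 - rho) * rho ^ n)%R).
{ intros n m Hnm; replace m with (n + (m - n))%nat by lia.
  eapply Rle_trans; [apply (geometric_increments u K rho n (m - n) Hr H)|].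
  assert (0 <= rho ^ n)%R by (apply pow_le; lra).
  assert (0 <= rho ^ (m - n))%R by (apply pow_le; lra).
  assert (0 < / (1 - rho))%R by (apply Rinv_0_lt_compat; lra).
  unfold Rdiv; assert (0 <= K * rho ^ n * / (1 - rho))%R
    by (apply Rmult_le_pos; [apply Rmult_le_pos|]; lra).
  nra. }
assert (cvg : forall pr : C -> R, (forall x y, pr x - pr y = pr (x - y)%C)%R ->
   (forall x, (Rabs (pr x) <= Cmod x)%R) -> exists l, Un_cv (fun n => pr (u n)) l).
{ intros pr E1 E2.
  destruct (Rcomplete.R_complete (fun n => pr (u n))) as [l Hl]; [|now exists l].
  intros eps He.
  set (D := (K / (1 - rho))%R).
  assert (D0 : (0 <= D)%R) by (apply Rmult_le_pos; [lra | left; apply Rinv_0_lt_compat; lra]).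
  destruct (pow_lt_1_zero rho) with (y := (eps / (D + 1))%R) as [N HN].
  { rewrite Rabs_pos_eq; lra. }
  { apply Rdiv_lt_0_compat; lra. }
  assert (W : forall n m, (N <= n)%nat -> (n <= m)%nat -> (Rabs (pr (u m) - pr (u n)) < eps)%R).
  { intros n m Hn Hnm; rewrite E1.
    eapply Rle_lt_trans; [apply E2|].
    eapply Rle_lt_trans; [apply B; auto|]; fold D.
    specialize (HN n Hn).
    assert (0 <= rho ^ n)%R by (apply pow_le; lra).
    rewrite Rabs_pos_eq in HN by auto.
    apply Rle_lt_trans with ((D + 1) * rho ^ n)%R; [nra|].
    apply Rlt_le_trans with ((D + 1) * (eps / (D + 1)))%R; [apply Rmult_lt_compat_l; lra|].
    right; field; lra. }
  exists N; intros n m Hn Hm; unfold Rdist.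
  destruct (Nat.le_ge_cases n m).
  - rewrite Rabs_minus_sym; apply W; lia.
  - apply W; lia. }
destruct (cvg Re) as [x Hx]; [intros; reflexivity | apply re_le_Cmod|].
destruct (cvg Im) as [y Hy].
{ intros; reflexivity. }
{ intros c; eapply Rle_trans; [apply Rmax_r | apply Rmax_Cmod]. }
assert (L : clim u (x, y)).
{ intros eps He.
  destruct (Hx (eps / 2)%R ltac:(lra)) as [N HN]; destruct (Hy (eps / 2)%R ltac:(lra)) as [N' HN'].
  exists (Nat.max N N'); intros n Hn _.
  specialize (HN n ltac:(lia)); specialize (HN' n ltac:(lia)); unfold Rdist, Re, Im in HN, HN'.
  replace (u n - (x, y)) with (RtoC (fst (u n) - x)%R + Ci * RtoC (snd (u n) - y)%R).
  2: { apply injective_projections; simpl; ring. }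
  eapply Rle_lt_trans; [apply Cmod_triangle|].
  rewrite Cmod_mult, Cmod_Ci, !Cmod_R; lra. }
exists (x, y); split; [exact L|].
intros n; assert (E : forall l : C, u n - l = - (l - u n)) by (intros; ring).
rewrite E, Cmod_opp.
apply (clim_bound (fun m => u (n + m)%nat)); [now apply clim_shift|].
intros m; apply B; lia.
Qed.

(** * Infinite q-shifted factorials *)

Lemma geom_exponent (rho : R) (n : nat) : (0 <= rho < 1)%R ->
  ((1 - rho ^ n) / (1 - rho) + rho ^ n = (1 - rho ^ S n) / (1 - rho))%R /\
  (0 <= (1 - rho ^ n) / (1 - rho) <= / (1 - rho))%R.
Proof.
intros Hr; split; [simpl; field; lra|].
assert (0 <= rho ^ n)%R by (apply pow_le; lra).
assert (rho ^ n <= 1)%R by (rewrite <- (pow1 n); apply pow_incr; lra).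
assert (0 < / (1 - rho))%R by (apply Rinv_0_lt_compat; lra).
unfold Rdiv; split; nra.
Qed.

(** From |1 - a q^j| <= 1 + |a||q|^j <= exp(|a||q|^j) and the geometric series. *)
Lemma qpoch_le (a q : C) (r : R) (n : nat) :
  (Cmod q < 1)%R -> (Cmod a <= r)%R ->
  (Cmod (qpoch a q n) <= exp (r / (1 - Cmod q)))%R.
Proof.
intros Hq Ha.
assert (Hr : (0 <= Cmod q < 1)%R) by (split; [apply Cmod_ge_0 | auto]).
assert (R0 : (0 <= r)%R) by (pose proof (Cmod_ge_0 a); lra).
assert (B : (Cmod (qpoch a q n) <= exp (r * ((1 - Cmod q ^ n) / (1 - Cmod q))))%R).
{ induction n as [|n IH].
  - simpl; rewrite Cmod_1; replace (r * ((1 - 1) / (1 - Cmod q)))%R with 0%R by (field; lra).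
    rewrite exp_0; lra.
  - rewrite qpoch_S, Cmod_mult.
    rewrite <- (proj1 (geom_exponent (Cmod q) n Hr)), Rmult_plus_distr_l, exp_plus.
    apply Rmult_le_compat; auto using Cmod_ge_0.
    eapply Rle_trans; [apply Cmod_triangle|].
    rewrite Cmod_opp, Cmod_1, Cmod_mult, Cmod_pow.
    eapply Rle_trans; [|apply exp_ineq1_le].
    apply Rplus_le_compat_l, Rmult_le_compat_r; auto; apply pow_le; lra. }
eapply Rle_trans; [exact B|].
destruct (proj2 (geom_exponent (Cmod q) n Hr)) as [_ B2].
assert (r * ((1 - Cmod q ^ n) / (1 - Cmod q)) <= r / (1 - Cmod q))%R
  by (apply Rmult_le_compat_l; auto).
destruct H as [H | H]; [left; now apply exp_increasing | right; now rewrite H].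
Qed.

Lemma Cinv_one_minus_le (x : C) (r : R) :
  (Cmod x <= r < 1)%R -> (Cmod (/ (1 - x)) <= / (1 - r))%R.
Proof.
intros Hx.
rewrite Cmod_inv by (apply one_minus_nz; lra).
apply Rinv_le_contravar; [lra|].
assert (Cmod 1 <= Cmod (1 - x) + Cmod x)%R.
{ replace (RtoC 1) with ((1 - x) + x) at 1 by ring; apply Cmod_triangle. }
rewrite Cmod_1 in H; lra.
Qed.

(** The same bound for the reciprocals, from
    1/(1 - r y) <= 1 + r y / (1 - r) for 0 <= y <= 1. Being uniform in n it shows
    that the infinite product does not vanish. *)
Lemma Cinv_qpoch_le (a q : C) (r : R) (n : nat) :
  (Cmod q < 1)%R -> (Cmod a <= r < 1)%R ->
  (Cmod (/ qpoch a q n) <= exp (r / (1 - r) / (1 - Cmod q)))%R.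
Proof.
intros Hq Ha.
assert (Hr : (0 <= Cmod q < 1)%R) by (split; [apply Cmod_ge_0 | auto]).
assert (R0 : (0 <= r)%R) by (pose proof (Cmod_ge_0 a); lra).
assert (D0 : (0 <= r / (1 - r))%R)
  by (apply Rmult_le_pos; [auto | left; apply Rinv_0_lt_compat; lra]).
assert (B : (Cmod (/ qpoch a q n) <= exp (r / (1 - r) * ((1 - Cmod q ^ n) / (1 - Cmod q))))%R).
{ induction n as [|n IH].
  - simpl; replace (/ 1) with (RtoC 1) by (field; apply C1_nz).
    rewrite Cmod_1; replace (r / (1 - r) * ((1 - 1) / (1 - Cmod q)))%R with 0%R by (field; lra).
    rewrite exp_0; lra.
  - rewrite qpoch_S.
    assert (N1 : qpoch a q n <> 0) by (apply qpoch_nz; lra).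
    assert (N2 : 1 - a * q ^ n <> 0) by (apply qpoch_factor_nz; lra).
    replace (/ (qpoch a q n * (1 - a * q ^ n)))
      with (/ qpoch a q n * / (1 - a * q ^ n)) by (field; auto).
    rewrite Cmod_mult.
    rewrite <- (proj1 (geom_exponent (Cmod q) n Hr)), Rmult_plus_distr_l, exp_plus.
    apply Rmult_le_compat; auto using Cmod_ge_0.
    eapply Rle_trans; [|apply exp_ineq1_le].
    set (y := (Cmod q ^ n)%R).
    assert (Y0 : (0 <= y)%R) by (apply pow_le; lra).
    assert (Y1 : (y <= 1)%R) by (unfold y; rewrite <- (pow1 n); apply pow_incr; lra).
    eapply Rle_trans.
    + apply Cinv_one_minus_le with (r := (r * y)%R).
      rewrite Cmod_mult, Cmod_pow; fold y; split; [|nra].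
      apply Rmult_le_compat_r; lra.
    + assert (P1 : (0 < 1 - r * y)%R) by nra.
      apply Rmult_le_reg_r with ((1 - r * y) * (1 - r))%R; [nra|].
      replace (/ (1 - r * y) * ((1 - r * y) * (1 - r)))%R with (1 - r)%R by (field; lra).
      replace ((1 + r / (1 - r) * y) * ((1 - r * y) * (1 - r)))%R
        with ((1 - r + r * y) * (1 - r * y))%R by (field; lra).
      assert (0 <= r * r * (y * (1 - y)))%R
        by (apply Rmult_le_pos; [nra | apply Rmult_le_pos; lra]).
      nra. }
eapply Rle_trans; [exact B|].
destruct (proj2 (geom_exponent (Cmod q) n Hr)) as [_ B2].
assert (r / (1 - r) * ((1 - Cmod q ^ n) / (1 - Cmod q)) <= r / (1 - r) / (1 - Cmod q))%R
  by (apply Rmult_le_compat_l; auto).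
destruct H as [H | H]; [left; now apply exp_increasing | right; now rewrite H].
Qed.

Lemma qpoch_inf_tail (a q : C) :
  (Cmod q < 1)%R ->
  clim (qpoch a q) (qpoch_inf a q) /\
  forall n, (Cmod (qpoch a q n - qpoch_inf a q)
    <= exp (Cmod a / (1 - Cmod q)) * Cmod a / (1 - Cmod q) * Cmod q ^ n)%R.
Proof.
intros Hq.
assert (Hr : (0 <= Cmod q < 1)%R) by (split; [apply Cmod_ge_0 | auto]).
destruct (geometric_limit (qpoch a q) (exp (Cmod a / (1 - Cmod q)) * Cmod a) (Cmod q) Hr)
  as [l [Hl Hb]].
{ intros n; rewrite qpoch_S.
  replace (qpoch a q n * (1 - a * q ^ n) - qpoch a q n) with (- (qpoch a q n * (a * q ^ n)))
    by ring.
  rewrite Cmod_opp, !Cmod_mult, Cmod_pow, <- Rmult_assoc.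
  apply Rmult_le_compat_r; [apply pow_le; lra|].
  apply Rmult_le_compat_r; [apply Cmod_ge_0|].
  apply qpoch_le; auto; lra. }
unfold qpoch_inf; rewrite (Clim_seq_eq _ _ Hl); auto.
Qed.

Lemma qpoch_inf_lim (a q : C) :
  (Cmod q < 1)%R -> clim (qpoch a q) (qpoch_inf a q).
Proof. intros Hq; apply (qpoch_inf_tail a q Hq). Qed.

Lemma qpoch_ulim {X : Type} (f : X -> C) (q : C) :
  (Cmod q < 1)%R -> bounded f ->
  ulim (fun n x => qpoch (f x) q n) (fun x => qpoch_inf (f x) q).
Proof.
intros Hq HB; destruct (bounded_pos f HB) as [M [M0 HM]].
assert (Hr : (0 <= Cmod q < 1)%R) by (split; [apply Cmod_ge_0 | auto]).
apply (ulim_tail _ _ (exp (M / (1 - Cmod q)) * M / (1 - Cmod q)) (Cmod q) Hr).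
intros n x; eapply Rle_trans; [apply (qpoch_inf_tail (f x) q Hq)|].
assert (I : (0 < / (1 - Cmod q))%R) by (apply Rinv_0_lt_compat; lra).
apply Rmult_le_compat_r; [apply pow_le; lra|].
unfold Rdiv; apply Rmult_le_compat_r; [lra|].
apply Rmult_le_compat; auto using Cmod_ge_0; [left; apply exp_pos|].
assert (H : (Cmod (f x) * / (1 - Cmod q) <= M * / (1 - Cmod q))%R)
  by (apply Rmult_le_compat_r; [lra | auto]).
destruct H as [H | H]; [left; now apply exp_increasing | right; now rewrite H].
Qed.

Lemma qpoch_inf_le (a q : C) (r : R) :
  (Cmod q < 1)%R -> (Cmod a <= r)%R ->
  (Cmod (qpoch_inf a q) <= exp (r / (1 - Cmod q)))%R.
Proof.
intros Hq Ha.
replace (qpoch_inf a q) with (qpoch_inf a q - 0) by ring.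
apply (clim_bound (qpoch a q)); [now apply qpoch_inf_lim|].
intros n; replace (qpoch a q n - 0) with (qpoch a q n) by ring; now apply qpoch_le.
Qed.

Lemma qpoch_inf_nz (a q : C) : (Cmod q < 1)%R -> (Cmod a < 1)%R -> qpoch_inf a q <> 0.
Proof.
intros Hq Ha E.
set (M := exp (Cmod a / (1 - Cmod a) / (1 - Cmod q))).
assert (M0 : (0 < M)%R) by apply exp_pos.
destruct (qpoch_inf_lim a q Hq (/ M)%R) as [N HN]; [now apply Rinv_0_lt_compat|].
specialize (HN N (le_n N) tt); simpl in HN; rewrite E in HN.
replace (qpoch a q N - 0) with (qpoch a q N) in HN by ring.
assert (B : (Cmod (/ qpoch a q N) <= M)%R) by (apply Cinv_qpoch_le; lra).
pose proof (qpoch_nz a q N Hq Ha) as NZ.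
rewrite Cmod_inv in B by auto.
apply Cmod_gt_0 in NZ.
apply Rinv_lt_contravar in HN; [|apply Rmult_lt_0_compat; auto; now apply Rinv_0_lt_compat].
rewrite Rinv_inv in HN; lra.
Qed.

Lemma Cinv_qpoch_ulim {X : Type} (f : X -> C) (q : C) (r : R) :
  (Cmod q < 1)%R -> (r < 1)%R -> (forall x, (Cmod (f x) <= r)%R) ->
  ulim (fun n x => / qpoch (f x) q n) (fun x => / qpoch_inf (f x) q) /\
  bounded (fun x => / qpoch_inf (f x) q).
Proof.
intros Hq Hr Hf.
set (M := exp (r / (1 - r) / (1 - Cmod q))).
assert (L : forall x, clim (fun n => / qpoch (f x) q n) (/ qpoch_inf (f x) q)).
{ intros x.
  assert (V : (Cmod (f x) < 1)%R) by (specialize (Hf x); lra).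
  pose proof (qpoch_inf_nz (f x) q Hq V) as NZ.
  apply (ulim_inv _ _ (Rmax M (Cmod (/ qpoch_inf (f x) q)))).
  - intros; apply qpoch_nz; auto.
  - auto.
  - intros n _; eapply Rle_trans; [|apply Rmax_l]; apply Cinv_qpoch_le; auto.
  - intros _; apply Rmax_r.
  - now apply qpoch_inf_lim. }
assert (B : forall x, (Cmod (/ qpoch_inf (f x) q) <= M)%R).
{ intros x.
  replace (/ qpoch_inf (f x) q) with (/ qpoch_inf (f x) q - 0) by ring.
  apply (clim_bound _ _ _ _ (L x)); intros n.
  replace (/ qpoch (f x) q n - 0) with (/ qpoch (f x) q n) by ring.
  apply Cinv_qpoch_le; auto. }
split; [|now exists M].
apply (ulim_inv _ _ M); auto.
- intros n x; apply qpoch_nz; auto; specialize (Hf x); lra.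
- intros x; apply qpoch_inf_nz; auto; specialize (Hf x); lra.
- intros n x; apply Cinv_qpoch_le; auto.
- apply qpoch_ulim; auto; now exists r.
Qed.

Lemma qpoch_inf_split (a q : C) (k : nat) :
  (Cmod q < 1)%R -> qpoch_inf a q = qpoch a q k * qpoch_inf (a * q ^ k) q.
Proof.
intros Hq; apply (clim_unique (fun n => qpoch a q (k + n)%nat)).
- apply clim_shift, qpoch_inf_lim, Hq.
- apply (clim_ext (fun n => qpoch a q k * qpoch (a * q ^ k) q n)).
  + intros n; now rewrite qpoch_add.
  + apply clim_mult; [apply clim_const | now apply qpoch_inf_lim].
Qed.

Lemma qpoch_inf_0 (q : C) : (Cmod q < 1)%R -> qpoch_inf 0 q = 1.
Proof.
intros Hq; apply (clim_unique (qpoch 0 q)); [now apply qpoch_inf_lim|].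
apply (clim_ext (fun _ => 1)); [|apply clim_const].
intros n; induction n as [|n IH]; [reflexivity|].
rewrite qpoch_S, <- IH; ring.
Qed.

(** * Continuity and integration of complex-valued functions *)

(** Continuity is imposed on the real and imaginary parts, which gives access to
    the rules for real functions without choosing a norm on C. *)
Definition Ccontinuous (f : R -> C) : Prop :=
  forall x, continuous (fun t => Re (f t)) x /\ continuous (fun t => Im (f t)) x.

Lemma Ccontinuous_ext (f g : R -> C) : (forall x, f x = g x) -> Ccontinuous f -> Ccontinuous g.
Proof. intros E H; now replace g with f by now apply functional_extensionality. Qed.

Lemma Ccontinuous_const (c : C) : Ccontinuous (fun _ => c).
Proof. intros x; split; apply continuous_const. Qed.

Lemma Ccontinuous_plus (f g : R -> C) : Ccontinuous f -> Ccontinuous g ->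
  Ccontinuous (fun x => f x + g x).
Proof.
intros Hf Hg x; destruct (Hf x), (Hg x); split.
- now apply (continuous_plus (fun t => Re (f t)) (fun t => Re (g t))).
- now apply (continuous_plus (fun t => Im (f t)) (fun t => Im (g t))).
Qed.

Lemma Ccontinuous_mult (f g : R -> C) : Ccontinuous f -> Ccontinuous g ->
  Ccontinuous (fun x => f x * g x).
Proof.
intros Hf Hg x; destruct (Hf x), (Hg x); split.
- apply (continuous_minus (fun t => Re (f t) * Re (g t))%R (fun t => Im (f t) * Im (g t))%R);
  apply (continuous_mult (K := R_AbsRing)); auto.
- apply (continuous_plus (fun t => Re (f t) * Im (g t))%R (fun t => Im (f t) * Re (g t))%R);
  apply (continuous_mult (K := R_AbsRing)); auto.
Qed.

Lemma Ccontinuous_inv (f : R -> C) : (forall x, f x <> 0) -> Ccontinuous f ->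
  Ccontinuous (fun x => / f x).
Proof.
intros NZ Hf x; destruct (Hf x) as [H1 H2].
assert (D : continuous (fun t => / (fst (f t) ^ 2 + snd (f t) ^ 2))%R x).
{ apply continuous_Rinv_comp.
  - apply (continuous_plus (fun t => fst (f t) ^ 2)%R (fun t => snd (f t) ^ 2)%R).
    + apply (continuous_ext (fun t => Re (f t) * Re (f t))%R); [intros; unfold Re; simpl; ring|].
      apply (continuous_mult (K := R_AbsRing)); auto.
    + apply (continuous_ext (fun t => Im (f t) * Im (f t))%R); [intros; unfold Im; simpl; ring|].
      apply (continuous_mult (K := R_AbsRing)); auto.
  - intros E; apply (NZ x), injective_projections; simpl; nra. }
split.
- apply (continuous_mult (K := R_AbsRing) (fun t => Re (f t))); auto.
- apply (continuous_mult (K := R_AbsRing) (fun t => - Im (f t))%R); auto.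
  now apply (continuous_opp (fun t => Im (f t))).
Qed.

Lemma Ccontinuous_pow (f : R -> C) (n : nat) : Ccontinuous f -> Ccontinuous (fun x => f x ^ n).
Proof.
intros H; induction n as [|n IH]; [exact (Ccontinuous_const 1)|].
now apply (Ccontinuous_mult f (fun x => f x ^ n)).
Qed.

Lemma Ccontinuous_csum (f : nat -> R -> C) (n : nat) :
  (forall k, Ccontinuous (f k)) -> Ccontinuous (fun x => csum (fun k => f k x) n).
Proof.
intros H; induction n as [|n IH]; simpl; [apply Ccontinuous_const | now apply Ccontinuous_plus].
Qed.

Lemma Ccontinuous_qpoch (f : R -> C) (q : C) (n : nat) : Ccontinuous f ->
  Ccontinuous (fun x => qpoch (f x) q n).
Proof.
intros H; induction n as [|n IH]; simpl; [apply Ccontinuous_const|].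
apply Ccontinuous_mult; auto.
apply (Ccontinuous_ext (fun x => 1 + f x * - q ^ n)); [intros; ring|].
apply Ccontinuous_plus; [apply Ccontinuous_const | apply Ccontinuous_mult; auto using Ccontinuous_const].
Qed.

Lemma continuous_ulim (f : nat -> R -> R) (g : R -> R) (x : R) :
  (forall eps, (0 < eps)%R -> exists n, forall y, (Rabs (f n y - g y) < eps)%R) ->
  (forall n, continuous (f n) x) -> continuous g x.
Proof.
intros H Hf; apply filterlim_locally; intros eps.
assert (E : (0 < eps / 3)%R) by (pose proof (cond_pos eps); lra).
destruct (H _ E) as [n Hn].
generalize (proj1 (filterlim_locally (f n) (f n x)) (Hf n) (mkposreal _ E)).
apply filter_imp; intros y Hy.
unfold ball in *; simpl in *; unfold AbsRing_ball, abs, minus, plus, opp in *; simpl in *.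
pose proof (Hn x) as X; pose proof (Hn y) as Y.
apply Rabs_def2 in X; apply Rabs_def2 in Y; apply Rabs_def2 in Hy.
apply Rabs_def1; lra.
Qed.

Lemma Ccontinuous_ulim (f : nat -> R -> C) (g : R -> C) :
  ulim f g -> (forall n, Ccontinuous (f n)) -> Ccontinuous g.
Proof.
intros H Hf x; split.
- apply (continuous_ulim (fun n t => Re (f n t))); [|intros n; exact (proj1 (Hf n x))].
  intros eps He; destruct (H eps He) as [N HN]; exists N; intros y.
  eapply Rle_lt_trans; [|apply (HN N (le_n N) y)].
  apply (re_le_Cmod (f N y - g y)).
- apply (continuous_ulim (fun n t => Im (f n t))); [|intros n; exact (proj2 (Hf n x))].
  intros eps He; destruct (H eps He) as [N HN]; exists N; intros y.
  eapply Rle_lt_trans; [|apply (HN N (le_n N) y)].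
  eapply Rle_trans; [apply Rmax_r | apply (Rmax_Cmod (f N y - g y))].
Qed.

Lemma Ccontinuous_qpoch_inf (f : R -> C) (q : C) :
  (Cmod q < 1)%R -> bounded f -> Ccontinuous f -> Ccontinuous (fun x => qpoch_inf (f x) q).
Proof.
intros Hq Hb Hf; apply (Ccontinuous_ulim (fun n x => qpoch (f x) q n)).
- now apply qpoch_ulim.
- intros; now apply Ccontinuous_qpoch.
Qed.

Lemma bounded_qpoch_inf {X : Type} (f : X -> C) (q : C) :
  (Cmod q < 1)%R -> bounded f -> bounded (fun x => qpoch_inf (f x) q).
Proof.
intros Hq [M HM]; exists (exp (M / (1 - Cmod q))); intros x; now apply qpoch_inf_le.
Qed.

Lemma Ccontinuous_expi : Ccontinuous expi.
Proof.
intros x; split; [apply continuous_cos | apply continuous_sin].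
Qed.

Lemma Cmod_expi (x : R) : Cmod (expi x) = 1%R.
Proof.
unfold Cmod, expi; simpl.
replace (cos x * (cos x * 1) + sin x * (sin x * 1))%R with 1%R; [apply sqrt_1|].
pose proof (sin2_cos2 x); unfold Rsqr in *; lra.
Qed.

Lemma expi_nz (x : R) : expi x <> 0.
Proof. apply Cmod_gt_0; rewrite Cmod_expi; lra. Qed.

Lemma expi_plus (x y : R) : expi (x + y) = expi x * expi y.
Proof.
apply injective_projections; simpl; [rewrite cos_plus | rewrite sin_plus]; ring.
Qed.

Lemma expi_0 : expi 0 = 1.
Proof. unfold expi; now rewrite cos_0, sin_0. Qed.

Lemma expi_opp (x : R) : expi (- x) = / expi x.
Proof.
assert (E : expi x * expi (- x) = 1) by (rewrite <- expi_plus, Rplus_opp_r; apply expi_0).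
pose proof (expi_nz x).
replace (expi (- x)) with (expi x * expi (- x) / expi x) by (field; auto).
rewrite E; field; auto.
Qed.

Lemma expi_pow (x : R) (n : nat) : expi x ^ n = expi (INR n * x).
Proof.
induction n as [|n IH]; [simpl; now rewrite Rmult_0_l, expi_0|].
rewrite Cpow_S, IH, <- expi_plus, S_INR; f_equal; ring.
Qed.

Definition CRInt (lo hi : R) (f : R -> C) : C :=
  (RInt (fun t => Re (f t)) lo hi, RInt (fun t => Im (f t)) lo hi).

Lemma Ccontinuous_ex_RInt (f : R -> C) (lo hi : R) : Ccontinuous f ->
  ex_RInt (fun t => Re (f t)) lo hi /\ ex_RInt (fun t => Im (f t)) lo hi.
Proof.
intros H; split; apply (ex_RInt_continuous (V := R_CompleteNormedModule)); intros x _.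
- exact (proj1 (H x)).
- exact (proj2 (H x)).
Qed.

Lemma CRInt_correct (lo hi : R) (f : R -> C) : Ccontinuous f ->
  is_RInt (V := C_R_NormedModule) f lo hi (CRInt lo hi f).
Proof.
intros H; destruct (Ccontinuous_ex_RInt f lo hi H) as [H1 H2].
apply (is_RInt_fct_extend_pair (U := R_NormedModule) (V := R_NormedModule)).
- apply (RInt_correct (V := R_CompleteNormedModule) _ _ _ H1).
- apply (RInt_correct (V := R_CompleteNormedModule) _ _ _ H2).
Qed.

Lemma CRInt_ext (lo hi : R) (f g : R -> C) : (forall x, f x = g x) ->
  CRInt lo hi f = CRInt lo hi g.
Proof. intros E; f_equal; now apply functional_extensionality. Qed.

Lemma CRInt_plus (lo hi : R) (f g : R -> C) : Ccontinuous f -> Ccontinuous g ->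
  CRInt lo hi (fun x => f x + g x) = CRInt lo hi f + CRInt lo hi g.
Proof.
intros Hf Hg; destruct (Ccontinuous_ex_RInt f lo hi Hf), (Ccontinuous_ex_RInt g lo hi Hg).
apply injective_projections; simpl.
- now apply (RInt_plus (fun t => Re (f t)) (fun t => Re (g t))).
- now apply (RInt_plus (fun t => Im (f t)) (fun t => Im (g t))).
Qed.

Lemma RInt_lincomb (lo hi r s : R) (f g : R -> R) :
  ex_RInt f lo hi -> ex_RInt g lo hi ->
  RInt (fun x => r * f x + s * g x)%R lo hi = (r * RInt f lo hi + s * RInt g lo hi)%R.
Proof.
intros Hf Hg.
rewrite (RInt_plus (fun x => r * f x)%R (fun x => s * g x)%R).
- rewrite (RInt_scal f), (RInt_scal g); auto.
- now apply (ex_RInt_scal f).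
- now apply (ex_RInt_scal g).
Qed.

Lemma CRInt_scal (lo hi : R) (c : C) (f : R -> C) : Ccontinuous f ->
  CRInt lo hi (fun x => c * f x) = c * CRInt lo hi f.
Proof.
intros Hf; destruct (Ccontinuous_ex_RInt f lo hi Hf) as [H1 H2].
destruct c as [r s]; apply injective_projections; simpl.
- rewrite <- (RInt_ext (fun x => r * Re (f x) + (- s) * Im (f x))%R)
    by (intros; unfold Re, Im; simpl; ring).
  rewrite RInt_lincomb; auto; ring.
- rewrite <- (RInt_ext (fun x => r * Im (f x) + s * Re (f x))%R)
    by (intros; unfold Re, Im; simpl; ring).
  rewrite RInt_lincomb; auto; ring.
Qed.

Lemma CRInt_csum (lo hi : R) (f : nat -> R -> C) (n : nat) :
  (forall k, Ccontinuous (f k)) ->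
  CRInt lo hi (fun x => csum (fun k => f k x) n) = csum (fun k => CRInt lo hi (f k)) n.
Proof.
intros H; induction n as [|n IH]; simpl.
- apply injective_projections; simpl; rewrite RInt_const; apply (Rmult_0_r (hi - lo)).
- rewrite <- IH; apply (CRInt_plus lo hi (fun x => csum (fun k => f k x) n)); auto.
  now apply Ccontinuous_csum.
Qed.

Lemma CRInt_bound (lo hi M : R) (f : R -> C) : (lo <= hi)%R -> Ccontinuous f ->
  (forall x, (Cmod (f x) <= M)%R) -> (Cmod (CRInt lo hi f) <= 2 * (hi - lo) * M)%R.
Proof.
intros Hl Hf HM; destruct (Ccontinuous_ex_RInt f lo hi Hf) as [H1 H2].
assert (A1 : (Rabs (fst (CRInt lo hi f)) <= (hi - lo) * M)%R).
{ apply abs_RInt_le_const; auto; intros t _.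
  eapply Rle_trans; [apply re_le_Cmod | apply HM]. }
assert (A2 : (Rabs (snd (CRInt lo hi f)) <= (hi - lo) * M)%R).
{ apply abs_RInt_le_const; auto; intros t _.
  eapply Rle_trans; [|apply (HM t)]; eapply Rle_trans; [apply Rmax_r | apply Rmax_Cmod]. }
destruct (CRInt lo hi f) as [x y]; simpl in *.
replace (x, y) with (RtoC x + Ci * RtoC y) by (apply injective_projections; simpl; ring).
eapply Rle_trans; [apply Cmod_triangle|].
rewrite Cmod_mult, Cmod_Ci, !Cmod_R; lra.
Qed.

Lemma CRInt_ulim (lo hi : R) (f : nat -> R -> C) (g : R -> C) : (lo <= hi)%R ->
  ulim f g -> (forall n, Ccontinuous (f n)) -> clim (fun n => CRInt lo hi (f n)) (CRInt lo hi g).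
Proof.
intros Hl H Hf; pose proof (Ccontinuous_ulim f g H Hf) as Hg.
intros eps He.
set (D := (2 * (hi - lo) + 1)%R).
assert (D0 : (0 < D)%R) by (unfold D; lra).
destruct (H (eps / D)%R ltac:(now apply Rdiv_lt_0_compat)) as [N HN].
exists N; intros n Hn _.
assert (Ccontinuous (fun x => - (1) * g x)) by (apply Ccontinuous_mult; auto using Ccontinuous_const).
replace (CRInt lo hi (f n) - CRInt lo hi g) with (CRInt lo hi (fun x => f n x + - (1) * g x)).
2: { rewrite CRInt_plus, CRInt_scal; auto; ring. }
eapply Rle_lt_trans.
- apply (CRInt_bound lo hi (eps / D)); auto; [now apply Ccontinuous_plus|].
  intros x; left; replace (f n x + - (1) * g x) with (f n x - g x) by ring; auto.
- apply Rlt_le_trans with (D * (eps / D))%R.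
  + apply Rmult_lt_compat_r; [now apply Rdiv_lt_0_compat | unfold D; lra].
  + right; field; lra.
Qed.

(** The orthogonality of the characters of the circle. *)
Lemma CRInt_expi_S (n : nat) :
  CRInt (- PI) PI (fun x => expi x ^ S n) = 0 /\ CRInt (- PI) PI (fun x => (/ expi x) ^ S n) = 0.
Proof.
assert (N : INR (S n) <> 0%R) by (apply not_0_INR; lia).
assert (P : forall m, (m = INR (S n) \/ m = - INR (S n))%R -> CRInt (- PI) PI (fun x => expi (m * x)) = 0).
{ intros m Hm.
  assert (M0 : (m <> 0)%R) by (destruct Hm; lra).
  assert (SP : sin (m * PI) = 0%R).
  { destruct Hm as [-> | ->].
    - apply sin_eq_0_1; exists (Z.of_nat (S n)); now rewrite INR_IZR_INZ.
    - rewrite Ropp_mult_distr_l_reverse, sin_neg.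
      rewrite (sin_eq_0_1 (INR (S n) * PI)); [ring|].
      exists (Z.of_nat (S n)); now rewrite INR_IZR_INZ. }
  apply injective_projections; simpl.
  - replace 0%R with (sin (m * PI) / m - sin (m * - PI) / m)%R.
    2: { replace (m * - PI)%R with (- (m * PI))%R by ring; rewrite sin_neg, SP; field; auto. }
    apply is_RInt_unique, (is_RInt_derive (fun x => sin (m * x) / m)%R).
    + intros x _; unfold Re; simpl; auto_derive; auto; field; auto.
    + intros x _; apply continuous_comp; [|apply continuous_cos].
      apply (continuous_scal_r m (fun x : R => x)), continuous_id.
  - replace 0%R with (- cos (m * PI) / m - - cos (m * - PI) / m)%R.
    2: { replace (m * - PI)%R with (- (m * PI))%R by ring; rewrite cos_neg; field; auto. }
    apply is_RInt_unique, (is_RInt_derive (fun x => - cos (m * x) / m)%R).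
    + intros x _; unfold Im; simpl; auto_derive; auto; field; auto.
    + intros x _; apply continuous_comp; [|apply continuous_sin].
      apply (continuous_scal_r m (fun x : R => x)), continuous_id. }
split.
- rewrite <- (P (INR (S n)) (or_introl eq_refl)); apply CRInt_ext; intros x; apply expi_pow.
- rewrite <- (P (- INR (S n))%R (or_intror eq_refl)); apply CRInt_ext; intros x.
  rewrite <- expi_opp, expi_pow; f_equal; ring.
Qed.

(** * Moving the contour from |u| = 1 to |u| = 1/|q| *)

Section Shift.
Variable q : C.
Hypothesis Hq : (0 < Cmod q < 1)%R.

(** The circles |u| = 1 and |u| = 1/|q| are parametrized as u = rho e^(ix) with rho = 1 and rho = 1/q. *)
Definition on_circles (P : C -> Prop) : Prop := P 1 /\ P (/ q).

Definition circle_good (F : C -> C) : Prop :=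
  on_circles (fun rho => Ccontinuous (fun x => F (rho * expi x)) /\ bounded (fun x => F (rho * expi x))).

Definition circle_ulim (f : nat -> C -> C) (g : C -> C) : Prop :=
  on_circles (fun rho => ulim (fun n x => f n (rho * expi x)) (fun x => g (rho * expi x))).

Definition moment (i j : nat) (F : C -> C) (rho : C) : C :=
  CRInt (- PI) PI (fun x => (rho * expi x) ^ i * (/ (rho * expi x)) ^ j * F (rho * expi x)).

(** A replacement for analyticity on the closed annulus: a function is shiftable
    when all its Laurent moments agree on the two boundary circles. Quantifying
    over all moments makes the class stable under multiplication by u and 1/u,
    and it is closed under uniform limits, so every convergent product of
    Laurent polynomials and geometric series stays in it. *)
Definition shiftable (F : C -> C) : Prop :=
  circle_good F /\ forall i j, moment i j F 1 = moment i j F (/ q).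

(** The functions by which one may multiply without leaving the class. Unlike
    shiftability itself, this property passes to products at once. *)
Definition shift_mult (m : C -> C) : Prop :=
  circle_good m /\ forall F, shiftable F -> shiftable (fun u => m u * F u).

Let q_nz : q <> 0. Proof. apply Cmod_gt_0; apply Hq. Qed.

Let invq_nz : / q <> 0.
Proof. intros E; apply C1_nz; rewrite <- (Cinv_r q q_nz), E; ring. Qed.

Lemma circle_good_mult (F G : C -> C) :
  circle_good F -> circle_good G -> circle_good (fun u => F u * G u).
Proof.
intros [[A1 A2] [A3 A4]] [[B1 B2] [B3 B4]]; split; split;
  first [now apply Ccontinuous_mult | now apply bounded_mult].
Qed.

Lemma circle_good_plus (F G : C -> C) :
  circle_good F -> circle_good G -> circle_good (fun u => F u + G u).
Proof.
intros [[A1 A2] [A3 A4]] [[B1 B2] [B3 B4]]; split; split;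
  first [now apply Ccontinuous_plus | now apply bounded_plus].
Qed.

Lemma circle_good_const (c : C) : circle_good (fun _ => c).
Proof. split; split; first [apply Ccontinuous_const | apply bounded_const]. Qed.

Lemma circle_good_id : circle_good (fun u => u).
Proof.
split; split; first [apply Ccontinuous_mult; [apply Ccontinuous_const | apply Ccontinuous_expi] |
  apply bounded_mult; [apply bounded_const | exists 1%R; intros; rewrite Cmod_expi; lra]].
Qed.

Lemma circle_good_inv : circle_good (fun u => / u).
Proof.
assert (H : forall rho : C, rho <> 0 -> Ccontinuous (fun x => / (rho * expi x)) /\
  bounded (fun x => / (rho * expi x))).
{ intros rho Hr; split.
  - apply Ccontinuous_inv; [intros; apply Cmult_neq_0; auto using expi_nz|].
    apply Ccontinuous_mult; [apply Ccontinuous_const | apply Ccontinuous_expi].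
  - exists (/ Cmod rho)%R; intros x.
    assert (rho * expi x <> 0) by (apply Cmult_neq_0; auto using expi_nz).
    rewrite Cmod_inv, Cmod_mult, Cmod_expi, Rmult_1_r by auto; lra. }
split; apply H; auto using C1_nz.
Qed.

Lemma circle_good_pow (F : C -> C) (n : nat) : circle_good F -> circle_good (fun u => F u ^ n).
Proof.
intros H; induction n as [|n IH]; [exact (circle_good_const 1)|].
now apply (circle_good_mult F (fun u => F u ^ n)).
Qed.

Lemma circle_good_monomial (i j : nat) : circle_good (fun u => u ^ i * (/ u) ^ j).
Proof.
apply circle_good_mult; apply circle_good_pow; [apply circle_good_id | apply circle_good_inv].
Qed.

Lemma shift_mult_mult (m m' : C -> C) :
  shift_mult m -> shift_mult m' -> shift_mult (fun u => m u * m' u).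
Proof.
intros [G H] [G' H']; split; [now apply circle_good_mult|].
intros F HF.
assert (E : (fun u => m u * m' u * F u) = (fun u => m u * (m' u * F u)))
  by (apply functional_extensionality; intros; ring).
rewrite E; auto.
Qed.

Lemma moment_plus (i j : nat) (F G : C -> C) (rho : C) :
  Ccontinuous (fun x => (rho * expi x) ^ i * (/ (rho * expi x)) ^ j * F (rho * expi x)) ->
  Ccontinuous (fun x => (rho * expi x) ^ i * (/ (rho * expi x)) ^ j * G (rho * expi x)) ->
  moment i j (fun u => F u + G u) rho = moment i j F rho + moment i j G rho.
Proof.
intros HF HG; unfold moment; rewrite <- CRInt_plus; auto.
apply CRInt_ext; intros; ring.
Qed.

Lemma moment_continuous (i j : nat) (F : C -> C) : circle_good F ->
  on_circles (fun rho =>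
    Ccontinuous (fun x => (rho * expi x) ^ i * (/ (rho * expi x)) ^ j * F (rho * expi x))).
Proof.
intros H.
destruct (circle_good_mult _ _ (circle_good_monomial i j) H) as [[A _] [B _]]; now split.
Qed.

Lemma shift_mult_plus (m m' : C -> C) :
  shift_mult m -> shift_mult m' -> shift_mult (fun u => m u + m' u).
Proof.
intros [G H] [G' H']; split; [now apply circle_good_plus|].
intros F HF.
assert (E : (fun u => (m u + m' u) * F u) = (fun u => m u * F u + m' u * F u))
  by (apply functional_extensionality; intros; ring).
rewrite E; destruct (H F HF) as [K1 K2]; destruct (H' F HF) as [K1' K2'].
split; [now apply circle_good_plus|]; intros i j.
destruct (moment_continuous i j _ K1), (moment_continuous i j _ K1').
rewrite !moment_plus; auto; now rewrite K2, K2'.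
Qed.

Lemma shift_mult_const (c : C) : shift_mult (fun _ => c).
Proof.
split; [apply circle_good_const|]; intros F [G M]; split.
- apply circle_good_mult; auto using circle_good_const.
- intros i j; destruct (moment_continuous i j _ G).
  assert (E : forall rho : C, Ccontinuous (fun x => (rho * expi x) ^ i * (/ (rho * expi x)) ^ j * F (rho * expi x)) ->
     moment i j (fun u => c * F u) rho = c * moment i j F rho).
  { intros rho Hr; unfold moment; rewrite <- CRInt_scal; auto; apply CRInt_ext; intros; ring. }
  rewrite !E; auto; now rewrite M.
Qed.

Lemma shift_mult_id : shift_mult (fun u => u).
Proof.
split; [apply circle_good_id|]; intros F [G M]; split.
- apply circle_good_mult; auto using circle_good_id.
- intros i j.
  assert (E : forall rho : C, moment i j (fun u => u * F u) rho = moment (S i) j F rho)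
    by (intros; unfold moment; apply CRInt_ext; intros; simpl; ring).
  now rewrite !E.
Qed.

Lemma shift_mult_inv : shift_mult (fun u => / u).
Proof.
split; [apply circle_good_inv|]; intros F [G M]; split.
- apply circle_good_mult; auto using circle_good_inv.
- intros i j.
  assert (E : forall rho : C, moment i j (fun u => / u * F u) rho = moment i (S j) F rho)
    by (intros; unfold moment; apply CRInt_ext; intros; simpl; ring).
  now rewrite !E.
Qed.

Lemma shift_mult_ulim (f : nat -> C -> C) (m : C -> C) :
  (forall n, shift_mult (f n)) -> circle_ulim f m ->
  on_circles (fun rho => bounded (fun x => m (rho * expi x))) -> shift_mult m.
Proof.
intros Hf [U1 U2] [B1 B2].
assert (Gm : circle_good m).
{ split; (split; [|assumption]).
  - apply (Ccontinuous_ulim _ _ U1); intros n; exact (proj1 (proj1 (proj1 (Hf n)))).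
  - apply (Ccontinuous_ulim _ _ U2); intros n; exact (proj1 (proj2 (proj1 (Hf n)))). }
split; [exact Gm|]; intros F HF; split.
- apply circle_good_mult; auto; apply HF.
- intros i j.
  assert (W : on_circles (fun rho => clim (fun n => moment i j (fun u => f n u * F u) rho)
                                    (moment i j (fun u => m u * F u) rho))).
  { destruct (circle_good_monomial i j) as [[_ Q1] [_ Q2]].
    pose proof (proj1 HF) as [[_ P1] [_ P2]].
    split; unfold moment; apply CRInt_ulim; try (pose proof PI_RGT_0; lra).
    - apply ulim_mult; auto using bounded_mult; [apply ulim_const|].
      apply ulim_mult; auto using ulim_const.
    - intros n; apply (moment_continuous i j (fun u => f n u * F u)), (Hf n), HF.
    - apply ulim_mult; auto using bounded_mult; [apply ulim_const|].
      apply ulim_mult; auto using ulim_const.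
    - intros n; apply (moment_continuous i j (fun u => f n u * F u)), (Hf n), HF. }
  destruct W as [W1 W2].
  apply (clim_unique _ _ _ W1), (clim_ext (fun n => moment i j (fun u => f n u * F u) (/ q))); auto.
  intros n; symmetry; apply (Hf n), HF.
Qed.

Lemma shift_mult_qpoch (m : C -> C) (n : nat) :
  shift_mult m -> shift_mult (fun u => qpoch (m u) q n).
Proof.
intros H; induction n as [|n IH]; simpl; [apply shift_mult_const|].
apply shift_mult_mult; auto.
assert (E : (fun u => 1 - m u * q ^ n) = (fun u => 1 + - q ^ n * m u))
  by (apply functional_extensionality; intros; ring).
rewrite E; apply shift_mult_plus; [apply shift_mult_const|].
apply shift_mult_mult; auto using shift_mult_const.
Qed.

Lemma shift_mult_qpoch_inf (m : C -> C) :
  shift_mult m -> shift_mult (fun u => qpoch_inf (m u) q).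
Proof.
intros H; pose proof (proj1 H) as [[_ B1] [_ B2]].
apply (shift_mult_ulim (fun n u => qpoch (m u) q n)).
- intros n; now apply shift_mult_qpoch.
- split; now apply (qpoch_ulim (fun x => m (_ * expi x))).
- split; now apply (bounded_qpoch_inf (fun x => m (_ * expi x))).
Qed.

Lemma shift_mult_pow (m : C -> C) (n : nat) : shift_mult m -> shift_mult (fun u => m u ^ n).
Proof.
intros H; induction n as [|n IH]; [exact (shift_mult_const 1)|].
now apply (shift_mult_mult m (fun u => m u ^ n)).
Qed.

Lemma geometric_ulim {X : Type} (f : X -> C) (r : R) :
  (r < 1)%R -> (forall x, (Cmod (f x) <= r)%R) ->
  ulim (fun n x => csum (fun k => f x ^ k) n) (fun x => / (1 - f x)).
Proof.
intros Hr Hf; destruct (Rle_dec 0 r) as [R0 | R0].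
2: { intros eps He; exists O; intros n _ x; specialize (Hf x).
     pose proof (Cmod_ge_0 (f x)); lra. }
apply (ulim_tail _ _ (/ (1 - r)) r); [lra|].
intros n x; specialize (Hf x).
assert (N : 1 - f x <> 0) by (apply one_minus_nz; lra).
assert (E : csum (fun k => f x ^ k) n - / (1 - f x) = - (/ (1 - f x) * f x ^ n)).
{ assert (D : csum (fun k => f x ^ k) n = (1 - f x ^ n) / (1 - f x)).
  { induction n as [|n IH]; simpl; [field; auto | rewrite IH; field; auto]. }
  rewrite D; field; auto. }
rewrite E, Cmod_opp, Cmod_mult, Cmod_pow.
apply Rmult_le_compat; auto using Cmod_ge_0.
- apply pow_le, Cmod_ge_0.
- apply Cinv_one_minus_le; lra.
- apply pow_incr; auto using Cmod_ge_0.
Qed.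

(** The reciprocal is the uniform limit of the geometric series, as |m| <= r < 1 on both circles. *)
Lemma shift_mult_inv_one_minus (m : C -> C) (r : R) :
  shift_mult m -> (r < 1)%R ->
  on_circles (fun rho => forall x, (Cmod (m (rho * expi x)%C) <= r)%R) ->
  shift_mult (fun u => / (1 - m u)).
Proof.
intros H Hr [B1 B2].
apply (shift_mult_ulim (fun n u => csum (fun k => m u ^ k) n)).
- intros n; induction n as [|n IH]; simpl; [apply shift_mult_const|].
  apply (shift_mult_plus (fun u => csum (fun k => m u ^ k) n)); auto using shift_mult_pow.
- split; now apply (geometric_ulim (fun x => m (_ * expi x)) r).
- split; exists (/ (1 - r))%R; intros x; apply Cinv_one_minus_le; auto.
Qed.

Lemma shift_mult_inv_qpoch_inf (m : C -> C) (r : R) :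
  shift_mult m -> (r < 1)%R ->
  on_circles (fun rho => forall x, (Cmod (m (rho * expi x)%C) <= r)%R) ->
  shift_mult (fun u => / qpoch_inf (m u) q).
Proof.
intros H Hr [B1 B2].
(* The finite quotients, built from factors to which the geometric series applies. *)
set (fin := fix fin n u : C := match n with O => 1 | S k => fin k u * / (1 - q ^ k * m u) end).
assert (E : forall n u, (Cmod (m u) <= r)%R -> fin n u = / qpoch (m u) q n).
{ intros n u Hu; induction n as [|n IH].
  - simpl; field; apply C1_nz.
  - rewrite qpoch_S; change (fin (S n) u) with (fin n u * / (1 - q ^ n * m u)); rewrite IH.
    assert (qpoch (m u) q n <> 0) by (apply qpoch_nz; lra).
    assert (1 - m u * q ^ n <> 0) by (apply qpoch_factor_nz; lra).
    rewrite (Cmult_comm (q ^ n)); field; auto. }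
destruct (Cinv_qpoch_ulim (fun x => m (1 * expi x)) q r) as [U1 V1]; auto; try lra.
destruct (Cinv_qpoch_ulim (fun x => m (/ q * expi x)) q r) as [U2 V2]; auto; try lra.
apply (shift_mult_ulim fin).
- intros n; induction n as [|n IH]; simpl; [apply shift_mult_const|].
  apply shift_mult_mult; auto.
  apply (shift_mult_inv_one_minus (fun u => q ^ n * m u) r); auto.
  + apply shift_mult_mult; auto using shift_mult_const.
  + assert (Q : forall y, (Cmod y <= r)%R -> (Cmod (q ^ n * y) <= r)%R).
    { intros y Hy; rewrite Cmod_mult.
      assert (Cmod (q ^ n) <= 1)%R by (apply Cmod_pow_le1, Hq).
      pose proof (Cmod_ge_0 (q ^ n)); pose proof (Cmod_ge_0 y); nra. }
    split; intros x; apply Q; auto.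
- split.
  + apply (ulim_ext _ _ _ _ (fun n x => eq_sym (E n _ (B1 x))) (fun x => eq_refl) U1).
  + apply (ulim_ext _ _ _ _ (fun n x => eq_sym (E n _ (B2 x))) (fun x => eq_refl) U2).
- now split.
Qed.

Lemma shiftable_1 : shiftable (fun _ => 1).
Proof.
split; [apply circle_good_const|]; intros i j.
assert (E : forall (rho : C) (x : R), rho <> 0 ->
  (rho * expi x) ^ i * (/ (rho * expi x)) ^ j * 1
  = (rho ^ i * (/ rho) ^ j) * (expi x ^ i * (/ expi x) ^ j)).
{ intros rho x Hr.
  replace (/ (rho * expi x)) with (/ rho * / expi x) by (field; auto using expi_nz).
  rewrite !Cpow_mult_l; ring. }
assert (Z : forall rho : C, rho <> 0 -> moment i j (fun _ => 1) rho
  = (rho ^ i * (/ rho) ^ j) * CRInt (- PI) PI (fun x => expi x ^ i * (/ expi x) ^ j)).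
{ intros rho Hr; unfold moment; rewrite <- CRInt_scal.
  - apply CRInt_ext; intros; auto.
  - apply Ccontinuous_mult; apply Ccontinuous_pow; [apply Ccontinuous_expi|].
    apply Ccontinuous_inv; auto using expi_nz, Ccontinuous_expi. }
rewrite !Z by auto using C1_nz.
assert (C1 : forall x n, expi x ^ n * (/ expi x) ^ n = 1).
{ intros x n; rewrite <- Cpow_mult_l, Cinv_r, Cpow_1_l by apply expi_nz; auto. }
destruct (Nat.lt_trichotomy i j) as [H | [H | H]].
- replace (CRInt (- PI) PI (fun x => expi x ^ i * (/ expi x) ^ j)) with (RtoC 0); [ring|].
  rewrite <- (proj2 (CRInt_expi_S (j - S i))); apply CRInt_ext; intros x.
  replace j with (i + S (j - S i))%nat at 2 by lia.
  rewrite Cpow_add_r, Cmult_assoc, C1; ring.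
- subst j.
  assert (Y : forall rho : C, rho <> 0 -> rho ^ i * (/ rho) ^ i = 1).
  { intros rho Hr; rewrite <- Cpow_mult_l, Cinv_r, Cpow_1_l; auto. }
  now rewrite !Y by auto using C1_nz.
- replace (CRInt (- PI) PI (fun x => expi x ^ i * (/ expi x) ^ j)) with (RtoC 0); [ring|].
  rewrite <- (proj1 (CRInt_expi_S (i - S j))); apply CRInt_ext; intros x.
  replace i with (S (i - S j) + j)%nat at 2 by lia.
  rewrite Cpow_add_r, <- Cmult_assoc, C1; ring.
Qed.

(** Cauchy's theorem for the annulus: the zeroth moment of a shiftable function. *)
Lemma contour_shift (F : C -> C) : shift_mult F ->
  CRInt (- PI) PI (fun x => F (expi x)) = CRInt (- PI) PI (fun x => F (expi x / q)).
Proof.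
intros [_ H]; destruct (H _ shiftable_1) as [_ M]; specialize (M O O); unfold moment in M.
rewrite (CRInt_ext _ _ (fun x => F (expi x)) (fun x =>
  (1 * expi x) ^ 0 * (/ (1 * expi x)) ^ 0 * (F (1 * expi x) * 1))).
- rewrite M; apply CRInt_ext; intros x; simpl; unfold Cdiv.
  rewrite (Cmult_comm (expi x)); ring.
- intros x; simpl; rewrite (Cmult_1_l (expi x)); ring.
Qed.

End Shift.

(** * The Askey-Wilson weight and its q-difference *)

Lemma Csqrt_exists (q : C) : exists s : C, s * s = q.
Proof.
destruct q as [x y].
set (m := Cmod (x, y)).
assert (M2 : (m * m = x * x + y * y)%R).
{ pose proof (Cmod2_alt (x, y)) as E; fold m in E; unfold Re, Im in E; simpl in E; nra. }
assert (Mx : (Rabs x <= m)%R) by (apply (re_le_Cmod (x, y))).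
apply Rabs_le_between in Mx.
set (A := sqrt ((m + x) / 2)); set (B := sqrt ((m - x) / 2)).
assert (A2 : (A * A = (m + x) / 2)%R) by (apply sqrt_sqrt; lra).
assert (B2 : (B * B = (m - x) / 2)%R) by (apply sqrt_sqrt; lra).
assert (A0 : (0 <= A)%R) by apply sqrt_pos.
assert (B0 : (0 <= B)%R) by apply sqrt_pos.
assert (AB : (A * B = Rabs y / 2)%R).
{ apply Rsqr_inj; [nra | pose proof (Rabs_pos y); lra|].
  unfold Rsqr; replace (A * B * (A * B))%R with (A * A * (B * B))%R by ring.
  rewrite A2, B2; replace (Rabs y / 2 * (Rabs y / 2))%R with (Rabs y * Rabs y / 4)%R by field.
  rewrite <- Rabs_mult, Rabs_pos_eq by nra; nra. }
destruct (Rle_dec 0 y) as [Y | Y].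
- exists (A, B); rewrite Rabs_pos_eq in AB by auto.
  apply injective_projections; simpl; lra.
- exists (A, - B)%R; rewrite Rabs_left in AB by lra.
  apply injective_projections; simpl; lra.
Qed.

Definition weight_factor (a q z : C) : C := qpoch_inf (a * z) q * qpoch_inf (a / z) q.

Definition aw_weight (a b c d q z : C) : C :=
  qpoch_inf (z ^ 2) q * qpoch_inf (/ z ^ 2) q
  / (weight_factor a q z * weight_factor b q z * weight_factor c q z * weight_factor d q z).

Lemma Cmod_mult_expi (a : C) (x : R) : Cmod (a * expi x) = Cmod a.
Proof. rewrite Cmod_mult, Cmod_expi; ring. Qed.

Lemma Cmod_div_expi (a : C) (x : R) : Cmod (a / expi x) = Cmod a.
Proof. rewrite Cmod_div, Cmod_expi by apply expi_nz; field. Qed.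

Lemma Ccontinuous_mult_expi (a : C) : Ccontinuous (fun x => a * expi x).
Proof. apply Ccontinuous_mult; [apply Ccontinuous_const | apply Ccontinuous_expi]. Qed.

Lemma Ccontinuous_div_expi (a : C) : Ccontinuous (fun x => a / expi x).
Proof.
apply Ccontinuous_mult; [apply Ccontinuous_const|]; apply Ccontinuous_inv; auto using expi_nz, Ccontinuous_expi.
Qed.

Definition bounded_continuous (f : R -> C) : Prop := Ccontinuous f /\ bounded f.

Lemma bounded_continuous_mult (f g : R -> C) : bounded_continuous f -> bounded_continuous g ->
  bounded_continuous (fun x => f x * g x).
Proof. intros [] []; split; [now apply Ccontinuous_mult | now apply bounded_mult]. Qed.

Lemma bounded_continuous_qpoch_inf (f : R -> C) (q : C) : (Cmod q < 1)%R ->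
  bounded_continuous f -> bounded_continuous (fun x => qpoch_inf (f x) q).
Proof.
intros Hq []; split; [now apply Ccontinuous_qpoch_inf | now apply bounded_qpoch_inf].
Qed.

Lemma bounded_continuous_mult_expi (a : C) : bounded_continuous (fun x => a * expi x).
Proof.
split; [apply Ccontinuous_mult_expi|]; exists (Cmod a); intros; rewrite Cmod_mult_expi; lra.
Qed.

Lemma bounded_continuous_div_expi (a : C) : bounded_continuous (fun x => a / expi x).
Proof.
split; [apply Ccontinuous_div_expi|]; exists (Cmod a); intros; rewrite Cmod_div_expi; lra.
Qed.

Lemma bounded_continuous_inv_qpoch_inf (f : R -> C) (q : C) (r : R) : (Cmod q < 1)%R ->
  (r < 1)%R ->
  Ccontinuous f -> (forall x, (Cmod (f x) <= r)%R) -> bounded_continuous (fun x => / qpoch_inf (f x) q).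
Proof.
intros Hq Hr Hc Hf; split; [|now apply (Cinv_qpoch_ulim f q r)].
apply Ccontinuous_inv.
- intros x; apply qpoch_inf_nz; auto; specialize (Hf x); lra.
- apply Ccontinuous_qpoch_inf; auto; now exists r.
Qed.

Lemma weight_factor_nz (a q : C) (x : R) : (Cmod q < 1)%R -> (Cmod a < 1)%R ->
  weight_factor a q (expi x) <> 0.
Proof.
intros Hq Ha; apply Cmult_neq_0; apply qpoch_inf_nz; auto;
  [rewrite Cmod_mult_expi | rewrite Cmod_div_expi]; auto.
Qed.

Lemma bounded_continuous_inv_weight_factor (a q : C) : (Cmod q < 1)%R -> (Cmod a < 1)%R ->
  bounded_continuous (fun x => / weight_factor a q (expi x)).
Proof.
intros Hq Ha.
destruct (bounded_continuous_mult (fun x => / qpoch_inf (a * expi x) q) (fun x => / qpoch_inf (a / expi x) q))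
  as [H1 H2].
- apply (bounded_continuous_inv_qpoch_inf _ q (Cmod a)); auto using Ccontinuous_mult_expi.
  intros; rewrite Cmod_mult_expi; lra.
- apply (bounded_continuous_inv_qpoch_inf _ q (Cmod a)); auto using Ccontinuous_div_expi.
  intros; rewrite Cmod_div_expi; lra.
- assert (E : (fun x => / weight_factor a q (expi x)) =
     (fun x => / qpoch_inf (a * expi x) q * / qpoch_inf (a / expi x) q)).
  { apply functional_extensionality; intros x; unfold weight_factor; field; split; apply qpoch_inf_nz; auto;
    [rewrite Cmod_div_expi | rewrite Cmod_mult_expi]; auto. }
  rewrite E; now split.
Qed.

Lemma bounded_continuous_aw_weight (a b c d q : C) : (Cmod q < 1)%R ->
  (Cmod a < 1)%R -> (Cmod b < 1)%R -> (Cmod c < 1)%R -> (Cmod d < 1)%R ->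
  bounded_continuous (fun x => aw_weight a b c d q (expi x)).
Proof.
intros Hq Ha Hb Hc Hd.
assert (E : (fun x => aw_weight a b c d q (expi x)) = (fun x =>
  qpoch_inf (expi x * expi x) q * qpoch_inf (1 / expi x * (1 / expi x)) q
  * (/ weight_factor a q (expi x) * / weight_factor b q (expi x) * (/ weight_factor c q (expi x) * / weight_factor d q (expi x))))).
{ apply functional_extensionality; intros x; unfold aw_weight.
  replace (expi x * expi x) with (expi x ^ 2) by ring.
  pose proof (expi_nz x).
  replace (1 / expi x * (1 / expi x)) with (/ expi x ^ 2) by (field; auto).
  field; repeat split; auto using weight_factor_nz. }
assert (N1 : bounded_continuous expi).
{ split; [apply Ccontinuous_expi | exists 1%R; intros; rewrite Cmod_expi; lra]. }
rewrite E; clear E; apply bounded_continuous_mult; apply bounded_continuous_mult.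
- now apply bounded_continuous_qpoch_inf, bounded_continuous_mult.
- apply bounded_continuous_qpoch_inf, bounded_continuous_mult; auto using bounded_continuous_div_expi.
- apply bounded_continuous_mult; auto using bounded_continuous_inv_weight_factor.
- apply bounded_continuous_mult; auto using bounded_continuous_inv_weight_factor.
Qed.

Lemma qpoch_inf_recl (a q : C) : (Cmod q < 1)%R ->
  qpoch_inf a q = (1 - a) * qpoch_inf (a * q) q.
Proof.
intros Hq; rewrite (qpoch_inf_split a q 1 Hq), Cpow_1_r; simpl; ring.
Qed.

(** The function F of the q-difference equation for the weight. In terms of the
    weight with parameters a sqrt q, ..., d sqrt q it is, up to a constant, the
    value at sqrt(q) u divided by sqrt(q) u - 1/(sqrt(q) u). In this form no
    square root occurs and the cancellation of the poles at q u^2 = 1 has been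
    carried out. *)
Definition aw_flux (a b c d q u : C) : C :=
  / u * qpoch_inf (q * (u * u)) q * qpoch_inf (/ u * / u) q
  * (/ qpoch_inf (a * q * u) q * / qpoch_inf (a * / u) q)
  * (/ qpoch_inf (b * q * u) q * / qpoch_inf (b * / u) q)
  * (/ qpoch_inf (c * q * u) q * / qpoch_inf (c * / u) q)
  * (/ qpoch_inf (d * q * u) q * / qpoch_inf (d * / u) q).

(** On both circles a q u and a / u have modulus at most |a| < 1, so the poles
    of these factors lie outside the annulus. *)
Lemma shift_mult_den (a q : C) : (0 < Cmod q < 1)%R -> (Cmod a < 1)%R ->
  shift_mult q (fun u => / qpoch_inf (a * q * u) q * / qpoch_inf (a * / u) q).
Proof.
intros Hq Ha.
assert (Hqn : q <> 0) by (apply Cmod_gt_0; apply Hq).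
assert (A0 := Cmod_ge_0 a).
apply shift_mult_mult.
- apply (shift_mult_inv_qpoch_inf q Hq (fun u => a * q * u) (Cmod a)); auto.
  + apply shift_mult_mult; auto using shift_mult_const, shift_mult_id.
  + split; intros x.
    * rewrite !Cmod_mult, Cmod_expi, Cmod_1; nra.
    * replace (a * q * (/ q * expi x)) with (a * expi x) by (field; auto).
      rewrite Cmod_mult_expi; lra.
- apply (shift_mult_inv_qpoch_inf q Hq (fun u => a * / u) (Cmod a)); auto.
  + apply shift_mult_mult; auto using shift_mult_const, shift_mult_inv.
  + pose proof expi_nz.
    split; intros x.
    * replace (a * / (1 * expi x)) with (a / expi x) by (field; auto using C1_nz).
      rewrite Cmod_div_expi; lra.
    * replace (a * / (/ q * expi x)) with (q * (a / expi x)) by (field; auto).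
      rewrite Cmod_mult, Cmod_div_expi; nra.
Qed.

Lemma shift_mult_aw_flux (a b c d q : C) : (0 < Cmod q < 1)%R ->
  (Cmod a < 1)%R -> (Cmod b < 1)%R -> (Cmod c < 1)%R -> (Cmod d < 1)%R ->
  shift_mult q (aw_flux a b c d q).
Proof.
intros Hq Ha Hb Hc Hd; unfold aw_flux.
apply (shift_mult_mult q); [|now apply shift_mult_den].
apply (shift_mult_mult q); [|now apply shift_mult_den].
apply (shift_mult_mult q); [|now apply shift_mult_den].
apply (shift_mult_mult q); [|now apply shift_mult_den].
apply (shift_mult_mult q); [apply (shift_mult_mult q); [now apply shift_mult_inv|]|].
- apply (shift_mult_qpoch_inf q Hq).
  apply (shift_mult_mult q); [now apply shift_mult_const|].
  apply (shift_mult_mult q); now apply shift_mult_id.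
- apply (shift_mult_qpoch_inf q Hq).
  apply (shift_mult_mult q); now apply shift_mult_inv.
Qed.

(** The integrand of the recurrence for the Askey-Wilson integral is a
    q-difference. After division by - a, the identity says that F(z) - F(z/q) is the
    weight times (1 - e4)(z + 1/z) - (e1 - e3), with e_i the elementary symmetric
    functions of a, b, c, d; this factor is a multiple of the Askey-Wilson
    polynomial of degree 1. *)
Lemma aw_flux_difference (a b c d q : C) (x : R) : (0 < Cmod q < 1)%R ->
  (Cmod a < 1)%R -> (Cmod b < 1)%R -> (Cmod c < 1)%R -> (Cmod d < 1)%R ->
  (1 - a * b * c * d) * aw_weight (a * q) b c d q (expi x)
  - (1 - a * b) * (1 - a * c) * (1 - a * d) * aw_weight a b c d q (expi x)
  = - a * (aw_flux a b c d q (expi x) - aw_flux a b c d q (expi x / q)).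
Proof.
intros Hq Ha Hb Hc Hd.
pose proof (proj2 Hq) as Hq1.
assert (Hqn : q <> 0) by (apply Cmod_gt_0; apply Hq).
set (z := expi x); assert (Hz : z <> 0) by apply expi_nz.
assert (Zz : Cmod (/ (z * z)) = 1%R).
{ rewrite Cmod_inv, Cmod_mult by (apply Cmult_neq_0; auto); unfold z; rewrite Cmod_expi; field. }
assert (D : forall e, (Cmod e < 1)%R ->
   qpoch_inf (e * z) q = (1 - e * z) * qpoch_inf (e * q * z) q /\
   qpoch_inf (e / z) q = (1 - e / z) * qpoch_inf (e * q / z) q /\
   qpoch_inf (e * q * z) q <> 0 /\ qpoch_inf (e * q / z) q <> 0 /\
   1 - e * z <> 0 /\ 1 - e / z <> 0).
{ intros e He; repeat split.
  - rewrite qpoch_inf_recl by auto; do 2 f_equal; ring.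
  - rewrite qpoch_inf_recl by auto; do 2 f_equal; field; auto.
  - apply qpoch_inf_nz; auto; unfold z; rewrite Cmod_mult_expi.
    apply Cmod_mult_lt1; auto; lra.
  - apply qpoch_inf_nz; auto; unfold z; rewrite Cmod_div_expi.
    apply Cmod_mult_lt1; auto; lra.
  - apply one_minus_nz; unfold z; now rewrite Cmod_mult_expi.
  - apply one_minus_nz; unfold z; now rewrite Cmod_div_expi. }
destruct (D a Ha) as (A1 & A2 & A3 & A4 & A5 & A6).
destruct (D b Hb) as (B1 & B2 & B3 & B4 & B5 & B6).
destruct (D c Hc) as (G1 & G2 & G3 & G4 & G5 & G6).
destruct (D d Hd) as (D1 & D2 & D3 & D4 & D5 & D6); clear D.
assert (N1 : qpoch_inf (z ^ 2) q = (1 - z ^ 2) * qpoch_inf (q * (z * z)) q).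
{ rewrite qpoch_inf_recl by auto; do 2 f_equal; ring. }
assert (N2 : qpoch_inf (/ z ^ 2) q = (1 - / z ^ 2) * qpoch_inf (q / (z * z)) q).
{ rewrite qpoch_inf_recl by auto; do 2 f_equal; field; auto. }
assert (N3 : qpoch_inf (q * (z / q * (z / q))) q
   = (1 - z ^ 2 / q) * ((1 - z ^ 2) * qpoch_inf (q * (z * z)) q)).
{ rewrite <- N1, qpoch_inf_recl by auto; f_equal; [field; auto | f_equal; field; auto]. }
assert (N4 : 1 - q / (z * z) <> 0).
{ apply one_minus_nz; unfold Cdiv; rewrite Cmod_mult, Zz; lra. }
assert (N5 : qpoch_inf (/ (z / q) * / (z / q)) q = qpoch_inf (q / (z * z)) q / (1 - q / (z * z))).
{ rewrite (qpoch_inf_recl (q / (z * z))) by auto.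
  replace (/ (z / q) * / (z / q)) with (q / (z * z) * q) by (field; auto).
  field; split; auto. intros E; apply N4; replace (1 - q / (z * z)) with ((z * z - q) / (z * z))
    by (field; auto); rewrite E; field; auto. }
set (N := qpoch_inf (q * (z * z)) q) in *.
set (N' := qpoch_inf (q / (z * z)) q) in *.
set (A := qpoch_inf (a * q * z) q) in *; set (A' := qpoch_inf (a * q / z) q) in *.
set (B := qpoch_inf (b * q * z) q) in *; set (B' := qpoch_inf (b * q / z) q) in *.
set (G := qpoch_inf (c * q * z) q) in *; set (G' := qpoch_inf (c * q / z) q) in *.
set (D := qpoch_inf (d * q * z) q) in *; set (D' := qpoch_inf (d * q / z) q) in *.
set (V := N * N' / (A * A' * (B * B') * (G * G') * (D * D'))).
set (P1 := (1 - a * z) * (1 - b * z) * (1 - c * z) * (1 - d * z)).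
set (P2 := (1 - a / z) * (1 - b / z) * (1 - c / z) * (1 - d / z)).
assert (NP1 : P1 <> 0) by (unfold P1; repeat apply Cmult_neq_0; auto).
assert (NP2 : P2 <> 0) by (unfold P2; repeat apply Cmult_neq_0; auto).
assert (Ew : aw_weight a b c d q z = (1 - z ^ 2) * (1 - / z ^ 2) * V / (P1 * P2)).
{ unfold aw_weight, weight_factor; rewrite N1, N2, A1, A2, B1, B2, G1, G2, D1, D2.
  transitivity ((1 - z ^ 2) * (1 - / z ^ 2) * (N * N') / (P1 * P2 *
     (A * A' * (B * B') * (G * G') * (D * D')))).
  - f_equal; [ring | unfold P1, P2; ring].
  - unfold V; field; repeat split; auto. }
assert (Ew' : aw_weight (a * q) b c d q z
   = (1 - a * z) * (1 - a / z) * ((1 - z ^ 2) * (1 - / z ^ 2) * V / (P1 * P2))).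
{ unfold aw_weight, weight_factor; rewrite N1, N2, B1, B2, G1, G2, D1, D2; fold A A'.
  transitivity ((1 - a * z) * (1 - a / z) * ((1 - z ^ 2) * (1 - / z ^ 2) * (N * N')) /
     ((1 - a * z) * (1 - a / z) * (A * A' * ((1 - b * z) * B * ((1 - b / z) * B'))
      * ((1 - c * z) * G * ((1 - c / z) * G')) * ((1 - d * z) * D * ((1 - d / z) * D'))))).
  - generalize (1 - b / z) (1 - c / z) (1 - d / z) (1 - a / z) (/ z ^ 2)
      B6 G6 D6 A6; intros b' c' d' a' z' ? ? ? ?.
    field; repeat split; auto.
  - transitivity ((1 - a * z) * (1 - a / z) * ((1 - z ^ 2) * (1 - / z ^ 2) * (N * N')) /
      (P1 * P2 * (A * A' * (B * B') * (G * G') * (D * D')))).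
    + f_equal; unfold P1, P2; ring.
    + unfold V; generalize (1 - a / z) (/ z ^ 2); intros a' z'.
      field; repeat split; auto. }
assert (Ef : aw_flux a b c d q z = / z * (1 - / z ^ 2) * V / P2).
{ unfold aw_flux.
  change (a * / z) with (a / z); change (b * / z) with (b / z);
  change (c * / z) with (c / z); change (d * / z) with (d / z).
  replace (/ z * / z) with (/ z ^ 2) by (field; auto); rewrite N2, A2, B2, G2, D2.
  fold N A B G D; unfold V, P2.
  generalize (1 - b / z) (1 - c / z) (1 - d / z) (1 - a / z) (/ z ^ 2)
      B6 G6 D6 A6; intros b' c' d' a' z' ? ? ? ?.
  field; repeat split; auto. }
assert (Nz : (1 - z ^ 2 / q) / (1 - q / (z * z)) = - (z * z) / q).
{ assert (N4' : z * z - q <> 0).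
  { intros E; apply N4; replace (1 - q / (z * z)) with ((z * z - q) / (z * z)) by (field; auto).
    rewrite E; field; auto. }
  field; repeat split; auto. }
assert (Eg : aw_flux a b c d q (z / q) = - (z * (1 - z ^ 2) * V / P1)).
{ unfold aw_flux; rewrite N3, N5.
  replace (a * q * (z / q)) with (a * z) by (field; auto).
  replace (b * q * (z / q)) with (b * z) by (field; auto).
  replace (c * q * (z / q)) with (c * z) by (field; auto).
  replace (d * q * (z / q)) with (d * z) by (field; auto).
  replace (a * / (z / q)) with (a * q / z) by (field; auto).
  replace (b * / (z / q)) with (b * q / z) by (field; auto).
  replace (c * / (z / q)) with (c * q / z) by (field; auto).
  replace (d * / (z / q)) with (d * q / z) by (field; auto).
  fold A' B' G' D'; rewrite A1, B1, G1, D1.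
  match goal with |- ?X = _ => transitivity (q / z * ((1 - z ^ 2 / q) / (1 - q / (z * z)))
    * (1 - z ^ 2) * V / P1) end.
  - unfold V, P1; generalize (1 - z ^ 2 / q); intros e1.
    revert N4; generalize (1 - q / (z * z)); intros e2 N4.
    field; repeat split; auto.
  - rewrite Nz; field; repeat split; auto. }
rewrite Ew, Ew', Ef, Eg.
(* After the infinite products have cancelled this identity remains. *)
assert (Poly : ((1 - a * b * c * d) * ((1 - a * z) * (1 - a / z))
    - (1 - a * b) * (1 - a * c) * (1 - a * d)) * ((1 - z ^ 2) * (1 - / z ^ 2))
  = - a * (/ z * (1 - / z ^ 2) * P1 + z * (1 - z ^ 2) * P2)).
{ unfold P1, P2; field; auto. }
transitivity (((1 - a * b * c * d) * ((1 - a * z) * (1 - a / z))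
    - (1 - a * b) * (1 - a * c) * (1 - a * d)) * ((1 - z ^ 2) * (1 - / z ^ 2)) * (V / (P1 * P2)));
  [unfold Cdiv; ring|].
rewrite Poly; generalize (/ z ^ 2); intros z'; clearbody V P1 P2; field; auto.
Qed.

(** * The Askey-Wilson integral over the circle *)

Definition aw_integral (a b c d q : C) : C :=
  CRInt (- PI) PI (fun x => aw_weight a b c d q (expi x)).

Lemma Cmod_mult_q_lt1 (a q : C) : (Cmod q < 1)%R -> (Cmod a < 1)%R -> (Cmod (a * q) < 1)%R.
Proof. intros; apply Cmod_mult_lt1; lra. Qed.

Lemma aw_integral_shift (a b c d q : C) : (0 < Cmod q < 1)%R ->
  (Cmod a < 1)%R -> (Cmod b < 1)%R -> (Cmod c < 1)%R -> (Cmod d < 1)%R ->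
  (1 - a * b * c * d) * aw_integral (a * q) b c d q
  = (1 - a * b) * (1 - a * c) * (1 - a * d) * aw_integral a b c d q.
Proof.
intros Hq Ha Hb Hc Hd.
pose proof (Cmod_mult_q_lt1 a q (proj2 Hq) Ha) as Haq.
pose proof (bounded_continuous_aw_weight _ b c d q (proj2 Hq) Haq Hb Hc Hd) as [C1 _].
pose proof (bounded_continuous_aw_weight a b c d q (proj2 Hq) Ha Hb Hc Hd) as [C2 _].
pose proof (shift_mult_aw_flux a b c d q Hq Ha Hb Hc Hd) as F.
pose proof (contour_shift q Hq _ F) as S.
pose proof (proj1 (proj1 (proj1 F))) as F1; pose proof (proj1 (proj2 (proj1 F))) as F2.
assert (G1 : Ccontinuous (fun x => aw_flux a b c d q (expi x))).
{ apply (Ccontinuous_ext _ _ (fun x => f_equal _ (Cmult_1_l (expi x))) F1). }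
assert (G2 : Ccontinuous (fun x => aw_flux a b c d q (expi x / q))).
{ apply (Ccontinuous_ext _ _ (fun x => f_equal _ (Cmult_comm (/ q) (expi x))) F2). }
set (l := - ((1 - a * b) * (1 - a * c) * (1 - a * d))).
assert (E : (1 - a * b * c * d) * aw_integral (a * q) b c d q + l * aw_integral a b c d q
  = - a * (CRInt (- PI) PI (fun x => aw_flux a b c d q (expi x))
          + - (1) * CRInt (- PI) PI (fun x => aw_flux a b c d q (expi x / q)))).
{ unfold aw_integral; rewrite <- !CRInt_scal by auto.
  assert (K : Ccontinuous (fun x => - (1) * aw_flux a b c d q (expi x / q)))
    by (apply Ccontinuous_mult; auto using Ccontinuous_const).
  rewrite <- !CRInt_plus; auto; try (apply Ccontinuous_mult; auto using Ccontinuous_const).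
  rewrite <- CRInt_scal by (now apply Ccontinuous_plus).
  apply CRInt_ext; intros x; pose proof (aw_flux_difference a b c d q x Hq Ha Hb Hc Hd) as D.
  unfold l; transitivity (- a * (aw_flux a b c d q (expi x) - aw_flux a b c d q (expi x / q)));
    [rewrite <- D|]; ring. }
rewrite S in E; unfold l in E.
match type of E with ?X + - ?A * ?Y = _ =>
  replace X with (X + - A * Y + A * Y) by ring; rewrite E end.
ring.
Qed.

Lemma weight_factor_split (a q z : C) (n : nat) : (Cmod q < 1)%R -> z <> 0 ->
  weight_factor a q z = qpoch (a * z) q n * qpoch (a / z) q n * weight_factor (a * q ^ n) q z.
Proof.
intros Hq Hz; unfold weight_factor.
rewrite (qpoch_inf_split (a * z) q n Hq), (qpoch_inf_split (a / z) q n Hq).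
replace (a * q ^ n * z) with (a * z * q ^ n) by ring.
replace (a * q ^ n / z) with (a / z * q ^ n) by (field; auto).
ring.
Qed.

Lemma aw_weight_split (a b c d q : C) (n : nat) (x : R) : (Cmod q < 1)%R ->
  (Cmod a < 1)%R -> (Cmod b < 1)%R -> (Cmod c < 1)%R -> (Cmod d < 1)%R ->
  aw_weight (a * q ^ n) b c d q (expi x)
  = aw_weight a b c d q (expi x) * (qpoch (a * expi x) q n * qpoch (a / expi x) q n).
Proof.
intros Hq Ha Hb Hc Hd; unfold aw_weight.
pose proof (weight_factor_nz a q x Hq Ha) as N; pose proof (weight_factor_nz b q x Hq Hb);
pose proof (weight_factor_nz c q x Hq Hc); pose proof (weight_factor_nz d q x Hq Hd).
rewrite (weight_factor_split a q (expi x) n Hq (expi_nz x)) in N |- *.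
assert (weight_factor (a * q ^ n) q (expi x) <> 0) by (intros E; apply N; rewrite E; ring).
assert (qpoch (a * expi x) q n <> 0)
  by (apply qpoch_nz; auto; now rewrite Cmod_mult_expi).
assert (qpoch (a / expi x) q n <> 0)
  by (apply qpoch_nz; auto; now rewrite Cmod_div_expi).
field; repeat split; auto.
Qed.

Lemma aw_integral_shift_n (a b c d q : C) (n : nat) : (0 < Cmod q < 1)%R ->
  (Cmod a < 1)%R -> (Cmod b < 1)%R -> (Cmod c < 1)%R -> (Cmod d < 1)%R ->
  qpoch (a * b * c * d) q n * aw_integral (a * q ^ n) b c d q
  = qpoch (a * b) q n * qpoch (a * c) q n * qpoch (a * d) q n * aw_integral a b c d q.
Proof.
intros Hq Ha Hb Hc Hd; induction n as [|n IH].
- simpl; rewrite (Cmult_1_r a); ring.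
- assert (Han : (Cmod (a * q ^ n) < 1)%R).
  { apply Cmod_mult_lt1; auto; apply Cmod_pow_le1, Hq. }
  pose proof (aw_integral_shift (a * q ^ n) b c d q Hq Han Hb Hc Hd) as HS.
  rewrite !qpoch_S.
  replace (a * q ^ S n) with (a * q ^ n * q) by (simpl; ring).
  replace (qpoch (a * b * c * d) q n * (1 - a * b * c * d * q ^ n) * aw_integral (a * q ^ n * q) b c d q)
    with (qpoch (a * b * c * d) q n * ((1 - a * q ^ n * b * c * d) * aw_integral (a * q ^ n * q) b c d q))
    by ring.
  rewrite HS.
  replace (qpoch (a * b * c * d) q n *
     ((1 - a * q ^ n * b) * (1 - a * q ^ n * c) * (1 - a * q ^ n * d) * aw_integral (a * q ^ n) b c d q))
    with ((1 - a * q ^ n * b) * (1 - a * q ^ n * c) * (1 - a * q ^ n * d) *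
      (qpoch (a * b * c * d) q n * aw_integral (a * q ^ n) b c d q)) by ring.
  rewrite IH; ring.
Qed.

Lemma bounded_mult_expi (a : C) : bounded (fun x => a * expi x).
Proof. apply bounded_continuous_mult_expi. Qed.

Lemma bounded_div_expi (a : C) : bounded (fun x => a / expi x).
Proof. apply bounded_continuous_div_expi. Qed.

(** Iterate the recurrence and let a q^n tend to 0; the weights converge
    uniformly because they are w(a) times finite products. *)
Lemma aw_integral_to_0 (a b c d q : C) : (0 < Cmod q < 1)%R ->
  (Cmod a < 1)%R -> (Cmod b < 1)%R -> (Cmod c < 1)%R -> (Cmod d < 1)%R ->
  qpoch_inf (a * b * c * d) q * aw_integral 0 b c d q
  = qpoch_inf (a * b) q * qpoch_inf (a * c) q * qpoch_inf (a * d) q * aw_integral a b c d q.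
Proof.
intros Hq Ha Hb Hc Hd; pose proof (proj2 Hq) as Hq1.
assert (L : clim (fun n => aw_integral (a * q ^ n) b c d q) (aw_integral 0 b c d q)).
{ unfold aw_integral; apply CRInt_ulim; [pose proof PI_RGT_0; lra | |].
  - apply (ulim_ext
      (fun n x => aw_weight a b c d q (expi x) * (qpoch (a * expi x) q n * qpoch (a / expi x) q n))
      _ (fun x => aw_weight a b c d q (expi x) * (qpoch_inf (a * expi x) q * qpoch_inf (a / expi x) q))).
    + intros n x; symmetry; now apply aw_weight_split.
    + intros x; unfold aw_weight; fold (weight_factor a q (expi x)).
      pose proof (weight_factor_nz a q x Hq1 Ha); pose proof (weight_factor_nz b q x Hq1 Hb);
      pose proof (weight_factor_nz c q x Hq1 Hc); pose proof (weight_factor_nz d q x Hq1 Hd).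
      replace (weight_factor 0 q (expi x)) with (RtoC 1).
      * field; repeat split; auto using C1_nz.
      * unfold weight_factor, Cdiv; rewrite !(Cmult_0_l _), qpoch_inf_0; auto; ring.
    + pose proof (bounded_mult_expi a); pose proof (bounded_div_expi a).
      apply ulim_mult.
      * now apply bounded_continuous_aw_weight.
      * apply bounded_mult; now apply bounded_qpoch_inf.
      * apply ulim_const.
      * apply ulim_mult; try (now apply bounded_qpoch_inf); now apply qpoch_ulim.
  - intros n; apply bounded_continuous_aw_weight; auto.
    apply Cmod_mult_lt1; auto using Cmod_pow_le1. }
apply (clim_unique (fun n => qpoch (a * b * c * d) q n * aw_integral (a * q ^ n) b c d q)).
- apply clim_mult; auto; now apply qpoch_inf_lim.
- apply (clim_ext (fun n => qpoch (a * b) q n * qpoch (a * c) q n * qpoch (a * d) q n * aw_integral a b c d q)).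
  + intros n; symmetry; now apply aw_integral_shift_n.
  + repeat apply clim_mult; try (now apply qpoch_inf_lim); apply clim_const.
Qed.

Lemma aw_integral_perm (a b c d q : C) :
  aw_integral a b c d q = aw_integral b c d a q.
Proof.
unfold aw_integral; apply CRInt_ext; intros x; unfold aw_weight.
match goal with |- _ / ?x = _ / ?y => replace x with y by ring end; reflexivity.
Qed.

Lemma aw_integral_reduce (a b c d q : C) : (0 < Cmod q < 1)%R ->
  (Cmod a < 1)%R -> (Cmod b < 1)%R -> (Cmod c < 1)%R -> (Cmod d < 1)%R ->
  qpoch_inf (a * b) q * qpoch_inf (a * c) q * qpoch_inf (a * d) q
  * qpoch_inf (b * c) q * qpoch_inf (b * d) q * qpoch_inf (c * d) q * aw_integral a b c d q
  = qpoch_inf (a * b * c * d) q * aw_integral 0 0 0 0 q.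
Proof.
intros Hq Ha Hb Hc Hd.
assert (H0 : (Cmod 0 < 1)%R) by (rewrite Cmod_0; lra).
pose proof (aw_integral_to_0 a b c d q Hq Ha Hb Hc Hd) as E1.
pose proof (aw_integral_to_0 b c d 0 q Hq Hb Hc Hd H0) as E2.
pose proof (aw_integral_to_0 c d 0 0 q Hq Hc Hd H0 H0) as E3.
pose proof (aw_integral_to_0 d 0 0 0 q Hq Hd H0 H0 H0) as E4.
rewrite (aw_integral_perm 0 b c d) in E1.
rewrite (aw_integral_perm 0 c d 0) in E2.
rewrite (aw_integral_perm 0 d 0 0) in E3.
replace (b * c * d * 0) with (RtoC 0) in E2 by ring.
replace (b * 0) with (RtoC 0) in E2 by ring.
replace (c * d * 0 * 0) with (RtoC 0) in E3 by ring.
replace (c * 0) with (RtoC 0) in E3 by ring.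
replace (d * 0 * 0 * 0) with (RtoC 0) in E4 by ring.
replace (d * 0) with (RtoC 0) in E4 by ring.
rewrite (qpoch_inf_0 q (proj2 Hq)) in E2, E3, E4.
rewrite Cmult_1_l in E2, E3, E4; rewrite E4, E3, E2.
transitivity (qpoch_inf (b * c) q * qpoch_inf (b * d) q * qpoch_inf (c * d) q
  * (qpoch_inf (a * b * c * d) q * aw_integral b c d 0 q)); [rewrite E1|]; ring.
Qed.

(** With q = s^2: 1 - q^(2i+1) y^2 and 1 - q^(2i+2) y^2 are differences of squares. *)
Lemma qpoch_double (s y : C) (n : nat) :
  qpoch (s * s * (y * y)) (s * s) (2 * n)
  = qpoch (s * s * y) (s * s) n * qpoch (- (s * s) * y) (s * s) n
    * (qpoch (s * y) (s * s) n * qpoch (- s * y) (s * s) n).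
Proof.
induction n as [|n IH]; [simpl; ring|].
replace (2 * S n)%nat with (S (S (2 * n))) by lia.
rewrite !qpoch_S, IH, Cpow_S.
replace ((s * s) ^ (2 * n)) with ((s * s) ^ n * (s * s) ^ n) by
  (rewrite <- Cpow_add_r; f_equal; lia).
ring.
Qed.

Lemma clim_double (u : nat -> C) (l : C) : clim u l -> clim (fun n => u (2 * n)%nat) l.
Proof.
intros H eps He; destruct (H eps He) as [N HN]; exists N; intros n Hn x.
apply (HN (2 * n)%nat ltac:(lia) x).
Qed.

Lemma qpoch_inf_double (s y : C) : (Cmod (s * s) < 1)%R ->
  qpoch_inf (s * s * (y * y)) (s * s)
  = qpoch_inf (s * s * y) (s * s) * qpoch_inf (- (s * s) * y) (s * s)
    * (qpoch_inf (s * y) (s * s) * qpoch_inf (- s * y) (s * s)).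
Proof.
intros Hq; apply (clim_unique (fun n => qpoch (s * s * (y * y)) (s * s) (2 * n))).
- now apply clim_double, qpoch_inf_lim.
- apply (clim_ext _ _ _ (fun n => eq_sym (qpoch_double s y n))).
  repeat apply clim_mult; now apply qpoch_inf_lim.
Qed.

Lemma CRInt_one : CRInt (- PI) PI (fun _ => 1) = 2 * PI.
Proof.
apply injective_projections; simpl; rewrite RInt_const; unfold scal; simpl; unfold mult; simpl; ring.
Qed.

(** The constant is found from one set of parameters for which the integral is
    elementary, namely q, -q, s, -s with s^2 = q. *)
Lemma aw_integral_0 (q : C) : (0 < Cmod q < 1)%R ->
  qpoch_inf q q * aw_integral 0 0 0 0 q = 4 * PI.
Proof.
intros Hq0; destruct (Csqrt_exists q) as [s <-].
pose proof (proj2 Hq0) as Hq.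
assert (Hs : (Cmod s < 1)%R).
{ rewrite Cmod_mult in Hq; pose proof (Cmod_ge_0 s); nra. }
assert (Hnq : (Cmod (- (s * s)) < 1)%R) by now rewrite Cmod_opp.
assert (Hns : (Cmod (- s) < 1)%R) by now rewrite Cmod_opp.
pose proof (aw_integral_reduce (s * s) (- (s * s)) s (- s) (s * s) Hq0 Hq Hnq Hs Hns) as E.
(* The denominator is (q z^2, q / z^2; q), which leaves (1 - z^2)(1 - 1/z^2). *)
assert (J : aw_integral (s * s) (- (s * s)) s (- s) (s * s) = 4 * PI).
{ unfold aw_integral.
  transitivity (CRInt (- PI) PI (fun x => 2 * 1 + (- (1) * expi x ^ 2 + - (1) * (/ expi x) ^ 2))).
  - apply CRInt_ext; intros x; unfold aw_weight.
    pose proof (expi_nz x) as Hz; set (z := expi x) in *.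
    assert (D : forall y, y = z \/ y = / z -> qpoch_inf (y ^ 2) (s * s) = (1 - y ^ 2)
      * (qpoch_inf (s * s * y) (s * s) * qpoch_inf (- (s * s) * y) (s * s)
         * (qpoch_inf (s * y) (s * s) * qpoch_inf (- s * y) (s * s)))).
    { intros y _; rewrite <- qpoch_inf_double, qpoch_inf_recl by auto; do 2 f_equal; ring. }
    pose proof (D z (or_introl eq_refl)) as D1; pose proof (D (/ z) (or_intror eq_refl)) as D2.
    replace ((/ z) ^ 2) with (/ z ^ 2) in * by (field; auto).
    rewrite D1, D2.
    pose proof (weight_factor_nz (s * s) (s * s) x Hq Hq) as N1.
    pose proof (weight_factor_nz (- (s * s)) (s * s) x Hq Hnq) as N2.
    pose proof (weight_factor_nz s (s * s) x Hq Hs) as N3.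
    pose proof (weight_factor_nz (- s) (s * s) x Hq Hns) as N4.
    unfold weight_factor in *; fold z in N1, N2, N3, N4.
    change (s * s / z) with (s * s * / z) in *; change (- (s * s) / z) with (- (s * s) * / z) in *.
    change (s / z) with (s * / z) in *; change (- s / z) with (- s * / z) in *.
    match goal with |- _ / ?den = _ => set (Q := den);
      assert (NQ : Q <> 0) by (unfold Q; repeat first [assumption | apply Cmult_neq_0]);
      transitivity ((1 - z ^ 2) * (1 - / z ^ 2) * (den / Q)) end.
    + unfold Cdiv; ring.
    + fold Q; clearbody Q; field; auto.
  - assert (K1 : Ccontinuous (fun x => expi x ^ 2)) by (apply Ccontinuous_pow, Ccontinuous_expi).
    assert (K2 : Ccontinuous (fun x => (/ expi x) ^ 2))
      by (apply Ccontinuous_pow, Ccontinuous_inv; auto using expi_nz, Ccontinuous_expi).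
    rewrite !CRInt_plus, !CRInt_scal; auto using Ccontinuous_const, Ccontinuous_mult, Ccontinuous_plus.
    rewrite CRInt_one, (proj1 (CRInt_expi_S 1)), (proj2 (CRInt_expi_S 1)); ring. }
rewrite J in E; clear J.
set (q := s * s) in *.
pose proof (qpoch_inf_double s 1 Hq) as Eu; fold q in Eu.
replace (q * (1 * 1)) with q in Eu by ring.
replace (q * 1) with q in Eu by ring.
replace (- q * 1) with (- q) in Eu by ring.
replace (s * 1) with s in Eu by ring.
replace (- s * 1) with (- s) in Eu by ring.
pose proof (qpoch_inf_nz q q Hq Hq) as NQ.
(* Euler's identity: the product of (-q; q) and (q; q^2) is 1, where (q; q^2) = (s, -s; q). *)
assert (Eu' : qpoch_inf (- q) q * (qpoch_inf s q * qpoch_inf (- s) q) = 1).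
{ replace (qpoch_inf (- q) q * (qpoch_inf s q * qpoch_inf (- s) q)) with
  (qpoch_inf q q * qpoch_inf (- q) q * (qpoch_inf s q * qpoch_inf (- s) q) / qpoch_inf q q)
    by (field; auto).
  rewrite <- Eu; field; auto. }
replace (q * - q) with (- q * q) in E by ring.
replace (- q * q * s * - s) with (q * q * q) in E by (unfold q; ring).
replace (q * s) with (s * q) in E by ring.
replace (q * - s) with (- s * q) in E by ring.
replace (- q * s) with (- s * q) in E by ring.
replace (- q * - s) with (s * q) in E by ring.
replace (s * - s) with (- q) in E by (unfold q; ring).
pose proof (qpoch_inf_recl (- q) q Hq) as R1.
pose proof (qpoch_inf_recl s q Hq) as R2.
pose proof (qpoch_inf_recl (- s) q Hq) as R3.
pose proof (qpoch_inf_recl q q Hq) as R4.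
rewrite (qpoch_inf_recl (q * q) q Hq) in R4.
assert (NQ3 : qpoch_inf (q * q * q) q <> 0).
{ intros Z; apply NQ; rewrite R4, Z; ring. }
transitivity (qpoch_inf q q * (qpoch_inf (q * q * q) q * aw_integral 0 0 0 0 q) / qpoch_inf (q * q * q) q);
  [field; auto|].
rewrite <- E.
transitivity (4 * PI * ((qpoch_inf (- q) q * (qpoch_inf s q * qpoch_inf (- s) q))
   * (qpoch_inf (- q) q * (qpoch_inf s q * qpoch_inf (- s) q)))).
2: { rewrite Eu'; ring. }
rewrite R4, R1, R2, R3.
revert NQ3; generalize (qpoch_inf (q * q * q) q); intros W NW.
unfold q; field; auto.
Qed.

(** * Orthogonality *)

Lemma CRInt_even (f : R -> C) : Ccontinuous f -> (forall x, f (- x)%R = f x) ->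
  CRInt (- PI) PI f = 2 * CRInt 0 PI f.
Proof.
intros Hf He.
assert (K : forall g : R -> R, (forall x, continuous g x) -> (forall x, g (- x)%R = g x) ->
  RInt g (- PI) PI = (2 * RInt g 0 PI)%R).
{ intros g Hg Eg.
  assert (X : forall u v, ex_RInt g u v)
    by (intros; apply (ex_RInt_continuous (V := R_CompleteNormedModule)); auto).
  rewrite <- (RInt_Chasles g (- PI) 0 PI); auto.
  pose proof (RInt_comp_lin g (-1) 0 0 PI) as L.
  replace (-1 * 0 + 0)%R with 0%R in L by ring.
  replace (-1 * PI + 0)%R with (- PI)%R in L by ring.
  specialize (L (X _ _)).
  rewrite <- (opp_RInt_swap g 0 (- PI)) by auto.
  rewrite <- L.
  rewrite (RInt_ext _ (fun y => scal (-1)%R (g y))).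
  2: { intros x _; f_equal; rewrite <- (Eg x); f_equal; ring. }
  rewrite (RInt_scal (V := R_CompleteNormedModule)) by auto.
  unfold scal, plus, opp; simpl; unfold mult; simpl; ring. }
apply injective_projections; simpl.
- rewrite (K (fun t => Re (f t))); [ring | intros x; exact (proj1 (Hf x)) | intros x; now rewrite He].
- rewrite (K (fun t => Im (f t))); [ring | intros x; exact (proj2 (Hf x)) | intros x; now rewrite He].
Qed.

Lemma aw_weight_inv (a b c d q z : C) : z <> 0 ->
  aw_weight a b c d q (/ z) = aw_weight a b c d q z.
Proof.
intros Hz; unfold aw_weight, weight_factor.
replace (/ (/ z) ^ 2) with (z ^ 2) by (field; auto).
replace ((/ z) ^ 2) with (/ z ^ 2) by (field; auto).
assert (E : forall e, e / / z = e * z) by (intros; field; auto).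
rewrite !E; unfold Cdiv.
f_equal; [ring | f_equal; ring].
Qed.

Definition aw_half (a b c d q : C) : C := CRInt 0 PI (fun x => aw_weight a b c d q (expi x)).

Lemma askey_wilson_integral (a b c d q : C) : (0 < Cmod q < 1)%R ->
  (Cmod a < 1)%R -> (Cmod b < 1)%R -> (Cmod c < 1)%R -> (Cmod d < 1)%R ->
  aw_half a b c d q = 2 * PI * qpoch_inf (a * b * c * d) q
   / (qpoch_inf q q * qpoch_inf (a * b) q * qpoch_inf (a * c) q * qpoch_inf (a * d) q
  * qpoch_inf (b * c) q * qpoch_inf (b * d) q * qpoch_inf (c * d) q).
Proof.
intros Hq Ha Hb Hc Hd; pose proof (proj2 Hq) as Hq1.
assert (Lt : forall x y, (Cmod x < 1)%R -> (Cmod y < 1)%R -> qpoch_inf (x * y) q <> 0).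
{ intros x y Hx Hy; apply qpoch_inf_nz; auto; apply Cmod_mult_lt1; lra. }
pose proof (qpoch_inf_nz q q Hq1 Hq1).
pose proof (aw_integral_reduce a b c d q Hq Ha Hb Hc Hd) as E.
pose proof (aw_integral_0 q Hq) as E0.
assert (H2 : aw_integral a b c d q = 2 * aw_half a b c d q).
{ apply CRInt_even; [now apply bounded_continuous_aw_weight|].
  intros x; rewrite expi_opp; apply aw_weight_inv, expi_nz. }
assert (N2 : RtoC 2 <> 0) by (intros X; apply RtoC_inj in X; lra).
replace (aw_half a b c d q) with (aw_integral a b c d q / 2) by (rewrite H2; field; auto).
replace (aw_integral 0 0 0 0 q) with (4 * PI / qpoch_inf q q) in E
  by (rewrite <- E0; field; auto).
match type of E with ?D * ?J = ?V => assert (NZ : D <> 0);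
  [repeat apply Cmult_neq_0; auto | replace J with (V / D) by (rewrite <- E; field; repeat split; auto)] end.
field; repeat split; auto.
Qed.

Definition aw_basis (a q z : C) (k : nat) : C := qpoch (a * z) q k * qpoch (a / z) q k.

Lemma Ccontinuous_aw_basis (a q : C) (k : nat) :
  Ccontinuous (fun x => aw_basis a q (expi x) k).
Proof.
apply Ccontinuous_mult; apply Ccontinuous_qpoch; [apply Ccontinuous_mult_expi | apply Ccontinuous_div_expi].
Qed.

(** (az, a/z; q)_k w(a,b,c,d) = w(a q^k,b,c,d), and likewise for c, so the
    integral is an Askey-Wilson integral with shifted parameters. *)
Lemma aw_moment (a b c d q : C) (k j : nat) : (0 < Cmod q < 1)%R ->
  (Cmod a < 1)%R -> (Cmod b < 1)%R -> (Cmod c < 1)%R -> (Cmod d < 1)%R ->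
  CRInt 0 PI (fun x => aw_basis a q (expi x) k * aw_basis c q (expi x) j
                    * aw_weight a b c d q (expi x))
  = aw_half a b c d q * (qpoch (a * b) q k * qpoch (a * d) q k)
    * (qpoch (c * d) q j * qpoch (c * b) q j)
    * (qpoch (a * c) q (k + j) / qpoch (a * b * c * d) q (k + j)).
Proof.
intros Hq Ha Hb Hc Hd; pose proof (proj2 Hq) as Hq1.
assert (Hak : (Cmod (a * q ^ k) < 1)%R) by (apply Cmod_mult_lt1; auto using Cmod_pow_le1).
assert (Hcj : (Cmod (c * q ^ j) < 1)%R) by (apply Cmod_mult_lt1; auto using Cmod_pow_le1).
transitivity (aw_half (a * q ^ k) b (c * q ^ j) d q).
- apply CRInt_ext; intros x.
  rewrite aw_weight_split by auto.
  assert (E : forall a' c', aw_weight a' b c' d q (expi x) = aw_weight c' b a' d q (expi x)).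
  { intros; unfold aw_weight; f_equal; ring. }
  rewrite (E a (c * q ^ j)), aw_weight_split, (E c a) by auto.
  unfold aw_basis; ring.
- rewrite !askey_wilson_integral by auto.
  assert (Lt : forall x y, (Cmod x < 1)%R -> (Cmod y < 1)%R -> (Cmod (x * y) < 1)%R).
  { intros x y Hx Hy; apply Cmod_mult_lt1; lra. }
  assert (NZ : forall x i, (Cmod x < 1)%R -> qpoch x q i <> 0 /\ qpoch_inf (x * q ^ i) q <> 0).
  { intros x i Hx; split; [now apply qpoch_nz | apply qpoch_inf_nz; auto].
    apply Cmod_mult_lt1; auto using Cmod_pow_le1. }
  rewrite (qpoch_inf_split (a * b * c * d) q (k + j)) by auto.
  rewrite (qpoch_inf_split (a * c) q (k + j)) by auto.
  rewrite (qpoch_inf_split (a * b) q k), (qpoch_inf_split (a * d) q k) by auto.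
  rewrite (qpoch_inf_split (b * c) q j), (qpoch_inf_split (c * d) q j) by auto.
  replace (a * q ^ k * b * (c * q ^ j) * d) with (a * b * c * d * q ^ (k + j))
    by (rewrite Cpow_add_r; ring).
  replace (a * q ^ k * (c * q ^ j)) with (a * c * q ^ (k + j)) by (rewrite Cpow_add_r; ring).
  replace (a * q ^ k * b) with (a * b * q ^ k) by ring.
  replace (a * q ^ k * d) with (a * d * q ^ k) by ring.
  replace (b * (c * q ^ j)) with (b * c * q ^ j) by ring.
  replace (c * q ^ j * d) with (c * d * q ^ j) by ring.
  rewrite (Cmult_comm c b).
  destruct (NZ (a * b * c * d) (k + j)%nat) as [? ?]; [auto|].
  destruct (NZ (a * c) (k + j)%nat) as [? ?]; [auto|].
  destruct (NZ (a * b) k) as [? ?]; [auto|].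
  destruct (NZ (a * d) k) as [? ?]; [auto|].
  destruct (NZ (b * c) j) as [? ?]; [auto|].
  destruct (NZ (c * d) j) as [? ?]; [auto|].
  pose proof (qpoch_inf_nz q q Hq1 Hq1).
  assert (qpoch_inf (b * d) q <> 0) by (apply qpoch_inf_nz; auto).
  field; repeat split; auto.
Qed.

(** What is left of the coefficient of an Askey-Wilson polynomial after the
    factors (ab, ad; q)_k have cancelled against those produced by [aw_moment].
    It depends on the parameters through abcd and ac only, hence is the same for
    (a,b,c,d) and for (c,d,a,b). *)
Definition aw_reduced_coef (n k : nat) (abcd ac q : C) : C :=
  qpoch (/ q ^ n) q k * qpoch (abcd * q ^ n / q) q k * q ^ k / (qpoch q q k * qpoch ac q k).

(** The q-Saalschuetz sum with x = abcd q^(n-1), y = ac q^j, g = q^(1-n)/(ac). *)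
Lemma aw_reduced_sum (abcd ac bd q : C) (n j : nat) : (0 < Cmod q < 1)%R ->
  abcd = ac * bd -> ac <> 0 -> (Cmod ac < 1)%R -> (Cmod abcd < 1)%R ->
  csum (fun k => aw_reduced_coef n k abcd ac q * (qpoch ac q (k + j) / qpoch abcd q (k + j))) (S n)
  = qpoch ac q j / qpoch abcd q j * (ac ^ n * qsgn q n)
    * (qpoch bd q n * qpoch (q ^ S j / q ^ n) q n)
    / (qpoch ac q n * qpoch (abcd * q ^ j) q n).
Proof.
intros Hq E Hac Hac1 Habcd; pose proof (proj2 Hq) as Hq1.
assert (Hqn : q <> 0) by (apply Cmod_gt_0; apply Hq).
pose proof (Cpow_nz q n Hqn) as Nqn.
(* Reversing (g)_(n-k) yields (ac q^k)_(n-k) = (ac)_n / (ac)_k, up to powers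
   that combine to (ac)^n times qsgn q n. *)
set (x := abcd * q ^ n / q); set (y := ac * q ^ j); set (g := q / (ac * q ^ n)).
assert (EZ : x * y * g = abcd * q ^ j) by (unfold x, y, g; field; auto).
assert (HZ : (Cmod (abcd * q ^ j) < 1)%R) by (apply Cmod_mult_lt1; auto using Cmod_pow_le1).
pose proof (q_saalschutz x y g q n Hq1) as HS; rewrite EZ in HS; specialize (HS HZ).
replace (x * g) with bd in HS by (unfold x, g; rewrite E; field; auto).
replace (y * g) with (q ^ S j / q ^ n) in HS by (unfold y, g; simpl; field; auto).
pose proof (qpoch_nz ac q n Hq1 Hac1). pose proof (qpoch_nz q q n Hq1 Hq1).
pose proof (qpoch_nz _ q n Hq1 HZ). pose proof (qpoch_nz abcd q j Hq1 Habcd).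
transitivity (qpoch ac q j / qpoch abcd q j * (ac ^ n * qsgn q n) * qpoch q q n / qpoch ac q n
  * csum (saalschutz_term x y g q n) (S n)).
2: { rewrite HS; field; repeat split; auto. }
rewrite <- csum_scal; apply csum_ext; intros k Hk.
unfold aw_reduced_coef, saalschutz_term; rewrite EZ; fold x.
pose proof (qpoch_neg_power q n k Hqn ltac:(lia)) as NP.
assert (Em : exists r, n = (k + r)%nat) by (exists (n - k)%nat; lia).
destruct Em as [r Em].
replace (n - k)%nat with r in * by lia.
assert (R : qpoch (ac * q ^ k) q r = qpoch g q r * (ac * q ^ k) ^ r * qsgn q r).
{ rewrite qpoch_reverse by (try apply Cmult_neq_0; auto using Cpow_nz).
  do 3 f_equal; unfold g; rewrite Em, Cpow_add_r; field; auto using Cpow_nz. }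
assert (S1 : qpoch ac q n = qpoch ac q k * (qpoch g q r * (ac * q ^ k) ^ r * qsgn q r))
  by (rewrite <- R, Em; apply qpoch_add).
assert (S2 : qpoch ac q (k + j) = qpoch ac q j * qpoch y q k)
  by (rewrite Nat.add_comm; apply qpoch_add).
assert (S3 : qpoch abcd q (k + j) = qpoch abcd q j * qpoch (abcd * q ^ j) q k)
  by (rewrite Nat.add_comm; apply qpoch_add).
assert (S4 : qsgn q n * (ac * q ^ n) ^ k * (ac ^ n) =
   qsgn q k * qsgn q r * (ac * q ^ k) ^ r * ac ^ k * (q ^ n) ^ k * ac ^ k).
{ rewrite Em, qsgn_add, !Cpow_mult_l, !Cpow_add_r; ring. }
assert (S5 : g ^ k * (ac * q ^ n) ^ k = q ^ k).
{ rewrite <- Cpow_mult_l; f_equal; unfold g; field; auto. }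
pose proof (qpoch_nz ac q k Hq1 Hac1). pose proof (qpoch_nz q q k Hq1 Hq1).
pose proof (qpoch_nz q q r Hq1 Hq1).
pose proof (qpoch_nz _ q k Hq1 HZ).
pose proof (Cpow_nz (q ^ n) k Nqn). pose proof (Cpow_nz ac k Hac).
assert (NX : (ac * q ^ n) ^ k <> 0) by (apply Cpow_nz, Cmult_neq_0; auto).
pose proof (qsgn_nz q k Hqn). pose proof (qsgn_nz q r Hqn).
assert (NY : (ac * q ^ k) ^ r <> 0) by (apply Cpow_nz, Cmult_neq_0; auto using Cpow_nz).
replace (qpoch (/ q ^ n) q k) with (qpoch q q n * qsgn q k / (qpoch q q r * (q ^ n) ^ k))
  by (rewrite <- NP; field; auto).
replace (g ^ k) with (q ^ k / (ac * q ^ n) ^ k) by (rewrite <- S5; field; auto).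
replace (ac ^ n * qsgn q n) with (qsgn q k * qsgn q r * (ac * q ^ k) ^ r * ac ^ k * (q ^ n) ^ k * ac ^ k
  / (ac * q ^ n) ^ k) by (rewrite <- S4; field; auto).
assert (NG : qpoch g q r <> 0) by (intros Z; apply H; rewrite S1, Z; ring).
rewrite S1, S2, S3.
replace ((ac * q ^ n) ^ k) with (ac ^ k * (q ^ n) ^ k) by (now rewrite Cpow_mult_l).
field; repeat split; auto.
Qed.

Lemma qpoch_root (q : C) (n j : nat) : q <> 0 -> (j < n)%nat ->
  qpoch (q ^ S j / q ^ n) q n = 0.
Proof.
intros Hq Hj.
destruct (Nat.le_exists_sub (S j) n Hj) as [r [-> _]].
rewrite qpoch_add, qpoch_recl, Cpow_add_r.
pose proof (Cpow_nz q r Hq); pose proof (Cpow_nz q (S j) Hq).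
replace (1 - q ^ S j / (q ^ r * q ^ S j) * q ^ r) with (RtoC 0) by (field; auto).
ring.
Qed.

Lemma aw_reduced_sum_0 (abcd ac bd q : C) (n j : nat) : (0 < Cmod q < 1)%R ->
  abcd = ac * bd -> ac <> 0 -> (Cmod ac < 1)%R -> (Cmod abcd < 1)%R -> (j < n)%nat ->
  csum (fun k => aw_reduced_coef n k abcd ac q * (qpoch ac q (k + j) / qpoch abcd q (k + j))) (S n) = 0.
Proof.
intros Hq E Hac Hac1 Habcd Hj; rewrite (aw_reduced_sum _ _ bd) by auto.
rewrite qpoch_root; [unfold Cdiv; ring | apply Cmod_gt_0, Hq | auto].
Qed.

Lemma qsgn_sq (q : C) (n : nat) : qsgn q n * qsgn q n * q ^ n = (q ^ n) ^ n.
Proof.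
induction n as [|n IH]; [simpl; ring|].
rewrite (Cpow_S (q ^ S n)), (Cpow_S q n), (Cpow_mult_l q), <- IH; cbn [qsgn]; ring.
Qed.

Section Orthogonality.
Variables a b c d q : C.
Hypothesis Hq : (0 < Cmod q < 1)%R.
Hypotheses (Ha0 : a <> 0) (Hc0 : c <> 0).
Hypotheses (Ha : (Cmod a < 1)%R) (Hb : (Cmod b < 1)%R) (Hc : (Cmod c < 1)%R) (Hd : (Cmod d < 1)%R).

Let Lt (x y : C) : (Cmod x < 1)%R -> (Cmod y < 1)%R -> (Cmod (x * y) < 1)%R.
Proof. intros Hx Hy; apply Cmod_mult_lt1; lra. Qed.

Lemma Ccontinuous_aw_poly (n : nat) (a' b' c' d' : C) :
  Ccontinuous (fun x => aw_poly n (expi x) a' b' c' d' q).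
Proof.
unfold aw_poly; apply Ccontinuous_mult; [apply Ccontinuous_const|].
apply (Ccontinuous_csum (fun k x => aw_coef n k a' b' c' d' q * aw_basis a' q (expi x) k)).
intros k; apply Ccontinuous_mult; auto using Ccontinuous_const, Ccontinuous_aw_basis.
Qed.

Definition aw_pair (n m : nat) : C :=
  CRInt 0 PI (fun x => aw_poly n (expi x) a b c d q * aw_poly m (expi x) c d a b q
                    * aw_weight a b c d q (expi x)).

Lemma aw_pair_double_sum (n m : nat) :
  aw_pair n m = aw_half a b c d q
   * (/ a ^ n * (qpoch (a * b) q n * qpoch (a * c) q n * qpoch (a * d) q n))
   * (/ c ^ m * (qpoch (c * d) q m * qpoch (c * a) q m * qpoch (c * b) q m))
   * csum (fun k => csum (fun j =>
       aw_reduced_coef n k (a * b * c * d) (a * c) q * aw_reduced_coef m j (a * b * c * d) (a * c) q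
       * (qpoch (a * c) q (k + j) / qpoch (a * b * c * d) q (k + j))) (S m)) (S n).
Proof.
pose proof (proj2 Hq) as Hq1.
set (Pa := / a ^ n * _); set (Pc := / c ^ m * _).
set (w := fun x => aw_weight a b c d q (expi x)).
assert (Cw : Ccontinuous w) by exact (proj1 (bounded_continuous_aw_weight a b c d q Hq1 Ha Hb Hc Hd)).
set (f := fun k j x => aw_basis a q (expi x) k * aw_basis c q (expi x) j * w x).
assert (Cf : forall k j, Ccontinuous (f k j)).
{ intros; apply Ccontinuous_mult; [apply Ccontinuous_mult; apply Ccontinuous_aw_basis | exact Cw]. }
transitivity (CRInt 0 PI (fun x => Pa * Pc * csum (fun k => csum (fun j =>
   (aw_coef n k a b c d q * aw_coef m j c d a b q) * f k j x) (S m)) (S n))).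
{ apply CRInt_ext; intros x; unfold aw_poly; fold Pa Pc; fold (w x).
  fold (aw_basis a q (expi x)).
  set (A := fun k => aw_coef n k a b c d q * aw_basis a q (expi x) k).
  set (B := fun j => aw_coef m j c d a b q * aw_basis c q (expi x) j).
  transitivity (Pa * csum A (S n) * (Pc * csum B (S m)) * w x); [reflexivity|].
  transitivity (Pa * Pc * (csum A (S n) * (csum B (S m) * w x))); [ring|].
  f_equal; rewrite <- csum_scal_r; apply csum_ext; intros k _.
  rewrite <- csum_scal_r, <- csum_scal; apply csum_ext; intros j _.
  unfold A, B, f; ring. }
assert (Cs : forall k, Ccontinuous (fun x => csum (fun j =>
   aw_coef n k a b c d q * aw_coef m j c d a b q * f k j x) (S m))).
{ intros k; apply (Ccontinuous_csum (fun j x => aw_coef n k a b c d q * aw_coef m j c d a b q * f k j x)).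
  intros j; apply Ccontinuous_mult; auto using Ccontinuous_const. }
rewrite CRInt_scal by now apply Ccontinuous_csum.
rewrite CRInt_csum by auto.
transitivity (Pa * Pc * (aw_half a b c d q * csum (fun k => csum (fun j =>
       aw_reduced_coef n k (a * b * c * d) (a * c) q * aw_reduced_coef m j (a * b * c * d) (a * c) q
       * (qpoch (a * c) q (k + j) / qpoch (a * b * c * d) q (k + j))) (S m)) (S n))); [|ring].
f_equal; rewrite <- csum_scal; apply csum_ext; intros k _.
rewrite <- csum_scal, CRInt_csum by (intros; apply Ccontinuous_mult; auto using Ccontinuous_const).
apply csum_ext; intros j _.
rewrite CRInt_scal by auto; unfold f, w; rewrite aw_moment by auto.
unfold aw_coef, aw_reduced_coef.
replace (c * d * a * b) with (a * b * c * d) by ring.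
rewrite (Cmult_comm c a).
assert (NZ : forall x i, (Cmod x < 1)%R -> qpoch x q i <> 0) by (intros; now apply qpoch_nz).
pose proof (NZ _ k (Lt _ _ Ha Hb)); pose proof (NZ _ k (Lt _ _ Ha Hc));
pose proof (NZ _ k (Lt _ _ Ha Hd)); pose proof (NZ _ j (Lt _ _ Hc Hd));
pose proof (NZ _ j (Lt _ _ Ha Hc)); pose proof (NZ _ j (Lt _ _ Hc Hb)).
pose proof (NZ _ k Hq1); pose proof (NZ _ j Hq1).
pose proof (NZ (a * b * c * d) (k + j)%nat ltac:(auto)).
field; repeat split; auto.
Qed.

(** Sum first over the index belonging to the polynomial of larger degree: the
    other index stays below that degree, so the inner sum vanishes. *)
Lemma aw_pair_off_diagonal (n m : nat) : n <> m -> aw_pair n m = 0.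
Proof.
intros Hnm; rewrite aw_pair_double_sum.
assert (E1 : a * b * c * d = a * c * (b * d)) by ring.
assert (N1 : a * c <> 0) by now apply Cmult_neq_0.
enough (E : forall P x : C, x = 0 -> P * x = 0); [apply E|intros P x ->; ring].
destruct (Nat.lt_gt_cases n m) as [[H | H] _]; [auto | |].
- apply csum_0; intros k Hk.
  transitivity (aw_reduced_coef n k (a * b * c * d) (a * c) q * csum (fun j =>
    aw_reduced_coef m j (a * b * c * d) (a * c) q
    * (qpoch (a * c) q (j + k) / qpoch (a * b * c * d) q (j + k))) (S m)).
  + rewrite <- csum_scal; apply csum_ext; intros j _; rewrite (Nat.add_comm j k); ring.
  + rewrite (aw_reduced_sum_0 _ _ (b * d)); auto; try lia; ring.
- rewrite csum_swap; apply csum_0; intros j Hj.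
  transitivity (aw_reduced_coef m j (a * b * c * d) (a * c) q * csum (fun k =>
    aw_reduced_coef n k (a * b * c * d) (a * c) q
    * (qpoch (a * c) q (k + j) / qpoch (a * b * c * d) q (k + j))) (S n)).
  + rewrite <- csum_scal; apply csum_ext; intros k _; ring.
  + rewrite (aw_reduced_sum_0 _ _ (b * d)); auto; try lia; ring.
Qed.

Lemma aw_pair_diagonal (n : nat) :
  aw_pair n n = aw_half a b c d q
   * (qpoch (a * b) q n * qpoch (a * c) q n * qpoch (a * d) q n)
   * (qpoch (c * d) q n * qpoch (c * b) q n * qpoch (b * d) q n)
   * qpoch q q n * qpoch (a * b * c * d * q ^ n / q) q n
   / (qpoch (a * b * c * d) q n * qpoch (a * b * c * d * q ^ n) q n).
Proof.
pose proof (proj2 Hq) as Hq1.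
assert (Hqn : q <> 0) by (apply Cmod_gt_0; apply Hq).
assert (E1 : a * b * c * d = a * c * (b * d)) by ring.
assert (N1 : a * c <> 0) by now apply Cmult_neq_0.
rewrite aw_pair_double_sum, csum_swap.
rewrite csum_last.
2: { intros j Hj.
  transitivity (aw_reduced_coef n j (a * b * c * d) (a * c) q * csum (fun k =>
    aw_reduced_coef n k (a * b * c * d) (a * c) q
    * (qpoch (a * c) q (k + j) / qpoch (a * b * c * d) q (k + j))) (S n)).
  - rewrite <- csum_scal; apply csum_ext; intros k _; ring.
  - rewrite (aw_reduced_sum_0 _ _ (b * d)); auto; ring. }
cbv beta.
match goal with |- ?P * csum ?f (S n) = _ =>
  transitivity (P * (aw_reduced_coef n n (a * b * c * d) (a * c) q * csum (fun k =>
    aw_reduced_coef n k (a * b * c * d) (a * c) q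
    * (qpoch (a * c) q (k + n) / qpoch (a * b * c * d) q (k + n))) (S n))) end.
{ f_equal; rewrite <- csum_scal; apply csum_ext; intros k _; ring. }
rewrite (aw_reduced_sum _ _ (b * d)) by auto.
pose proof (Cpow_nz q n Hqn).
replace (q ^ S n / q ^ n) with q by (simpl; field; auto).
unfold aw_reduced_coef.
pose proof (qpoch_neg_power q n n Hqn (le_n n)) as NP; rewrite Nat.sub_diag in NP.
pose proof (Cpow_nz (q ^ n) n (Cpow_nz q n Hqn)).
pose proof (Cpow_nz a n Ha0); pose proof (Cpow_nz c n Hc0).
replace (qpoch (/ q ^ n) q n) with (qpoch q q n * qsgn q n / (q ^ n) ^ n)
  by (rewrite <- NP; simpl; field; auto).
rewrite <- qsgn_sq in *.
pose proof (qsgn_nz q n Hqn).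
assert (NZ : forall x i, (Cmod x < 1)%R -> qpoch x q i <> 0) by (intros; now apply qpoch_nz).
pose proof (NZ _ n (Lt _ _ Ha Hc)).
pose proof (NZ _ n Hq1).
pose proof (NZ (a * b * c * d) n ltac:(auto)).
assert (qpoch (a * b * c * d * q ^ n) q n <> 0)
  by (apply NZ, Cmod_mult_lt1; auto using Cmod_pow_le1).
rewrite (Cmult_comm c a), (Cpow_mult_l a c).
field; repeat split; auto.
Qed.

End Orthogonality.

(** * Termwise integration of the generating function *)

Lemma csum_geometric (u : nat -> C) (K r : R) (n p : nat) :
  (0 <= r < 1)%R -> (forall i, (Cmod (u i) <= K * r ^ i)%R) ->
  (Cmod (csum u (n + p) - csum u n) <= K / (1 - r) * r ^ n)%R.
Proof.
intros Hr H.
assert (K0 : (0 <= K)%R) by (specialize (H O); simpl in H; pose proof (Cmod_ge_0 (u O)); lra).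
eapply Rle_trans; [apply (geometric_increments (csum u) K r n p Hr)|].
- intros m; simpl; replace (csum u m + u m - csum u m) with (u m) by ring; apply H.
- assert (0 <= r ^ n)%R by (apply pow_le; lra).
  assert (0 <= r ^ p)%R by (apply pow_le; lra).
  assert (0 < / (1 - r))%R by (apply Rinv_0_lt_compat; lra).
  assert (0 <= K * r ^ n * / (1 - r))%R by (repeat apply Rmult_le_pos; lra).
  unfold Rdiv; nra.
Qed.

Lemma CSeries_geometric {X : Type} (u : nat -> X -> C) (K r : R) :
  (0 <= r < 1)%R -> (forall i x, (Cmod (u i x) <= K * r ^ i)%R) ->
  ulim (fun n x => csum (fun i => u i x) n) (fun x => CSeries (fun i => u i x)) /\
  bounded (fun x => CSeries (fun i => u i x)).
Proof.
intros Hr H.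
assert (L : forall x, exists l, clim (csum (fun i => u i x)) l /\
   forall n, (Cmod (csum (fun i => u i x) n - l) <= K / (1 - r) * r ^ n)%R).
{ intros x; apply geometric_limit; auto.
  intros n; simpl; replace (csum (fun i => u i x) n + u n x - csum (fun i => u i x) n)
    with (u n x) by ring; apply H. }
assert (B : forall x n, (Cmod (csum (fun i => u i x) n - CSeries (fun i => u i x)) <= K / (1 - r) * r ^ n)%R).
{ intros x n; destruct (L x) as [l [L1 L2]]; rewrite (CSeries_eq _ _ L1); apply L2. }
split; [apply (ulim_tail _ _ (K / (1 - r)) r); auto|].
exists (K / (1 - r))%R; intros x; specialize (B x O); simpl in B.
replace (0 - CSeries (fun i => u i x)) with (- CSeries (fun i => u i x)) in B by ring.
rewrite Cmod_opp, Rmult_1_r in B; exact B.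
Qed.

(** The triangular partial sums of the product differ from the product of the
    partial sums by terms with i + j >= n. The two different rates r and r^2 make
    these terms summable with a bound proportional to r^n instead of n r^n. *)
Lemma cauchy_product {X : Type} (u v : nat -> X -> C) (K r : R) :
  (0 <= r < 1)%R ->
  (forall i x, (Cmod (u i x) <= K * r ^ i)%R) ->
  (forall i x, (Cmod (v i x) <= K * (r * r) ^ i)%R) ->
  ulim (fun n x => csum (fun m => csum (fun j => u (m - j)%nat x * v j x) (S m)) n)
    (fun x => CSeries (fun i => u i x) * CSeries (fun i => v i x)) /\
  bounded (fun x => CSeries (fun i => u i x) * CSeries (fun i => v i x)).
Proof.
intros Hr Hu Hv.
assert (Hr2 : (0 <= r * r < 1)%R) by nra.
destruct (CSeries_geometric u K r Hr Hu) as [U BU].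
destruct (CSeries_geometric v K (r * r) Hr2 Hv) as [V BV].
pose proof (ulim_mult _ _ _ _ BU BV U V) as P.
split; [|now apply bounded_mult].
(* Minus the part of the product of partial sums that lies outside the triangle. *)
set (D := fun n (x : X) => csum (fun k => v k x *
    - (csum (fun i => u i x) n - csum (fun i => u i x) (n - k))) n).
assert (LD : ulim D (fun _ => 0)).
{ apply (ulim_tail _ _ (K * (K / (1 - r)) / (1 - r)) r Hr).
  intros n x; replace (D n x - 0) with (D n x) by ring.
  set (C0 := (K / (1 - r))%R).
  assert (I0 : (0 < / (1 - r))%R) by (apply Rinv_0_lt_compat; lra).
  assert (K0 : (0 <= K)%R)
    by (specialize (Hu O x); simpl in Hu; pose proof (Cmod_ge_0 (u O x)); lra).
  assert (C00 : (0 <= C0)%R) by (apply Rmult_le_pos; lra).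
  unfold D; set (w := fun k => v k x * - (csum (fun i => u i x) n - csum (fun i => u i x) (n - k))).
  assert (Hw : forall k, (Cmod (w k) <= K * C0 * r ^ n * r ^ k)%R).
  { intros k; unfold w; rewrite Cmod_mult, Cmod_opp.
    assert (T : (Cmod (csum (fun i => u i x) n - csum (fun i => u i x) (n - k)) <= C0 * r ^ (n - k))%R).
    { replace n with ((n - k) + (n - (n - k)))%nat at 1 by lia.
      apply csum_geometric; auto. }
    apply Rle_trans with (K * (r * r) ^ k * (C0 * r ^ (n - k)))%R.
    - apply Rmult_le_compat; auto using Cmod_ge_0.
    - replace ((r * r) ^ k)%R with (r ^ k * r ^ k)%R by (now rewrite Rpow_mult_distr).
      assert (Q : (r ^ k * r ^ (n - k) <= r ^ n)%R).
      { destruct (Nat.le_gt_cases k n) as [G | G].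
        - right; rewrite <- pow_add; f_equal; lia.
        - replace (n - k)%nat with O by lia; replace k with (n + (k - n))%nat by lia.
          rewrite pow_add; simpl.
          assert (0 <= r ^ n)%R by (apply pow_le; lra).
          assert (r ^ (k - n) <= 1)%R by (rewrite <- (pow1 (k - n)); apply pow_incr; lra).
          nra. }
      assert (0 <= r ^ k)%R by (apply pow_le; lra).
      replace (K * (r ^ k * r ^ k) * (C0 * r ^ (n - k)))%R
        with (K * C0 * r ^ k * (r ^ k * r ^ (n - k)))%R by ring.
      replace (K * C0 * r ^ n * r ^ k)%R with (K * C0 * r ^ k * r ^ n)%R by ring.
      apply Rmult_le_compat_l; auto.
      apply Rmult_le_pos; [apply Rmult_le_pos|]; auto. }
  pose proof (csum_geometric w (K * C0 * r ^ n) r 0 n Hr Hw) as G; simpl in G.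
  replace (csum w n - 0) with (csum w n) in G by ring.
  eapply Rle_trans; [exact G|]; right; unfold Rdiv; ring. }
pose proof (ulim_plus _ _ _ _ P LD) as Q.
revert Q; apply ulim_ext; [|intros x; apply Cplus_0_r]; intros n x.
rewrite (csum_triangle (fun m j => u (m - j)%nat x * v j x)).
unfold D; rewrite <- csum_scal, <- csum_plus; apply csum_ext; intros k Hk.
transitivity (v k x * csum (fun i => u i x) (n - k)); [ring|].
rewrite <- csum_scal; apply csum_ext; intros i _.
replace (k + i - k)%nat with i by lia; ring.
Qed.

Lemma phi21_coef_bounded (a b q : C) : (0 < Cmod q < 1)%R -> (Cmod a < 1)%R ->
  (Cmod b < 1)%R ->
  exists K : R, forall i z, Cmod z = 1%R -> (Cmod (phi21_coef a b q z i) <= K)%R.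
Proof.
intros [Hq0 Hq] Ha Hb.
assert (Hab : (Cmod (a * b) < 1)%R) by (apply Cmod_mult_lt1; lra).
set (K1 := exp (1 / (1 - Cmod q))).
set (K2 := exp (Cmod q / (1 - Cmod q) / (1 - Cmod q))).
set (K3 := exp (Cmod (a * b) / (1 - Cmod (a * b)) / (1 - Cmod q))).
exists (K1 * K1 * (K2 * K3))%R; intros i z Hz.
assert (Z0 : z <> 0) by (apply Cmod_gt_0; lra).
pose proof (qpoch_nz q q i Hq Hq); pose proof (qpoch_nz _ q i Hq Hab).
unfold phi21_coef.
replace (qpoch (a * z) q i * qpoch (b * z) q i / (qpoch q q i * qpoch (a * b) q i) * (/ z) ^ i)
  with (qpoch (a * z) q i * qpoch (b * z) q i * (/ qpoch q q i * / qpoch (a * b) q i) * (/ z) ^ i)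
  by (field; auto).
rewrite !Cmod_mult, Cmod_pow, (Cmod_inv z), Hz, Rinv_1, pow1, Rmult_1_r by auto.
assert (Q : forall e, (Cmod e < 1)%R -> (Cmod (qpoch (e * z) q i) <= K1)%R).
{ intros e He; apply qpoch_le; auto; rewrite Cmod_mult, Hz; lra. }
assert (Q2 : (Cmod (/ qpoch q q i) <= K2)%R) by (apply Cinv_qpoch_le; auto; lra).
assert (Q3 : (Cmod (/ qpoch (a * b) q i) <= K3)%R) by (apply Cinv_qpoch_le; auto; lra).
apply Rmult_le_compat; try (apply Rmult_le_pos; apply Cmod_ge_0).
- apply Rmult_le_compat; auto using Cmod_ge_0.
- apply Rmult_le_compat; auto using Cmod_ge_0.
Qed.

Lemma qhyper_phi21 (a b q z t : C) :
  qhyper [a * z; b * z] [a * b] q (t * / z) = CSeries (fun i => phi21_coef a b q z i * t ^ i).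
Proof.
unfold qhyper; apply CSeries_ext; intros k.
unfold qpochs, phi21_coef; simpl; rewrite Cpow_mult_l.
unfold Cdiv; rewrite !Cmult_1_r; ring.
Qed.

Lemma CpowZ_opp_nat (x : C) (n : nat) : CpowZ x (- Z.of_nat n) = / x ^ n.
Proof.
destruct n as [|n]; [simpl; field; apply C1_nz|].
change (CpowZ x (- Z.of_nat (S n))) with (/ x ^ Pos.to_nat (Pos.of_succ_nat n)).
now rewrite SuccNat2Pos.id_succ.
Qed.

Lemma CpowZ_pred_nat (x : C) (n : nat) : x <> 0 -> CpowZ x (Z.of_nat n - 1) = x ^ n / x.
Proof.
intros Hx; destruct n as [|n].
- simpl; rewrite Cmult_1_r; field; auto.
- replace (Z.of_nat (S n) - 1)%Z with (Z.of_nat n) by lia.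
  replace (CpowZ x (Z.of_nat n)) with (x ^ n); [simpl; field; auto|].
  destruct n as [|n]; [reflexivity|].
  change (CpowZ x (Z.of_nat (S n))) with (x ^ Pos.to_nat (Pos.of_succ_nat n)).
  now rewrite SuccNat2Pos.id_succ.
Qed.

Lemma askey_wilson_poly (n : nat) (z a b c d q : C) : q <> 0 -> z <> 0 ->
  askey_wilson n ((z + / z) / 2) a b c d q = aw_poly n z a b c d q.
Proof.
intros Hq Hz; rewrite askey_wilsonE by auto.
unfold askey_wilson_z, aw_poly; rewrite !CpowZ_opp_nat, CpowZ_pred_nat by auto.
f_equal; [unfold qpochs; simpl; ring|].
unfold qhyper.
rewrite (CSeries_finite _ (S n)).
- apply csum_ext; intros k Hk.
  unfold qpochs, aw_coef; simpl.
  replace (q ^ n / q * (a * b * c * d)) with (a * b * c * d * q ^ n / q) by (field; auto).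
  unfold Cdiv; rewrite !Cmult_1_r, !Cmult_assoc; ring.
- intros k Hk; unfold qpochs; simpl.
  replace (qpoch (/ q ^ n) q k) with (RtoC 0); [unfold Cdiv; ring|].
  destruct (Nat.le_exists_sub (S n) k Hk) as [r [-> _]].
  rewrite Nat.add_comm, qpoch_add, qpoch_S.
  pose proof (Cpow_nz q n Hq).
  replace (1 - / q ^ n * q ^ n) with (RtoC 0) by (field; auto); ring.
Qed.

(** Both sides are (s1, -s1, s2, -s2; q)_n times the product of the
    1 - A q^(2i+1), because 1 - s1^2 q^(2i) = 1 - A q^(2i) and
    1 - s2^2 q^(2i) = 1 - A q^(2i+2). *)
Lemma qpoch_square_factors (A s1 s2 q : C) (n : nat) :
  s1 * s1 = A -> s2 * s2 = A * q * q ->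
  qpoch A q (2 * n) * (qpoch s2 q n * qpoch (- s2) q n)
  = qpoch (A * q) q (2 * n) * (qpoch s1 q n * qpoch (- s1) q n).
Proof.
intros E1 E2; induction n as [|n IH]; [simpl; ring|].
replace (2 * S n)%nat with (S (S (2 * n))) by lia.
rewrite !qpoch_S, !Cpow_S.
replace (q ^ (2 * n)) with (q ^ n * q ^ n) by (rewrite <- Cpow_add_r; f_equal; lia).
transitivity (qpoch A q (2 * n) * (qpoch s2 q n * qpoch (- s2) q n) *
  ((1 - A * (q ^ n * q ^ n)) * (1 - A * (q * (q ^ n * q ^ n))) * (1 - (s2 * s2) * (q ^ n * q ^ n))));
  [ring|].
rewrite IH, E2.
transitivity (qpoch (A * q) q (2 * n) * (qpoch s1 q n * qpoch (- s1) q n) *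
  ((1 - A * q * (q ^ n * q ^ n)) * (1 - A * q * (q * (q ^ n * q ^ n))) * (1 - (s1 * s1) * (q ^ n * q ^ n))));
  [|ring].
rewrite E1; ring.
Qed.

(** Only the term m = n of the generating function survives the integration. *)
Lemma aw_generating_integral (n : nat) (q t a b c d : C) :
  (0 < Cmod q < 1)%R -> a <> 0 -> b <> 0 -> c <> 0 -> d <> 0 -> (Cmod t < 1)%R ->
  (Cmod a < 1)%R -> (Cmod b < 1)%R -> (Cmod c < 1)%R -> (Cmod d < 1)%R ->
  is_RInt (V := C_R_NormedModule)
    (fun x => aw_poly n (expi x) a b c d q *
      (CSeries (fun i => phi21_coef a b q (expi x) i * t ^ i)
       * CSeries (fun j => phi21_coef c d q (/ expi x) j * t ^ j))
      * aw_weight a b c d q (expi x)) 0 PI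
    (t ^ n * aw_pair a b c d q n n / (qpoch q q n * qpoch (a * b) q n * qpoch (c * d) q n)).
Proof.
intros Hq Na Nb Nc Nd Ht Ha Hb Hc Hd; pose proof (proj2 Hq) as Hq1.
assert (Lt : forall x y, (Cmod x < 1)%R -> (Cmod y < 1)%R -> (Cmod (x * y) < 1)%R).
{ intros x y Hx Hy; apply Cmod_mult_lt1; lra. }
set (den := fun m => qpoch q q m * qpoch (a * b) q m * qpoch (c * d) q m).
set (u := fun i x => phi21_coef a b q (expi x) i * t ^ i).
set (v := fun j x => phi21_coef c d q (/ expi x) j * t ^ j).
destruct (bounded_continuous_aw_weight a b c d q Hq1 Ha Hb Hc Hd) as [Cw Bw].
set (w := fun x => aw_weight a b c d q (expi x)) in *.
set (p := fun x => aw_poly n (expi x) a b c d q).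
assert (Cp : Ccontinuous p) by apply Ccontinuous_aw_poly.
(* The rates r and r^2 = |t| of the two series are those of the Cauchy product. *)
set (r := sqrt (Cmod t)).
assert (Hrr : (r * r)%R = Cmod t) by (apply sqrt_sqrt, Cmod_ge_0).
assert (Hr0 : (0 <= r)%R) by apply sqrt_pos.
assert (Hr : (0 <= r < 1)%R) by (split; [auto | nra]).
assert (L : ulim (fun N x => csum (fun m => t ^ m / den m * aw_poly m (expi x) c d a b q) N)
   (fun x => CSeries (fun i => u i x) * CSeries (fun j => v j x)) /\
   bounded (fun x => CSeries (fun i => u i x) * CSeries (fun j => v j x))).
{ destruct (phi21_coef_bounded a b q Hq Ha Hb) as [K1 HK1].
  destruct (phi21_coef_bounded c d q Hq Hc Hd) as [K2 HK2].
  set (K := Rmax K1 K2).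
  assert (T0 : forall i, (0 <= Cmod t ^ i)%R) by (intros; apply pow_le, Cmod_ge_0).
  assert (Ex : forall x, Cmod (/ expi x) = 1%R)
    by (intros; rewrite Cmod_inv, Cmod_expi by apply expi_nz; field).
  assert (K0 : (0 <= K)%R).
  { apply Rle_trans with K1; [|apply Rmax_l].
    eapply Rle_trans; [apply Cmod_ge_0 | apply (HK1 O (expi 0)), Cmod_expi]. }
  assert (Bu : forall i x, (Cmod (u i x) <= K * Cmod t ^ i)%R).
  { intros i x; unfold u; rewrite Cmod_mult, Cmod_pow; apply Rmult_le_compat_r; auto.
    eapply Rle_trans; [apply HK1, Cmod_expi | apply Rmax_l]. }
  assert (Bv : forall i x, (Cmod (v i x) <= K * Cmod t ^ i)%R).
  { intros i x; unfold v; rewrite Cmod_mult, Cmod_pow; apply Rmult_le_compat_r; auto.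
    eapply Rle_trans; [apply HK2, Ex | apply Rmax_r]. }
  assert (Htr : (Cmod t <= r)%R) by (rewrite <- Hrr; nra).
  destruct (cauchy_product u v K r Hr) as [CP BP].
  { intros i x; eapply Rle_trans; [apply Bu|].
    apply Rmult_le_compat_l; auto; apply pow_incr; auto using Cmod_ge_0. }
  { rewrite Hrr; apply Bv. }
  split; [clear BP|exact BP].
  revert CP;apply ulim_ext; [|auto]; intros N x; apply csum_ext; intros m _.
  transitivity (t ^ m * csum (fun j => phi21_coef a b q (expi x) (m - j) * phi21_coef c d q (/ expi x) j) (S m)).
  - rewrite <- csum_scal; apply csum_ext; intros j Hj; unfold u, v.
    replace (t ^ m) with (t ^ (m - j) * t ^ j) by (rewrite <- Cpow_add_r; f_equal; lia).
    ring.
  - rewrite phi21_product_coef; auto using expi_nz.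
    + fold (den m); unfold Cdiv; ring.
    + rewrite Cmod_mult, Cmod_expi, Rmult_1_r; auto. }
set (F := fun x => p x * (CSeries (fun i => u i x) * CSeries (fun j => v j x)) * w x).
set (f := fun N x => csum (fun m => t ^ m / den m * (p x * aw_poly m (expi x) c d a b q * w x)) N).
assert (Bp : bounded p).
{ unfold p, aw_poly; apply bounded_mult; [apply bounded_const|].
  set (A := fun k (x : R) => aw_coef n k a b c d q * (qpoch (a * expi x) q k * qpoch (a / expi x) q k)).
  assert (BA : forall k, bounded (A k)).
  { intros k; apply bounded_mult; [apply bounded_const|]; apply bounded_mult.
    - exists (exp (Cmod a / (1 - Cmod q))); intros x; apply qpoch_le; auto.
      rewrite Cmod_mult_expi; lra.
    - exists (exp (Cmod a / (1 - Cmod q))); intros x; apply qpoch_le; auto.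
      rewrite Cmod_div_expi; lra. }
  change (bounded (fun x => csum (fun k => A k x) (S n))).
  generalize (S n); intros M; induction M as [|M IH]; simpl; [apply bounded_const|].
  now apply bounded_plus. }
destruct L as [L BUV].
assert (Cterm : forall m, Ccontinuous (fun x => p x * aw_poly m (expi x) c d a b q * w x)).
{ intros m; apply Ccontinuous_mult; [apply Ccontinuous_mult; [exact Cp | apply Ccontinuous_aw_poly] | exact Cw]. }
assert (Cf : forall N, Ccontinuous (f N)).
{ intros N; unfold f.
  apply (Ccontinuous_csum (fun m x => t ^ m / den m * (p x * aw_poly m (expi x) c d a b q * w x))).
  intros m; apply Ccontinuous_mult; [apply Ccontinuous_const | apply Cterm]. }
assert (LF : ulim f F).
{ apply (ulim_ext (fun N x => (p x * w x) * csum (fun m => t ^ m / den m * aw_poly m (expi x) c d a b q) N)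
    _ (fun x => (p x * w x) * (CSeries (fun i => u i x) * CSeries (fun j => v j x)))).
  - intros N x; unfold f; rewrite <- csum_scal; apply csum_ext; intros m _; ring.
  - intros x; unfold F; ring.
  - apply ulim_mult; [now apply bounded_mult | exact BUV | apply ulim_const | exact L]. }
assert (EF : CRInt 0 PI F = t ^ n / den n * aw_pair a b c d q n n).
{ apply (clim_unique (fun N => CRInt 0 PI (f N))).
  - apply CRInt_ulim; auto; pose proof PI_RGT_0; lra.
  - intros eps He; exists (S n); intros N HN _.
    replace (CRInt 0 PI (f N)) with (t ^ n / den n * aw_pair a b c d q n n).
    { replace (t ^ n / den n * aw_pair a b c d q n n - t ^ n / den n * aw_pair a b c d q n n)
        with (RtoC 0) by ring.
      rewrite Cmod_0; auto. }
    unfold f.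
    rewrite (CRInt_csum 0 PI (fun m x => t ^ m / den m * (p x * aw_poly m (expi x) c d a b q * w x))).
    + assert (Em : forall m, CRInt 0 PI (fun x => t ^ m / den m * (p x * aw_poly m (expi x) c d a b q * w x))
        = t ^ m / den m * aw_pair a b c d q n m) by (intros m; now rewrite CRInt_scal).
      rewrite (csum_single _ n); [now rewrite Em | lia|].
      intros m Hm; rewrite Em, aw_pair_off_diagonal by auto; ring.
    + intros m; apply Ccontinuous_mult; [apply Ccontinuous_const | apply Cterm]. }
replace (t ^ n * aw_pair a b c d q n n / (qpoch q q n * qpoch (a * b) q n * qpoch (c * d) q n))
  with (CRInt 0 PI F) by (rewrite EF; unfold den, Cdiv; ring).
apply CRInt_correct, (Ccontinuous_ulim f F LF Cf).
Qed.

Theorem theorem7p1 :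
  forall (n : nat) (q t a b c d s1 s2 : C),
    (0 < Cmod q < 1)%R ->
    t <> 0 -> a <> 0 -> b <> 0 -> c <> 0 -> d <> 0 ->
    (Cmod t < 1)%R ->
    (Rmax (Rmax (Cmod a) (Cmod b)) (Rmax (Cmod c) (Cmod d)) < 1)%R ->
    (* s1 and s2 are arbitrary square roots of abcd/q and qabcd *)
    s1 ^ 2 = a * b * c * d / q ->
    s2 ^ 2 = q * a * b * c * d ->
    qpochs [a * b * c * d / q; s2; - s2] q n <> 0 ->
    is_RInt (V := C_R_NormedModule)
      (fun psi : R =>
         let z := expi psi in
         askey_wilson n (cos psi) a b c d q
         * qhyper [a * z; b * z] [a * b] q (t / z)
         * qhyper [c / z; d / z] [c * d] q (t * z)
         * (qpochs_inf [z ^ 2; / z ^ 2] q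
            / qpochs_inf [a * z; a * / z; b * z; b * / z;
                          c * z; c * / z; d * z; d * / z] q))
      0 PI
      (2 * PI * t ^ n * qpoch_inf (a * b * c * d) q
       * qpochs [s1; - s1; a * c; a * d; b * c; b * d] q n
       / (qpochs_inf [q; a * b; a * c; a * d; b * c; b * d; c * d] q
          * qpochs [a * b * c * d / q; s2; - s2] q n)).
Proof.
intros n q t a b c d s1 s2 Hq Nt Na Nb Nc Nd Ht Hmax E1 E2 ND.
pose proof (proj2 Hq) as Hq1.
assert (Nq : q <> 0) by (apply Cmod_gt_0, Hq).
assert (Hall : (Cmod a < 1 /\ Cmod b < 1 /\ Cmod c < 1 /\ Cmod d < 1)%R).
{ apply Rmax_Rlt in Hmax; destruct Hmax as [M1 M2].
  apply Rmax_Rlt in M1; apply Rmax_Rlt in M2; tauto. }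
destruct Hall as (Ha & Hb & Hc & Hd).
assert (Lt : forall x y, (Cmod x < 1)%R -> (Cmod y < 1)%R -> (Cmod (x * y) < 1)%R).
{ intros x y Hx Hy; apply Cmod_mult_lt1; lra. }
pose proof (aw_generating_integral n q t a b c d Hq Na Nb Nc Nd Ht Ha Hb Hc Hd) as I.
match type of I with is_RInt _ _ _ ?v => match goal with |- is_RInt _ _ _ ?v' =>
  replace v' with v end end.
- revert I; apply is_RInt_ext; intros x _; cbv zeta.
  pose proof (expi_nz x) as Nz.
  assert (Ecos : RtoC (cos x) = (expi x + / expi x) / 2).
  { rewrite <- expi_opp; apply injective_projections; simpl;
      rewrite cos_neg, sin_neg; field. }
  rewrite Ecos, askey_wilson_poly by auto.
  rewrite <- qhyper_phi21.
  rewrite <- (qhyper_phi21 c d q (/ expi x) t).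
  replace (/ / expi x) with (expi x) by (field; auto).
  change (t * / expi x) with (t / expi x).
  change (c * / expi x) with (c / expi x); change (d * / expi x) with (d / expi x).
  change (a * / expi x) with (a / expi x); change (b * / expi x) with (b / expi x).
  assert (Ew : aw_weight a b c d q (expi x) =
    qpochs_inf [expi x ^ 2; / expi x ^ 2] q / qpochs_inf [a * expi x; a / expi x; b * expi x;
       b / expi x; c * expi x; c / expi x; d * expi x; d / expi x] q).
  { unfold aw_weight, weight_factor, qpochs_inf; cbn [fold_right]; f_equal; ring. }
  rewrite Ew; match goal with |- ?X = ?Y => change (@eq C X Y) end; ring.
- rewrite aw_pair_diagonal, askey_wilson_integral by auto.
  set (A := a * b * c * d / q) in *.
  assert (EA : a * b * c * d = A * q) by (unfold A; field; auto).
  assert (HA : (Cmod (A * q) < 1)%R) by (rewrite <- EA; auto).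
  unfold qpochs, qpochs_inf in *; cbn [fold_right] in *.
  assert (NA : qpoch A q n <> 0) by (intros Z; apply ND; rewrite Z; ring).
  assert (N2 : qpoch s2 q n <> 0) by (intros Z; apply ND; rewrite Z; ring).
  assert (N3 : qpoch (- s2) q n <> 0) by (intros Z; apply ND; rewrite Z; ring).
  assert (Sq : qpoch A q n * qpoch (A * q ^ n) q n * (qpoch s2 q n * qpoch (- s2) q n)
    = qpoch (A * q) q n * qpoch (A * q * q ^ n) q n * (qpoch s1 q n * qpoch (- s1) q n)).
  { rewrite <- !qpoch_add; replace (n + n)%nat with (2 * n)%nat by lia.
    apply qpoch_square_factors.
    - rewrite <- E1; ring.
    - replace (s2 * s2) with (s2 ^ 2) by ring; rewrite E2.
      replace (q * a * b * c * d) with (q * (a * b * c * d)) by ring; rewrite EA; ring. }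
  rewrite EA.
  replace (A * q * q ^ n / q) with (A * q ^ n) by (field; auto).
  pose proof (qpoch_nz (A * q) q n Hq1 HA) as N4.
  assert (N5 : qpoch (A * q * q ^ n) q n <> 0)
    by (apply qpoch_nz; auto; apply Cmod_mult_lt1; auto using Cmod_pow_le1).
  replace (qpoch s1 q n * (qpoch (- s1) q n * (qpoch (a * c) q n * (qpoch (a * d) q n
     * (qpoch (b * c) q n * (qpoch (b * d) q n * 1))))))
    with ((qpoch A q n * qpoch (A * q ^ n) q n * (qpoch s2 q n * qpoch (- s2) q n))
     / (qpoch (A * q) q n * qpoch (A * q * q ^ n) q n)
     * (qpoch (a * c) q n * qpoch (a * d) q n * qpoch (b * c) q n * qpoch (b * d) q n))
    by (rewrite Sq; field; auto).
  rewrite (Cmult_comm c b).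
  assert (NI : forall x y, (Cmod x < 1)%R -> (Cmod y < 1)%R ->
    qpoch_inf (x * y) q <> 0 /\ qpoch (x * y) q n <> 0).
  { intros; split; [apply qpoch_inf_nz | apply qpoch_nz]; auto. }
  pose proof (qpoch_inf_nz q q Hq1 Hq1); pose proof (qpoch_nz q q n Hq1 Hq1).
  destruct (NI a b Ha Hb), (NI a c Ha Hc), (NI a d Ha Hd), (NI b c Hb Hc),
    (NI b d Hb Hd), (NI c d Hc Hd).
  field; repeat split; auto.
Qed.
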